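(* Let $R$ be an integral domain of characteristic different from $2$, let $q\in R^\times\setminus\{\pm1\}$ with $q+q^{-1}\in R^\times$, let $n\ge 1$, $m\ge 0$, $\underline{Q}=(Q_1,\dots,Q_m)\in(R^\times)^m$ and $\bullet\in\{\mathsf{0},\mathsf{s}\}$. Let $f=f^{(\bullet)}_{\underline{Q}}$, let $r=\deg f$, and let $\mathcal{H}^f_c(n)$ be the cyclotomic Hecke-Clifford algebra over $R$ with standard Frobenius form $\tau_{r,n}:\mathcal{H}^f_c(n)\to R$. (i) If $\bullet=\mathsf{0}$, then $\mathcal{H}^f_c(n)$ is supersymmetric with supersymmetrizing form $$t_{r,n}:=\tau_{r,n}\bigl(-\cdot (X_1X_2\cdots X_n)^{m}\bigr).$$ (ii) If $\bullet=\mathsf{s}$ and $(1+X_1)(1+X_2)\cdots(1+X_n)$ is invertible in $\mathcal{H}^f_c(n)$, then $\mathcal{H}^f_c(n)$ is symmetric with symmetrizing form $$t_{r,n}:=\tau_{r,n}\bigl(-\cdot (X_1X_2\cdots X_n)^{m}(1+X_1)(1+X_2)\cdots(1+X_n)\bigr).$$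
   Context: Superalgebra means $\mathbb{Z}_2$-graded associative algebra; $|x|$ is the parity of a homogeneous element $x$. Let $\mathcal{A}$ be an $R$-superalgebra, free of finite rank over $R$. An $R$-linear map $t:\mathcal{A}\to R$ is non-degenerate if there is a homogeneous basis $\mathcal{B}$ with $\det(t(b_1b_2))_{b_1,b_2\in\mathcal{B}}\in R^\times$; it is even if it vanishes on odd elements. $\mathcal{A}$ is symmetric with symmetrizing form $t$ if $t$ is even, non-degenerate and $t(xy)=t(yx)$ for all $x,y$. $\mathcal{A}$ is supersymmetric with supersymmetrizing form $t$ if $t$ is even, non-degenerate and $t(xy)=(-1)^{|x||y|}t(yx)$ for all homogeneous $x,y$. Put $\epsilon=q-q^{-1}$. The affine Hecke-Clifford algebra $\mathcal{H}_c(n)$ is the $R$-superalgebra with even generators $T_1,\dots,T_{n-1},X_1^{\pm1},\dots,X_n^{\pm1}$, odd generators $C_1,\dots,C_n$ and relations: $T_i^2=\epsilon T_i+1$; $T_iT_j=T_jT_i$ for $|i-j|>1$; $T_iT_{i+1}T_i=T_{i+1}T_iT_{i+1}$; $X_iX_j=X_jX_i$, $X_iX_i^{-1}=X_i^{-1}X_i=1$; $C_i^2=1$, $C_iC_j=-C_jC_i$ for $i\ne j$; $T_iX_i=X_{i+1}T_i-\epsilon(X_{i+1}+C_iC_{i+1}X_i)$; $T_iX_{i+1}=X_iT_i+\epsilon(1-C_iC_{i+1})X_{i+1}$; $T_iX_j=X_jT_i$ for $j\ne i,i+1$; $T_iC_i=C_{i+1}T_i$; $T_iC_{i+1}=C_iT_i-\epsilon(C_i-C_{i+1})$;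 $T_iC_j=C_jT_i$ for $j\ne i,i+1$; $X_iC_i=C_iX_i^{-1}$; $X_iC_j=C_jX_i$ for $i\neq j$. For $\iota\in R^\times$ put $\mathtt{q}(\iota)=2\,\frac{q\iota+(q\iota)^{-1}}{q+q^{-1}}$. Let $f^{(\mathsf 0)}_{\underline{Q}}=\prod_{i=1}^m(X_1+X_1^{-1}-\mathtt{q}(Q_i))$ (with $\deg f=2m$) and $f^{(\mathsf s)}_{\underline{Q}}=(X_1-1)\prod_{i=1}^m(X_1+X_1^{-1}-\mathtt{q}(Q_i))$ (with $\deg f=2m+1$). Then $\mathcal{H}^f_c(n)=\mathcal{H}_c(n)/\langle f(X_1)\rangle$; it is $R$-free with basis $X^\alpha C^\beta T_w$, $\alpha\in\{0,\dots,r-1\}^n$, $\beta\in\mathbb{Z}_2^n$, $w\in\mathfrak{S}_n$ (where $X^\alpha=X_1^{\alpha_1}\cdots X_n^{\alpha_n}$, $C^\beta=C_1^{\beta_1}\cdots C_n^{\beta_n}$). Standard Frobenius form: with $\mathcal{H}^f_c(n-1)\subset\mathcal{H}^f_c(n)$ the natural subalgebra ($\mathcal{H}^f_c(0)=R$), there is a (Mackey) decomposition $\mathcal{H}^f_c(n)=\mathcal{H}^f_c(n-1)T_{n-1}\mathcal{H}^f_c(n-1)\oplus\bigoplus_{0\le k\le r-1,\,a\in\mathbb{Z}_2}X_n^kC_n^a\mathcal{H}^f_c(n-1)$ (the first summand is absent for $n=1$), in which each $X_n^kC_n^a\mathcal{H}^f_c(n-1)$ is free of rank one as a right $\mathcal{H}^f_c(n-1)$-module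 on $X_n^kC_n^a$. Let $\varepsilon_n:\mathcal{H}^f_c(n)\to\mathcal{H}^f_c(n-1)$ be the projection onto the summand $k=0,a=\bar0$. Then $\tau_{r,n}=\varepsilon_1\circ\cdots\circ\varepsilon_n$. The notation $\tau_{r,n}(-\cdot z)$ means $h\mapsto\tau_{r,n}(hz)$. *)

(* Defs.v *)
From HB Require Import structures.
From mathcomp Require Import all_boot all_algebra.
From mathcomp Require Import finmap boolp monalg.

Set Implicit Arguments.
Unset Strict Implicit.
Unset Printing Implicit Defensive.

Import GRing.Theory.
Local Open Scope ring_scope.
Local Open Scope quotient_scope.

(* R-superalgebras. MathComp's algType excludes the zero algebra, which does
   occur below (f = 1 if m = 0 and there is no factor X_1 - 1), so we build on
   pzRingType. In [homog p x] (x is homogeneous of parity p) true means odd. *)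
HB.mixin Record isSuperAlgebra (R : comNzRingType) A of GRing.PzRing A := {
  sscale : R -> A -> A;
  sscaleA : forall a b x, sscale a (sscale b x) = sscale (a * b) x;
  sscale1 : left_id 1 sscale;
  sscaleDr : right_distributive sscale +%R;
  sscaleDl : forall x, {morph sscale^~ x : a b / a + b};
  sscaleAl : forall a x y, sscale a (x * y) = sscale a x * y;
  sscaleAr : forall a x y, sscale a (x * y) = x * sscale a y;
  homog : bool -> A -> Prop;
  homog0 : forall p, homog p 0;
  homogP : forall p a x y, homog p x -> homog p y -> homog p (sscale a x + y);
  homog1 : homog false 1;
  homogM : forall p r x y, homog p x -> homog r y -> homog (p (+) r) (x * y);
  homog_split : forall x, exists x0 x1,
    [/\ homog false x0, homog true x1 & x = x0 + x1];
  homog_dir : forall x0 x1,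
    homog false x0 -> homog true x1 -> x0 + x1 = 0 -> x0 = 0
}.

#[short(type="superAlgType")]
HB.structure Definition SuperAlgebra (R : comNzRingType) :=
  {A of GRing.PzRing A & isSuperAlgebra R A}.

HB.instance Definition _ (R : comNzRingType) (A : superAlgType R) :=
  GRing.Zmodule_isLmodule.Build R (@SuperAlgebra.sort R A)
    sscaleA sscale1 sscaleDr sscaleDl.

Arguments homogM {_ _ _ _ _ _}.
Arguments homogP {_ _ _ _ _ _}.
Arguments homog_dir {_ _ _ _}.

Section SuperTheory.
Variables (R : comNzRingType) (A : superAlgType R).
Implicit Types (x y : A) (a : R).

Lemma sscaleE a x : sscale a x = a *: x. Proof. by []. Qed.

Lemma super_scalerAl a x y : a *: (x * y) = (a *: x) * y.
Proof. exact: sscaleAl. Qed.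

Lemma super_scalerAr a x y : a *: (x * y) = x * (a *: y).
Proof. exact: sscaleAr. Qed.

Lemma homogD p x y : homog p x -> homog p y -> homog p (x + y).
Proof. by move=> hx hy; rewrite -[x]scale1r; apply: homogP. Qed.

Lemma homogZ p a x : homog p x -> homog p (a *: x).
Proof. by move=> hx; rewrite -[_ *: _]addr0; apply/homogP/homog0. Qed.

Lemma homogN p x : homog p x -> homog p (- x).
Proof. by move=> hx; rewrite -scaleN1r; apply: homogZ. Qed.

Lemma homogB p x y : homog p x -> homog p y -> homog p (x - y).
Proof. by move=> hx /homogN; apply: homogD. Qed.

Lemma homog_eq p x0 x1 y0 y1 : homog p x0 -> homog (~~ p) x1 ->
  homog p y0 -> homog (~~ p) y1 -> x0 + x1 = y0 + y1 -> x0 = y0.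
Proof.
move=> hx0 hx1 hy0 hy1 e; apply/eqP; rewrite -subr_eq0; apply/eqP.
have e0 : (x0 - y0) + (x1 - y1) = 0 by rewrite addrACA -opprD e subrr.
have h0 := homogB hx0 hy0; have h1 := homogB hx1 hy1.
case: p h0 h1 {hx0 hx1 hy0 hy1} => /= h0 h1; last exact: homog_dir e0.
have z1 : x1 - y1 = 0 by apply: homog_dir h1 h0 _; rewrite addrC.
by rewrite -e0 z1 addr0.
Qed.

Definition is_basis (d : nat) (b : 'I_d -> A) : Prop :=
  forall x, exists! c : {ffun 'I_d -> R}, x = \sum_i c i *: b i.

End SuperTheory.

Section Forms.
Variables (R : comUnitRingType) (A : superAlgType R) (t : A -> R).

Definition nondegenerate : Prop :=
  exists (d : nat) (b : 'I_d -> A),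
    [/\ is_basis b, (forall i, exists p, homog p (b i))
      & \det (\matrix_(i, j) t (b i * b j)) \is a GRing.unit].

Definition even_form : Prop := forall x, homog true x -> t x = 0.

Definition symmetrizing_form : Prop :=
  [/\ scalar t, even_form, nondegenerate & forall x y, t (x * y) = t (y * x)].

Definition supersymmetrizing_form : Prop :=
  [/\ scalar t, even_form, nondegenerate
    & forall p r x y, homog p x -> homog r y ->
        t (x * y) = (-1) ^+ (p && r) * t (y * x)].

End Forms.

(* R is purely even. *)
Section BaseRing.
Variable R : comNzRingType.

Definition base_homog (p : bool) (x : R^o) : Prop := p -> x = 0.

Fact base_homog0 p : base_homog p 0. Proof. by []. Qed.

Fact base_homogP p (a : R) (x y : R^o) :
  base_homog p x -> base_homog p y -> base_homog p (a *: x + y).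
Proof. by move=> hx hy hp; rewrite hx // hy // scaler0 addr0. Qed.

Fact base_homog1 : base_homog false 1. Proof. by []. Qed.

Fact base_homogM p r (x y : R^o) :
  base_homog p x -> base_homog r y -> base_homog (p (+) r) (x * y).
Proof.
case: p r => [] [] //= hx hy; first by move=> _; rewrite hx // mul0r.
by move=> _; rewrite hy // mulr0.
Qed.

Fact base_split (x : R^o) : exists x0 x1 : R^o,
  [/\ base_homog false x0, base_homog true x1 & x = x0 + x1].
Proof. by exists x, 0; split=> //; rewrite addr0. Qed.

Fact base_dir (x0 x1 : R^o) :
  base_homog false x0 -> base_homog true x1 -> x0 + x1 = 0 -> x0 = 0.
Proof. by move=> _ -> //; rewrite addr0. Qed.

Fact base_scalerAr (a : R) (x y : R^o) : a *: (x * y) = x * (a *: y).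
Proof. exact: mulrCA. Qed.

HB.instance Definition _ := isSuperAlgebra.Build R R^o
  (@scalerA R R^o) (@scale1r R R^o) (@scalerDr R R^o) (@scalerDl R R^o)
  (@scalerAl R R^o) base_scalerAr
  base_homog0 base_homogP base_homog1 base_homogM base_split base_dir.

End BaseRing.

(* The free superalgebra on a set G of generators with parities par. *)
Section Free.
Variables (R : comNzRingType) (G : choiceType) (par : G -> bool).

Definition free_alg : Type := let _ := par in {malg R[{fmonom G}]}.
HB.instance Definition _ := GRing.NzRing.on free_alg.
HB.instance Definition _ := GRing.Lmodule.on free_alg.
Implicit Types (x y : free_alg) (w : {fmonom G}) (g : G).

Definition free_gen g : free_alg := << fmu g >>.

Definition wpar w : bool := odd (count par w).

Definition free_homog (p : bool) x : Prop :=
  forall w, x@_w != 0 -> wpar w = p.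

Fact free_scalerAl (a : R) x y : a *: (x * y) = (a *: x) * y.
Proof. exact: (@fgscaleAl {fmonom G} R a x y). Qed.

Fact free_scalerAr (a : R) x y : a *: (x * y) = x * (a *: y).
Proof.
have H := @mul_malgC {fmonom G} R.
have comC (z : {malg R[{fmonom G}]}) :
    (a%:MP : {malg R[{fmonom G}]}) * z = z * a%:MP.
  rewrite !malgM_def fgmulUg fgmulgU; apply: eq_bigr => w _.
  by rewrite mulrC mul1m mulm1.
by rewrite -[LHS]H -[a *: y]H !mulrA comC.
Qed.

Fact free_homog0 p : free_homog p 0.
Proof. by move=> w; rewrite mcoeff0 eqxx. Qed.

Fact free_homogP p (a : R) x y :
  free_homog p x -> free_homog p y -> free_homog p (a *: x + y).
Proof.
move=> hx hy w; rewrite mcoeffD mcoeffZ => nz.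
have [x0|] := eqVneq x@_w 0; last exact: hx.
by apply: hy; move: nz; rewrite x0 mulr0 add0r.
Qed.

Fact free_homog1 : free_homog false 1.
Proof.
move=> w; rewrite mcoeff1; case: (w =P mone) => [-> _|]; last by rewrite eqxx.
by rewrite /wpar fm1.
Qed.

Fact free_homogM p r x y :
  free_homog p x -> free_homog r y -> free_homog (p (+) r) (x * y).
Proof.
move=> hx hy w; rewrite mcoeff_neq0 => /msuppM_le [w1 [w2 []]].
rewrite -!mcoeff_neq0 => /hx e1 /hy e2 ->.
by rewrite /wpar fmM count_cat oddD -/(wpar w1) -/(wpar w2) e1 e2.
Qed.

Definition free_part (p : bool) x : free_alg :=
  \sum_(w <- msupp x | wpar w == p) << x@_w *g w >>.

Fact free_part_homog p x : free_homog p (free_part p x).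
Proof.
apply: (big_ind (free_homog p)) => [|u v hu hv|w /eqP wp].
- exact: free_homog0.
- by rewrite -[u]scale1r; apply: free_homogP.
- move=> w'; rewrite mcoeffU; case: (w =P w') => [<-|] //.
  by rewrite eqxx.
Qed.

Fact free_split x : exists x0 x1 : free_alg,
  [/\ free_homog false x0, free_homog true x1 & x = x0 + x1].
Proof.
exists (free_part false x), (free_part true x); split;
  [exact: free_part_homog|exact: free_part_homog|].
rewrite {1}[x]monalgE (bigID (fun w => wpar w == false)) /=; congr (_ + _).
by apply: eq_bigl => w; case: (wpar w).
Qed.

Fact free_dir (x0 x1 : free_alg) :
  free_homog false x0 -> free_homog true x1 -> x0 + x1 = 0 -> x0 = 0.
Proof.
move=> h0 h1 /malgP e; apply/malgP => w; rewrite mcoeff0.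
have := e w; rewrite mcoeffD mcoeff0.
have [-> //|/h0 w0] := eqVneq x0@_w 0.
have [-> |/h1] := eqVneq x1@_w 0; first by rewrite addr0.
by rewrite w0.
Qed.

HB.instance Definition _ := isSuperAlgebra.Build R free_alg
  (@scalerA R free_alg) (@scale1r R free_alg) (@scalerDr R free_alg)
  (@scalerDl R free_alg) free_scalerAl free_scalerAr
  free_homog0 free_homogP free_homog1 free_homogM free_split free_dir.

Lemma free_gen_homog g : homog (par g) (free_gen g).
Proof.
move=> w; rewrite mcoeffU; case: (_ =P w) => [<- _|]; last by rewrite eqxx.
by rewrite /wpar fmU /= addn0 oddb.
Qed.

Section Eval.
Variables (B : superAlgType R) (v : G -> B).

Definition free_eval x : B :=
  \sum_(w <- msupp x) x@_w *: \prod_(g <- w : seq G) v g.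

Lemma free_evalw (d : {fset {fmonom G}}) x : (msupp x `<=` d)%fset ->
  free_eval x = \sum_(w <- d) x@_w *: \prod_(g <- w : seq G) v g.
Proof.
move=> le; rewrite /free_eval (big_fset_incl _ le) // => w _ /mcoeff_outdom ->.
by rewrite scale0r.
Qed.

Lemma free_evalU (a : R) w :
  free_eval << a *g w >> = a *: \prod_(g <- w : seq G) v g.
Proof. by rewrite (free_evalw msuppU_le) big_seq_fset1 mcoeffUU. Qed.

Lemma free_eval_linear : linear free_eval.
Proof.
move=> a x y.
pose d := (msupp (a *: x + y) `|` (msupp x `|` msupp y))%fset.
rewrite !(@free_evalw d); last first.
- exact: fsubsetUl.
- by rewrite fsubsetU // fsubsetUl orbT.
- by rewrite fsubsetU // fsubsetUr orbT.
rewrite scaler_sumr -big_split /=; apply: eq_bigr => w _.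
by rewrite mcoeffD mcoeffZ scalerDl scalerA.
Qed.

HB.instance Definition _ := GRing.isLinear.Build R free_alg B *:%R free_eval
  free_eval_linear.

Lemma free_eval_gen g : free_eval (free_gen g) = v g.
Proof. by rewrite free_evalU scale1r fmU big_seq1. Qed.

Lemma free_eval1 : free_eval 1 = 1.
Proof. by rewrite free_evalU scale1r fm1 big_nil. Qed.

Lemma free_evalM : {morph free_eval : x y / x * y}.
Proof.
move=> x y; rewrite malgME raddf_sum /= [in RHS]/free_eval mulr_suml.
apply: eq_bigr => w1 _; rewrite raddf_sum /= mulr_sumr; apply: eq_bigr => w2 _.
by rewrite free_evalU fmM big_cat /= -super_scalerAl -super_scalerAr scalerA.
Qed.

End Eval.
End Free.

(* The quotient A / <S> by the two-sided ideal generated by a set S of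
   homogeneous elements. *)
Record homset (R : comNzRingType) (A : superAlgType R) := Homset {
  hset :> A -> Prop;
  hset_homog : forall x, hset x -> exists p, homog p x
}.

Section Quot.
Variables (R : comNzRingType) (A : superAlgType R) (S : homset A).

Inductive in_ideal : A -> Prop :=
| in_ideal0 : in_ideal 0
| in_idealD x y : in_ideal x -> in_ideal y -> in_ideal (x + y)
| in_idealM x s y : S s -> in_ideal (x * s * y).

Lemma in_idealMl z x : in_ideal x -> in_ideal (z * x).
Proof.
elim=> [|u v _ hu _ hv|u s v hs]; first by rewrite mulr0; constructor.
  by rewrite mulrDr; constructor.
by rewrite !mulrA; constructor.
Qed.

Lemma in_idealMr z x : in_ideal x -> in_ideal (x * z).
Proof.
elim=> [|u v _ hu _ hv|u s v hs]; first by rewrite mul0r; constructor.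
  by rewrite mulrDl; constructor.
by rewrite -mulrA; constructor.
Qed.

Lemma in_idealZ (a : R) x : in_ideal x -> in_ideal (a *: x).
Proof. by move=> hx; rewrite -[x]mul1r super_scalerAl; apply: in_idealMl. Qed.

Lemma in_idealS x : S x -> in_ideal x.
Proof. by move=> hx; rewrite -[x]mul1r -[1 * x]mulr1; constructor. Qed.

Definition ideal_pred : {pred A} := fun x => `[< in_ideal x >].

Fact ideal_zmod_closed : zmod_closed ideal_pred.
Proof.
split=> [|x y /asboolP hx /asboolP hy]; apply/asboolP; first by constructor.
by constructor=> //; rewrite -mulN1r; apply: in_idealMl.
Qed.

HB.instance Definition _ := GRing.isZmodClosed.Build A ideal_pred
  ideal_zmod_closed.

Definition squot : Type := Quotient.quot ideal_pred.
HB.instance Definition _ := GRing.Zmodule.on squot.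
HB.instance Definition _ := EqQuotient.on squot.

Definition squot_pi (x : A) : squot := \pi_squot x.

Lemma squot_piP x y : squot_pi x = squot_pi y <-> in_ideal (x - y).
Proof.
have E : `[< in_ideal (x - y) >] = (squot_pi x == squot_pi y).
  exact: (@Quotient.idealrBE A ideal_pred x y).
by split=> [e|h]; [apply/asboolP; rewrite E e|apply/eqP; rewrite -E; apply/asboolP].
Qed.

Lemma squot_reprK (h : squot) : squot_pi (repr h) = h.
Proof. exact: reprK. Qed.

Lemma squot_piD : {morph squot_pi : x y / x + y}.
Proof. by move=> x y; rewrite /squot_pi !piE. Qed.

Lemma squot_pi0 : squot_pi 0 = 0.
Proof. by rewrite /squot_pi !piE. Qed.

Definition squot_one : squot := squot_pi 1.
Definition squot_mul (g h : squot) : squot := squot_pi (repr g * repr h).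
Definition squot_scale (a : R) (h : squot) : squot := squot_pi (a *: repr h).

Lemma squot_mulE x y : squot_mul (squot_pi x) (squot_pi y) = squot_pi (x * y).
Proof.
apply/squot_piP; set x' := repr _; set y' := repr _.
have hx : in_ideal (x' - x) by apply/squot_piP/squot_reprK.
have hy : in_ideal (y' - y) by apply/squot_piP/squot_reprK.
have -> : x' * y' - x * y = (x' - x) * y' + x * (y' - y).
  by rewrite mulrBl mulrBr addrA subrK.
by constructor; [apply: in_idealMr|apply: in_idealMl].
Qed.

Lemma squot_scaleE a x : squot_scale a (squot_pi x) = squot_pi (a *: x).
Proof.
apply/squot_piP; rewrite -scalerBr; apply/in_idealZ/squot_piP.
exact: squot_reprK.
Qed.

Let squotW (P : squot -> Prop) : (forall x, P (squot_pi x)) -> forall h, P h.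
Proof. by move=> hP h; rewrite -[h]squot_reprK. Qed.

Fact squot_mulA : associative squot_mul.
Proof.
by elim/squotW=> x; elim/squotW=> y; elim/squotW=> z; rewrite !squot_mulE mulrA.
Qed.

Fact squot_mul1 : left_id squot_one squot_mul.
Proof. by elim/squotW=> x; rewrite squot_mulE mul1r. Qed.

Fact squot_mulr1 : right_id squot_one squot_mul.
Proof. by elim/squotW=> x; rewrite squot_mulE mulr1. Qed.

Fact squot_mulDl : left_distributive squot_mul +%R.
Proof.
elim/squotW=> x; elim/squotW=> y; elim/squotW=> z.
by rewrite -squot_piD !squot_mulE mulrDl squot_piD.
Qed.

Fact squot_mulDr : right_distributive squot_mul +%R.
Proof.
elim/squotW=> x; elim/squotW=> y; elim/squotW=> z.
by rewrite -squot_piD !squot_mulE mulrDr squot_piD.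
Qed.

HB.instance Definition _ := GRing.Zmodule_isPzRing.Build squot
  squot_mulA squot_mul1 squot_mulr1 squot_mulDl squot_mulDr.

Lemma squot_piM : {morph squot_pi : x y / x * y}.
Proof. by move=> x y; rewrite -squot_mulE. Qed.

Definition squot_homog (p : bool) (h : squot) : Prop :=
  exists2 x, homog p x & h = squot_pi x.

Fact squot_scaleA a b h :
  squot_scale a (squot_scale b h) = squot_scale (a * b) h.
Proof. by elim/squotW: h => x; rewrite !squot_scaleE scalerA. Qed.

Fact squot_scale1 : left_id 1 squot_scale.
Proof. by elim/squotW=> x; rewrite squot_scaleE scale1r. Qed.

Fact squot_scaleDr : right_distributive squot_scale +%R.
Proof.
move=> a; elim/squotW=> x; elim/squotW=> y.
by rewrite -squot_piD !squot_scaleE scalerDr squot_piD.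
Qed.

Fact squot_scaleDl h : {morph squot_scale^~ h : a b / a + b}.
Proof.
by elim/squotW: h => x a b; rewrite /= !squot_scaleE scalerDl squot_piD.
Qed.

Fact squot_scaleAl a (g h : squot) :
  squot_scale a (g * h) = squot_scale a g * h.
Proof.
elim/squotW: g => x; elim/squotW: h => y.
by rewrite squot_scaleE -!squot_piM squot_scaleE super_scalerAl.
Qed.

Fact squot_scaleAr a (g h : squot) :
  squot_scale a (g * h) = g * squot_scale a h.
Proof.
elim/squotW: g => x; elim/squotW: h => y.
by rewrite squot_scaleE -!squot_piM squot_scaleE super_scalerAr.
Qed.

Fact squot_homog0 p : squot_homog p 0.
Proof. by exists 0; [apply: homog0|rewrite squot_pi0]. Qed.

Fact squot_homogP p a g h :
  squot_homog p g -> squot_homog p h -> squot_homog p (squot_scale a g + h).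
Proof.
case=> x hx -> [y hy ->]; exists (a *: x + y); first exact: homogP.
by rewrite squot_scaleE squot_piD.
Qed.

Fact squot_homog1 : squot_homog false 1.
Proof. by exists 1; first exact: homog1. Qed.

Fact squot_homogM p r (g h : squot) :
  squot_homog p g -> squot_homog r h -> squot_homog (p (+) r) (g * h).
Proof.
case=> x hx -> [y hy ->]; exists (x * y); first exact: homogM.
by rewrite squot_piM.
Qed.

Fact squot_split h : exists h0 h1,
  [/\ squot_homog false h0, squot_homog true h1 & h = h0 + h1].
Proof.
elim/squotW: h => x; have [x0 [x1 [h0 h1 ->]]] := homog_split x.
exists (squot_pi x0), (squot_pi x1); split; [by exists x0|by exists x1|].
exact: squot_piD.
Qed.

Lemma ideal_split x : in_ideal x -> exists x0 x1, [/\ in_ideal x0, in_ideal x1,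
  homog false x0, homog true x1 & x = x0 + x1].
Proof.
elim=> [|u v _ [u0 [u1 [? ? ? ? ->]]] _ [v0 [v1 [? ? ? ? ->]]]|u s v hs].
- by exists 0, 0; split; rewrite ?addr0 //; try constructor; apply: homog0.
- exists (u0 + v0), (u1 + v1); split; try by constructor.
  + exact: homogD.
  + exact: homogD.
  + by rewrite addrACA.
have [p hp] := hset_homog hs.
have [u0 [u1 [hu0 hu1 ->]]] := homog_split u.
have [v0 [v1 [hv0 hv1 ->]]] := homog_split v.
pose e := u0 * s * v0 + u1 * s * v1; pose o := u0 * s * v1 + u1 * s * v0.
have ie : in_ideal e by apply: in_idealD; constructor.
have io : in_ideal o by apply: in_idealD; constructor.
have he : homog p e.
  have := homogM (homogM hu0 hp) hv0; have := homogM (homogM hu1 hp) hv1.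
  by rewrite addbT negbK addbF => ? ?; apply: homogD.
have ho : homog (~~ p) o.
  have := homogM (homogM hu0 hp) hv1; have := homogM (homogM hu1 hp) hv0.
  by rewrite addbT addbF => ? ?; apply: homogD.
have eq_eo : (u0 + u1) * s * (v0 + v1) = e + o.
  by rewrite mulrDl mulrDl !mulrDr [X in _ + X]addrC addrACA.
rewrite eq_eo; case: p {hp} he ho => he ho; last by exists e, o.
by exists o, e; split=> //; rewrite addrC.
Qed.

Fact squot_dir h0 h1 :
  squot_homog false h0 -> squot_homog true h1 -> h0 + h1 = 0 -> h0 = 0.
Proof.
case=> x0 hx0 -> [x1 hx1 ->]; rewrite -squot_piD -squot_pi0 => /squot_piP.
rewrite subr0 => /ideal_split [y0 [y1 [iy0 iy1 hy0 hy1 e]]].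
apply/squot_piP; rewrite subr0.
by rewrite (homog_eq hx0 _ hy0 _ e).
Qed.

HB.instance Definition _ := isSuperAlgebra.Build R squot
  squot_scaleA squot_scale1 squot_scaleDr squot_scaleDl
  squot_scaleAl squot_scaleAr squot_homog0 squot_homogP squot_homog1
  squot_homogM squot_split squot_dir.

HB.instance Definition _ := GRing.Zmodule_isLmodule.Build R squot
  squot_scaleA squot_scale1 squot_scaleDr squot_scaleDl.

Lemma squot_piZ (a : R) x : squot_pi (a *: x) = a *: squot_pi x.
Proof. by rewrite -squot_scaleE. Qed.

Lemma squot_pi_linear : linear squot_pi.
Proof. by move=> a x y; rewrite squot_piD squot_piZ. Qed.

Lemma squot_piS x : S x -> squot_pi x = 0.
Proof.
move=> hx; rewrite -squot_pi0; apply/squot_piP; rewrite subr0.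
exact: in_idealS.
Qed.

(* squot_lift f is the map induced by f if f kills S, and junk otherwise. *)
Section Lift.
Variables (B : superAlgType R) (f : A -> B).

Definition squot_lift (h : squot) : B := f (repr h).

Hypotheses (f_lin : linear f) (fM : {morph f : x y / x * y}) (f1 : f 1 = 1).
Hypothesis fS : forall x, S x -> f x = 0.

Lemma squot_liftE x : squot_lift (squot_pi x) = f x.
Proof.
have fD u v : f (u + v) = f u + f v by rewrite -[u]scale1r f_lin !scale1r.
have f0 : f 0 = 0 by apply: (addrI (f 0)); rewrite -fD !addr0.
have fI u : in_ideal u -> f u = 0.
  elim=> [|u' v _ hu _ hv|u' s v hs] //; first by rewrite fD hu hv addr0.
  by rewrite !fM (fS hs) mulr0 mul0r.
have /fI : in_ideal (repr (squot_pi x) - x) by apply/squot_piP/squot_reprK.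
move=> e; rewrite /squot_lift -[repr _](subrK x) fD e add0r.
by [].
Qed.

Lemma squot_lift_linear : linear squot_lift.
Proof.
move=> a; elim/squotW=> x; elim/squotW=> y.
by rewrite -squot_pi_linear !squot_liftE f_lin.
Qed.

Lemma squot_liftM : {morph squot_lift : g h / g * h}.
Proof.
by elim/squotW=> x; elim/squotW=> y; rewrite -squot_piM !squot_liftE fM.
Qed.

Lemma squot_lift1 : squot_lift 1 = 1.
Proof. by rewrite -[1]/(squot_pi 1) squot_liftE f1. Qed.

End Lift.
End Quot.

Inductive letter := LT of nat | LX of nat | LXinv of nat | LC of nat.

Definition letter_code (l : letter) : nat * nat :=
  match l with
  | LT i => (0%N, i) | LX i => (1%N, i) | LXinv i => (2%N, i) | LC i => (3%N, i)
  end.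

Definition letter_decode (c : nat * nat) : letter :=
  match c with
  | (0%N, i) => LT i | (1%N, i) => LX i | (2%N, i) => LXinv i | (_, i) => LC i
  end.

Fact letter_codeK : cancel letter_code letter_decode. Proof. by case. Qed.

HB.instance Definition _ := Choice.copy letter (can_type letter_codeK).

Definition letter_odd (l : letter) : bool := if l is LC _ then true else false.

Definition letter_ok (n : nat) (l : letter) : bool :=
  match l with
  | LT i => (0 < i < n)%N
  | LX i | LXinv i | LC i => (0 < i <= n)%N
  end.

Lemma letter_okS n l : letter_ok n l -> letter_ok n.+1 l.
Proof. by case: l => i /= /andP[-> h] /=; rewrite ltnW. Qed.

Section Relations.
Variables (R : comUnitRingType) (q : R).

Definition hc_eps : R := q - q^-1.

(* hc_rel n v l r : l = r is a defining relation of H_c(n), each generator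
   being replaced by its image under v. *)
Inductive hc_rel (n : nat) (A : superAlgType R) (v : letter -> A) :
    A -> A -> Prop :=
| rel_TT i : (0 < i < n)%N ->
    hc_rel n v (v (LT i) ^+ 2) (hc_eps *: v (LT i) + 1)
| rel_TTC i j : (0 < i < n)%N -> (0 < j < n)%N ->
    (i.+1 < j)%N || (j.+1 < i)%N ->
    hc_rel n v (v (LT i) * v (LT j)) (v (LT j) * v (LT i))
| rel_braid i : (0 < i)%N -> (i.+1 < n)%N ->
    hc_rel n v (v (LT i) * v (LT i.+1) * v (LT i))
               (v (LT i.+1) * v (LT i) * v (LT i.+1))
| rel_XX i j : (0 < i <= n)%N -> (0 < j <= n)%N ->
    hc_rel n v (v (LX i) * v (LX j)) (v (LX j) * v (LX i))
| rel_XXinv i : (0 < i <= n)%N -> hc_rel n v (v (LX i) * v (LXinv i)) 1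
| rel_XinvX i : (0 < i <= n)%N -> hc_rel n v (v (LXinv i) * v (LX i)) 1
| rel_CC i : (0 < i <= n)%N -> hc_rel n v (v (LC i) ^+ 2) 1
| rel_CCN i j : (0 < i <= n)%N -> (0 < j <= n)%N -> i != j ->
    hc_rel n v (v (LC i) * v (LC j)) (- (v (LC j) * v (LC i)))
| rel_TX i : (0 < i < n)%N ->
    hc_rel n v (v (LT i) * v (LX i))
      (v (LX i.+1) * v (LT i)
       - hc_eps *: (v (LX i.+1) + v (LC i) * v (LC i.+1) * v (LX i)))
| rel_TXS i : (0 < i < n)%N ->
    hc_rel n v (v (LT i) * v (LX i.+1))
      (v (LX i) * v (LT i)
       + hc_eps *: ((1 - v (LC i) * v (LC i.+1)) * v (LX i.+1)))
| rel_TXC i j : (0 < i < n)%N -> (0 < j <= n)%N -> j != i -> j != i.+1 ->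
    hc_rel n v (v (LT i) * v (LX j)) (v (LX j) * v (LT i))
| rel_TC i : (0 < i < n)%N ->
    hc_rel n v (v (LT i) * v (LC i)) (v (LC i.+1) * v (LT i))
| rel_TCS i : (0 < i < n)%N ->
    hc_rel n v (v (LT i) * v (LC i.+1))
      (v (LC i) * v (LT i) - hc_eps *: (v (LC i) - v (LC i.+1)))
| rel_TCC i j : (0 < i < n)%N -> (0 < j <= n)%N -> j != i -> j != i.+1 ->
    hc_rel n v (v (LT i) * v (LC j)) (v (LC j) * v (LT i))
| rel_XC i : (0 < i <= n)%N ->
    hc_rel n v (v (LX i) * v (LC i)) (v (LC i) * v (LXinv i))
| rel_XCC i j : (0 < i <= n)%N -> (0 < j <= n)%N -> i != j ->
    hc_rel n v (v (LX i) * v (LC j)) (v (LC j) * v (LX i)).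

Lemma hc_rel_homog n (A : superAlgType R) (v : letter -> A) l r :
  (forall x, homog (letter_odd x) (v x)) -> hc_rel n v l r ->
  exists2 p, homog p l & homog p r.
Proof.
move=> hv.
have hT i : homog false (v (LT i)) by apply: hv (LT i).
have hX i : homog false (v (LX i)) by apply: hv (LX i).
have hY i : homog false (v (LXinv i)) by apply: hv (LXinv i).
have hC i : homog true (v (LC i)) by apply: hv (LC i).
have h1 : homog false (1 : A) by apply: homog1.
have M0 (x y : A) : homog false x -> homog false y -> homog false (x * y).
  exact: homogM.
have M1 (x y : A) : homog true x -> homog false y -> homog true (x * y).
  exact: homogM.
have M2 (x y : A) : homog false x -> homog true y -> homog true (x * y).
  exact: homogM.
have M3 (x y : A) : homog true x -> homog true y -> homog false (x * y).
  exact: homogM.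
have E i : homog false (v (LC i) * v (LC i.+1)) by apply: M3.
case=> *.
all: try by exists false; rewrite ?expr2; auto using homogD, homogZ, homogB, homogN.
all: by exists true; rewrite ?expr2; auto using homogD, homogZ, homogB, homogN.
Qed.

Lemma hc_relW n (A B : superAlgType R) (v : letter -> A) (v' : letter -> B)
    (f : A -> B) l r :
    linear f -> {morph f : x y / x * y} -> f 1 = 1 ->
    (forall x, letter_ok n x -> f (v x) = v' x) ->
  hc_rel n v l r -> hc_rel n.+1 v' (f l) (f r).
Proof.
move=> fL fM f1 fv.
have fD x y : f (x + y) = f x + f y by rewrite -[x]scale1r fL !scale1r.
have f0 : f 0 = 0 by apply: (addrI (f 0)); rewrite -fD !addr0.
have fZ a x : f (a *: x) = a *: f x by rewrite -[_ *: x]addr0 fL f0 addr0.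
have fN x : f (- x) = - f x by rewrite -scaleN1r fZ scaleN1r.
have w1 i : (0 < i < n)%N -> (0 < i < n.+1)%N.
  by case/andP=> -> /ltnW; rewrite ltnS.
have w2 i : (0 < i <= n)%N -> (0 < i <= n.+1)%N.
  by case/andP=> -> /leqW.
have w3 i : (0 < i < n)%N -> (0 < i <= n)%N by case/andP=> -> /ltnW.
have w4 i : (0 < i < n)%N -> (0 < i.+1 <= n)%N by case/andP.
have w5 i : (0 < i)%N -> (i.+1 < n)%N -> (0 < i < n)%N by move=> -> /ltnW.
have w6 i : (i.+1 < n)%N -> (i.+1 < n.+1)%N by apply: ltnW.
have w7 i : (0 < i < n)%N -> (i < n)%N by case/andP.
case=> *; rewrite ?expr2; rewrite !(fD, fN, fZ, fM, f1) !fv /=; auto;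
  rewrite -?expr2.
all: by first [ apply: rel_TT | apply: rel_TTC | apply: rel_braid
  | apply: rel_XX | apply: rel_XXinv | apply: rel_XinvX | apply: rel_CC
  | apply: rel_CCN | apply: rel_TX | apply: rel_TXS | apply: rel_TXC
  | apply: rel_TC | apply: rel_TCS | apply: rel_TCC | apply: rel_XC
  | apply: rel_XCC ]; auto.
Qed.

End Relations.

(* H_c(n): the generators are the letters with indices in range; indices out
   of range denote 0. *)
Section AffineAlg.
Variables (R : comUnitRingType) (q : R) (n : nat).

Definition hc_free : superAlgType R :=
  free_alg R (fun g : {l : letter | letter_ok n l} => letter_odd (val g)).

Definition hc_free_gen (l : letter) : hc_free :=
  if insub l is Some g then free_gen R _ g else 0.

Lemma hc_free_gen_val (g : {l : letter | letter_ok n l}) :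
  hc_free_gen (val g) = free_gen R _ g.
Proof. by rewrite /hc_free_gen valK. Qed.

Lemma hc_free_gen_homog l : homog (letter_odd l) (hc_free_gen l).
Proof.
rewrite /hc_free_gen; case: insubP => [g _ <-|_]; last exact: homog0.
exact: free_gen_homog.
Qed.

Definition hc_set (x : hc_free) : Prop :=
  exists l r, hc_rel q n hc_free_gen l r /\ x = l - r.

Fact hc_set_homog x : hc_set x -> exists p, homog p x.
Proof.
case=> l [r [/(hc_rel_homog hc_free_gen_homog)[p hl hr] ->]].
by exists p; apply: homogB.
Qed.

Definition hc_alg : superAlgType R := squot (Homset hc_set_homog).

Definition hc_gen (l : letter) : hc_alg := squot_pi _ (hc_free_gen l).

End AffineAlg.

Section AffineMap.
Variables (R : comUnitRingType) (q : R) (n : nat).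

(* The natural morphism H_c(n) -> H_c(n+1). *)
Definition hc_free_map : hc_free R n -> hc_free R n.+1 :=
  free_eval (fun g => hc_free_gen R n.+1 (val g)).

Definition hc_map : hc_alg q n -> hc_alg q n.+1 :=
  squot_lift (fun x => squot_pi _ (hc_free_map x)).

Let f (x : hc_free R n) : hc_alg q n.+1 := squot_pi _ (hc_free_map x).

Let fL : linear f.
Proof.
by move=> a x y; rewrite /f /hc_free_map free_eval_linear squot_pi_linear.
Qed.

Let fM : {morph f : x y / x * y}.
Proof. by move=> x y; rewrite /f /hc_free_map free_evalM squot_piM. Qed.

Let f1 : f 1 = 1.
Proof. by rewrite /f /hc_free_map free_eval1. Qed.

Lemma hc_free_map_gen l : letter_ok n l ->
  hc_free_map (hc_free_gen R n l) = hc_free_gen R n.+1 l.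
Proof.
move=> ok; rewrite -[l]/(val (exist (letter_ok n) l ok)).
by rewrite hc_free_gen_val; apply: free_eval_gen.
Qed.

Let fS x : hc_set q x -> f x = 0.
Proof.
case=> l [r [h ->]]; rewrite /f -(squot_pi0 (Homset (@hc_set_homog R q n.+1))).
apply/squot_piP; rewrite subr0; apply: in_idealS.
exists (hc_free_map l), (hc_free_map r); split; last first.
  by rewrite /hc_free_map raddfB.
apply: hc_relW h.
- exact: free_eval_linear.
- exact: free_evalM.
- exact: free_eval1.
- exact: hc_free_map_gen.
Qed.

Lemma hc_map_linear : linear hc_map.
Proof. exact: squot_lift_linear. Qed.

Lemma hc_mapM : {morph hc_map : x y / x * y}.
Proof. exact: squot_liftM. Qed.

Lemma hc_map1 : hc_map 1 = 1.
Proof. exact: squot_lift1. Qed.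

Lemma hc_map_gen l : letter_ok n l -> hc_map (hc_gen q n l) = hc_gen q n.+1 l.
Proof.
move=> ok; rewrite /hc_map /hc_gen squot_liftE //.
by rewrite hc_free_map_gen.
Qed.

End AffineMap.

Inductive cyc_type := cyc_0 | cyc_s.

Section Cyclotomic.
Variables (R : comUnitRingType) (q : R) (b : cyc_type) (m : nat).
Variable Q : 'I_m -> R.

Definition qfun (a : R) : R := 2%:R * ((q * a + (q * a)^-1) / (q + q^-1)).

Definition cyc_poly (n : nat) : hc_alg q n :=
  (if b is cyc_s then hc_gen q n (LX 1) - 1 else 1) *
  \prod_(i < m) (hc_gen q n (LX 1) + hc_gen q n (LXinv 1) - qfun (Q i) *: (1 : hc_alg q n)).

(* deg f, for X_1 + X_1^-1 counted with degree 2 *)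
Definition cyc_deg : nat := if b is cyc_s then m.*2.+1 else m.*2.

Lemma hc_gen_homog n l : homog (letter_odd l) (hc_gen q n l).
Proof. by exists (hc_free_gen R n l); first exact: hc_free_gen_homog. Qed.

Fact cyc_set_homog n x : x = cyc_poly n -> exists p, homog p x.
Proof.
have h1 : homog false (1 : hc_alg q n) by apply: homog1.
have hX : homog false (hc_gen q n (LX 1)) by apply: (@hc_gen_homog n (LX 1)).
have hY : homog false (hc_gen q n (LXinv 1)).
  exact: (@hc_gen_homog n (LXinv 1)).
have M0 (y z : hc_alg q n) :
  homog false y -> homog false z -> homog false (y * z) by apply: homogM.
move=> ->; exists false; apply: (M0); first by case: b => //; apply: homogB.
apply: (big_ind (homog false)) => // i _.
by apply: homogB; [exact: homogD|exact: homogZ].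
Qed.

(* H_c^f(n), with the convention H_c^f(0) = R. *)
Definition cyc_alg (n : nat) : superAlgType R :=
  if n is k.+1 then squot (Homset (@cyc_set_homog k.+1)) else R^o.

Definition cyc_gen (n : nat) (l : letter) : cyc_alg n :=
  if n is k.+1 return cyc_alg n then squot_pi _ (hc_gen q k.+1 l) else 0.

(* The natural morphism H_c^f(n) -> H_c^f(n+1). *)
Definition cyc_map (n : nat) : cyc_alg n -> cyc_alg n.+1 :=
  match n return cyc_alg n -> cyc_alg n.+1 with
  | 0 => fun a : R => a *: (1 : cyc_alg 1)
  | k.+1 => squot_lift (fun x => squot_pi _ (hc_map x))
  end.

Lemma hc_map_cyc_poly n : (0 < n)%N -> hc_map (cyc_poly n) = cyc_poly n.+1.
Proof.
move=> n0; rewrite /cyc_poly.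
have fL := @hc_map_linear R q n.
have fD x y : hc_map (x + y) = hc_map x + hc_map y :> hc_alg q n.+1.
  by rewrite -[x]scale1r fL !scale1r.
have f0 : hc_map 0 = 0 :> hc_alg q n.+1.
  by apply: (addrI (hc_map 0)); rewrite -fD !addr0.
have fZ a x : hc_map (a *: x) = a *: hc_map x :> hc_alg q n.+1.
  by rewrite -[_ *: _]addr0 fL f0 addr0.
have fN x : hc_map (- x) = - hc_map x :> hc_alg q n.+1.
  by rewrite -scaleN1r fZ scaleN1r.
rewrite hc_mapM; congr (_ * _).
  by case: b; rewrite ?fD ?fN hc_map1 // hc_map_gen.
rewrite (big_morph _ (@hc_mapM R q n) (@hc_map1 R q n)).
by apply: eq_bigr => i _; rewrite !fD fN fZ hc_map1 !hc_map_gen.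
Qed.

Section MapS.
Variable k : nat.
Let f (x : hc_alg q k.+1) : cyc_alg k.+2 := squot_pi _ (hc_map x).

Let fL : linear f.
Proof. by move=> a x y; rewrite /f hc_map_linear squot_pi_linear. Qed.

Let fM : {morph f : x y / x * y}.
Proof. by move=> x y; rewrite /f hc_mapM squot_piM. Qed.

Let f1 : f 1 = 1.
Proof. by rewrite /f hc_map1. Qed.

Let fS x : x = cyc_poly k.+1 -> f x = 0.
Proof. by move=> ->; rewrite /f hc_map_cyc_poly // squot_piS. Qed.

Lemma cyc_mapS_linear : linear (@cyc_map k.+1).
Proof. exact: squot_lift_linear. Qed.

Lemma cyc_mapSM : {morph @cyc_map k.+1 : x y / x * y}.
Proof. exact: squot_liftM. Qed.

Lemma cyc_mapS1 : @cyc_map k.+1 1 = 1.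
Proof. exact: squot_lift1. Qed.

Lemma cyc_mapS_gen l :
  letter_ok k.+1 l -> cyc_map (cyc_gen k.+1 l) = cyc_gen k.+2 l.
Proof.
by move=> ok; rewrite /cyc_map /cyc_gen squot_liftE // hc_map_gen.
Qed.

End MapS.

Lemma cyc_map_linear n : linear (@cyc_map n).
Proof.
case: n => [|k]; last exact: cyc_mapS_linear.
by move=> a x y; rewrite /cyc_map scalerDl -scalerA.
Qed.

Lemma cyc_mapM n : {morph @cyc_map n : x y / x * y}.
Proof.
case: n => [|k]; last exact: cyc_mapSM.
move=> x y; rewrite /cyc_map.
by rewrite -super_scalerAl mul1r scalerA.
Qed.

Lemma cyc_map1 n : @cyc_map n 1 = 1.
Proof. by case: n => [|k]; [exact: scale1r|exact: cyc_mapS1]. Qed.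

Lemma cyc_map_gen n l :
  letter_ok n l -> cyc_map (cyc_gen n l) = cyc_gen n.+1 l.
Proof.
case: n => [|k]; last exact: cyc_mapS_gen.
by case: l => i /=; rewrite ?leqn0 ?ltn0 ?andbF //; case: i.
Qed.

(* e is the projection of H_c^f(k+1) onto the summand H_c^f(k) of
   H_c^f(k+1) = H_c^f(k) T_k H_c^f(k)
                (+) sum_(j < r, a < 2) X_(k+1)^j C_(k+1)^a H_c^f(k)
   with j = a = 0: it is the identity there and vanishes on the others. The
   first summand is absent for k = 0, the third clause is void for r = 0. *)
Definition mackey_projection (k : nat) (e : cyc_alg k.+1 -> cyc_alg k) : Prop :=
  [/\ linear e,
      (0 < k)%N -> forall x y : cyc_alg k,
        e (cyc_map x * cyc_gen k.+1 (LT k) * cyc_map y) = 0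
    & forall (j : nat) (a : bool) (x : cyc_alg k), (j < cyc_deg)%N ->
        e (cyc_gen k.+1 (LX k.+1) ^+ j * cyc_gen k.+1 (LC k.+1) ^+ a *
           cyc_map x) = if (j == 0) && ~~ a then x else 0].

Fixpoint compose_projections (e : forall k, cyc_alg k.+1 -> cyc_alg k)
    (n : nat) : cyc_alg n -> R :=
  match n return cyc_alg n -> R with
  | 0 => id
  | k.+1 => fun h => compose_projections e (e k h)
  end.

(* tau = eps_1 \o ... \o eps_n, with eps_(k+1) = e k. *)
Definition standard_Frobenius_form (n : nat) (tau : cyc_alg n -> R) : Prop :=
  exists e : forall k, cyc_alg k.+1 -> cyc_alg k,
    (forall k, (k < n)%N -> mackey_projection (e k)) /\
    forall h, tau h = compose_projections e h.

End Cyclotomic.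

(* Main.v *)
From HB Require Import structures.
Require Import Defs.
From mathcomp Require Import all_boot all_algebra.
From mathcomp Require finmap boolp monalg.
Set Implicit Arguments.
Unset Strict Implicit.
Unset Printing Implicit Defensive.
Import GRing.Theory.
Local Open Scope ring_scope.

(** Write H_k for the cyclotomic algebra and [e_k : H_{k+1} -> H_k] for the Mackey
    projection. Let T = T_k, X = X_k, C = C_k, Y = X_{k+1}, D = C_{k+1}, and let
    s = -1 in case 0, s = 1 in case s, so that e_0 (X_1^r) = s.

    Pushing powers of X through T gives e_k (T y T) = e_{k-1} y on H_k, and from
    this, by induction on k, e_k (Y^r) = s and e_k (Y^j D) = 0 for all j. As e_k
    is determined by its bimodule property and its values on the spanning
    set H_k T H_k + sum_{j < r} Y^j D^a H_k, these values give
      e_k (Y x) = e_k (x Y)  and  e_k (Y^r D x D) = s (-1)^|x| e_k x.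
    The form of the theorem is t_{k+1} x = t_k (e_k (x z)) with z = Y^m, resp.
    z = Y^m + Y^{m+1}, and D z D Y^r = z; so the two identities say that Y and D
    (super)commute with everything under t_{k+1}. For T one uses in addition
    e_k (T b T z) = e_{k-1} (b z_X) + kappa b, z_X being z with X in place of Y.

    Nondegeneracy and freeness come together: there are spanning families (b_i)
    and elements g_i for which the matrix of the values tau (g_i b_j) is
    triangular with units on the diagonal. *)

(** The sign s separates the two cases. Multiplied by X_1^m, the cyclotomic polynomial becomes monic
    of degree r with constant term -s: each factor X + X^-1 - a turns into X^2 - aX + 1, and X - 1
    contributes -1. This is the origin of e_0 (X_1^r) = s. An even form sees D x only for odd x, and
    there the second identity exchanges D and x at the price of s: -1 is the super rule, 1 the
    ordinary one.

    The shape of z has a similar origin. D inverts Y, so z -> D z D Y^r replaces each exponent k by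
    r - k, which fixes Y^m for r = 2m and Y^m + Y^{m+1} for r = 2m + 1.

    Above the first level no polynomial relation for Y is at hand. What replaces it is a comparison:
    Y^k T C^a T is expanded once through T C^a = D^a T and the quadratic relation, and once by
    pushing Y through the left T. This shows that Y^r lies in the Mackey sum, and then gives the
    values of e_k on Y^r, Y^r D and Y^{r+1} D.

    If r = 0 the algebra is zero and is treated apart. *)

Section SuperMore.
Variables (R : comUnitRingType) (A : superAlgType R).
Implicit Types (x y : A) (p : bool).

Lemma homog_sum p (I : Type) (s : seq I) (P : pred I) (F : I -> A) :
  (forall i, P i -> homog p (F i)) -> homog p (\sum_(i <- s | P i) F i).
Proof.
move=> hF; apply: (big_ind (homog p)) => //; first exact: homog0.
by move=> *; apply: homogD.
Qed.

Lemma homogX x j : homog false x -> homog false (x ^+ j).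
Proof.
move=> hx; elim: j => [|j IH]; first by rewrite expr0; apply: homog1.
by rewrite exprS; apply: (homogM hx IH).
Qed.

Lemma homogXb p x : homog true x -> homog p (x ^+ p).
Proof. by case: p => // _; exact: homog1. Qed.

(** The odd part of [y] is annihilated by [x], since [x * y] = 1 is even; as [x] is invertible, it
    vanishes. *)
Lemma homog_inv x y : homog false x -> x * y = 1 -> y * x = 1 -> homog false y.
Proof.
move=> hx xy yx; have [y0 [y1 [h0 h1 Dy]]] := homog_split y.
suff: y1 = 0 by move=> y10; rewrite Dy y10 addr0.
have e : x * y0 = 1.
  have h := @homog_eq R A false (x * y0) (x * y1) 1 0; apply: h.
  - exact: (homogM hx h0).
  - exact: (homogM hx h1).
  - exact: homog1.
  - exact: homog0.
  - by rewrite -mulrDr -Dy xy addr0.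
have e1 : x * y1 = 0.
  by apply: (addrI (x * y0)); rewrite -mulrDr -Dy xy addr0 e.
by rewrite -[y1]mul1r -yx -mulrA e1 mulr0.
Qed.

End SuperMore.

(** * Mackey decompositions *)

Section Extension.
Variables (R : comUnitRingType) (A B : superAlgType R) (i : {linear B -> A}).
Variables (Y Y' D : A).

(* [A] is H_{k+1}, [B] is H_k; [Y], [Y'], [D] are X_{k+1}, its inverse and C_{k+1}. *)
Record extension : Prop := Extension {
  ext_M : {morph i : x y / x * y};
  ext_1 : i 1 = 1;
  ext_homog : forall p x, homog p x -> homog p (i x);
  ext_YY' : Y * Y' = 1;
  ext_Y'Y : Y' * Y = 1;
  ext_DD : D * D = 1;
  ext_YD : Y * D = D * Y';
  ext_homogY : homog false Y;
  ext_homogD : homog true D;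
  ext_commY : forall x, i x * Y = Y * i x;
  ext_commD : forall p x, homog p x -> i x * D = (-1) ^+ p *: (D * i x)
}.

Variables (hasT : bool) (T : A) (r : nat).

(* [hasT] is false for k = 0, where the summand H_k T_k H_k is absent. *)
Inductive mspan : A -> Prop :=
| mspan0 : mspan 0
| mspanD x y : mspan x -> mspan y -> mspan (x + y)
| mspanT x y : hasT -> mspan (i x * T * i y)
| mspanX j (a : bool) h : (j < r)%N -> mspan (Y ^+ j * D ^+ a * i h).

(** Graded refinement of [mspan]: with the parity as an index, signs such as [(-1) ^+ p] can be
    followed in an induction over the spanning set. *)
Inductive hspan : bool -> A -> Prop :=
| hspan0 p : hspan p 0
| hspanD p x y : hspan p x -> hspan p y -> hspan p (x + y)
| hspanT p1 p2 x y : hasT -> homog p1 x -> homog p2 y ->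
    hspan (p1 (+) p2) (i x * T * i y)
| hspanX j (a : bool) p h : (j < r)%N -> homog p h ->
    hspan (a (+) p) (Y ^+ j * D ^+ a * i h).

Hypothesis ext : extension.
Hypothesis homogT : homog false T.

Lemma mspanZ a x : mspan x -> mspan (a *: x).
Proof.
elim=> [|u v _ hu _ hv|u v hT|j c h hj].
- by rewrite scaler0; constructor.
- by rewrite scalerDr; constructor.
- by rewrite !super_scalerAl -linearZ; constructor.
- by rewrite super_scalerAr -linearZ; constructor.
Qed.

Lemma mspanN x : mspan x -> mspan (- x).
Proof. by move=> hx; rewrite -scaleN1r; apply: mspanZ. Qed.

Lemma mspanB x y : mspan x -> mspan y -> mspan (x - y).
Proof. by move=> hx /mspanN; constructor. Qed.

Lemma hspan_homog p x : hspan p x -> homog p x.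
Proof.
elim=> {p x} [p|p x y _ hx _ hy|p1 p2 x y _ hx hy|j a p h _ hh].
- exact: homog0.
- exact: homogD.
- have := homogM (homogM (ext_homog ext hx) homogT) (ext_homog ext hy).
  by rewrite addbF.
- have := homogM (homogM (homogX j (ext_homogY ext))
    (homogXb a (ext_homogD ext))) (ext_homog ext hh).
  by rewrite addFb.
Qed.

Lemma mspan_hspan x : mspan x -> exists x0 x1,
  [/\ hspan false x0, hspan true x1 & x = x0 + x1].
Proof.
elim=> {x} [|x y _ [x0 [x1 [hx0 hx1 ->]]] _ [y0 [y1 [hy0 hy1 ->]]]|x y hT|j a h hj].
- by exists 0, 0; split; rewrite ?addr0 //; constructor.
- by exists (x0 + y0), (x1 + y1); split; rewrite 1?addrACA //; constructor.
- have [x0 [x1 [hx0 hx1 ->]]] := homog_split x.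
  have [y0 [y1 [hy0 hy1 ->]]] := homog_split y.
  exists (i x0 * T * i y0 + i x1 * T * i y1).
  exists (i x0 * T * i y1 + i x1 * T * i y0); split.
  + by apply: hspanD;
      [apply: (@hspanT false false)|apply: (@hspanT true true)].
  + by apply: hspanD;
      [apply: (@hspanT false true)|apply: (@hspanT true false)].
  + by rewrite !linearD /= !mulrDl !mulrDr [X in _ + X]addrC addrACA.
- have [h0 [h1 [hh0 hh1 ->]]] := homog_split h.
  have E0 := @hspanX j a _ _ hj hh0; have E1 := @hspanX j a _ _ hj hh1.
  rewrite linearD mulrDr; case: a E0 E1 => /= E0 E1; last first.
    by do 2!eexists; split; [exact: E0|exact: E1|].
  by do 2!eexists; split; [exact: E1|exact: E0|rewrite addrC].
Qed.

Lemma homog_hspan p x : mspan x -> homog p x -> hspan p x.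
Proof.
move=> /mspan_hspan[x0 [x1 [h0 h1 e]]] hx.
have H0 := hspan_homog h0; have H1 := hspan_homog h1.
case: p hx => hx.
  by rewrite (homog_eq hx (homog0 false) H1 H0) // addr0 addrC.
by rewrite (homog_eq hx (homog0 true) H0 H1) // addr0.
Qed.

Lemma ext_Y'D : Y' * D = D * Y.
Proof.
rewrite -[Y' * D]mulr1 -(ext_Y'Y ext) !mulrA -(mulrA Y' D) -(ext_YD ext).
by rewrite mulrA (ext_Y'Y ext) mul1r.
Qed.

Lemma ext_commY' x : i x * Y' = Y' * i x.
Proof.
rewrite -[i x * Y']mul1r -(ext_Y'Y ext) -mulrA (mulrA Y) -(ext_commY ext).
by rewrite -mulrA (ext_YY' ext) mulr1.
Qed.

Lemma ext_commYX x j : i x * Y ^+ j = Y ^+ j * i x.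
Proof.
elim: j => [|j IH]; first by rewrite mulr1 mul1r.
by rewrite exprSr mulrA IH -!mulrA (ext_commY ext).
Qed.

Lemma ext_commDb p x (a : bool) : homog p x ->
  i x * D ^+ a = (-1) ^+ (p && a) *: (D ^+ a * i x).
Proof.
case: a => hx; first by rewrite andbT expr1 (ext_commD ext hx).
by rewrite andbF expr0 mulr1 mul1r scale1r.
Qed.

Lemma ext_commDl p x : homog p x -> D * i x = (-1) ^+ p *: (i x * D).
Proof. by move=> hx; rewrite (ext_commD ext hx) scalerA -signr_addb addbb scale1r. Qed.

Lemma conjD_i2 w p1 p2 x y : homog p1 x -> homog p2 y ->
  D * (i x * w * i y) * D =
  ((-1) ^+ p1 * (-1) ^+ p2) *: (i x * (D * w * D) * i y).
Proof.
move=> hx hy; transitivity (D * i x * w * (i y * D)); first by rewrite !mulrA.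
rewrite (ext_commDl hx) (ext_commD ext hy).
by rewrite -!super_scalerAl -!super_scalerAr scalerA !mulrA.
Qed.

Lemma ext_DYX j : D * Y ^+ j = Y' ^+ j * D.
Proof.
elim: j => [|j IH]; first by rewrite mulr1 mul1r.
by rewrite exprS mulrA -ext_Y'D -mulrA IH mulrA exprS.
Qed.

Lemma ext_YY'X j k : (k <= j)%N -> Y ^+ j * Y' ^+ k = Y ^+ (j - k).
Proof.
elim: k j => [|k IH] j; first by rewrite mulr1 subn0.
case: j => // j.
by rewrite ltnS => h; rewrite exprSr exprS mulrA -(mulrA _ Y) (ext_YY' ext) mulr1 IH.
Qed.

Section Mult.
Hypothesis r_gt0 : (0 < r)%N.

Lemma mspan_i h : mspan (i h).
Proof. by rewrite -[i h]mul1r -(mul1r 1); apply: (@mspanX 0%N false). Qed.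

Lemma mspan_mulr x h : mspan x -> mspan (x * i h).
Proof.
elim=> {x} [|x y _ hx _ hy|x y hT|j a k hj].
- by rewrite mul0r; constructor.
- by rewrite mulrDl; constructor.
- by rewrite -mulrA -(ext_M ext); constructor.
- by rewrite -mulrA -(ext_M ext); constructor.
Qed.

Lemma mspan_mull x h : mspan x -> mspan (i h * x).
Proof.
move=> hx; have [h0 [h1 [hh0 hh1 ->]]] := homog_split h.
suff H p k : homog p k -> mspan (i k * x).
  by rewrite linearD mulrDl; constructor; [apply: H hh0|apply: H hh1].
move=> hk; elim: hx => {x} [|x y _ hx _ hy|x y hT|j a l hj].
- by rewrite mulr0; constructor.
- by rewrite mulrDr; constructor.
- by rewrite !mulrA -(ext_M ext); constructor.
- rewrite !mulrA ext_commYX -(mulrA _ (i k)) (ext_commDb _ hk).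
  rewrite -super_scalerAr -super_scalerAl; apply: mspanZ.
  by rewrite !mulrA -mulrA -(ext_M ext); constructor.
Qed.

End Mult.

Section Projection.
Variable e : {linear A -> B}.

Record projection : Prop := Projection {
  proj_T : forall x y, hasT -> e (i x * T * i y) = 0;
  proj_X : forall j (a : bool) h, (j < r)%N ->
    e (Y ^+ j * D ^+ a * i h) = if (j == 0) && ~~ a then h else 0
}.

Hypothesis proj : projection.
Hypothesis span : forall x, mspan x.

(** [proj_X] prescribes values with H_k on the right. A homogeneous element of H_k on the left
    passes [Y ^+ j] freely and [D ^+ a] up to a sign that is nontrivial only for [a] = 1, where both
    sides vanish. *)
Lemma projMl h x : e (i h * x) = h * e x.
Proof.
have [h0 [h1 [hh0 hh1 ->]]] := homog_split h.
suff H p k : homog p k -> e (i k * x) = k * e x.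
  by rewrite linearD !mulrDl linearD /=; rewrite (H _ _ hh0) (H _ _ hh1).
move=> hk; elim: (span x) => {x} [|x y _ hx _ hy|x y hT|j a l hj].
- by rewrite mulr0 linear0 mulr0.
- by rewrite mulrDr !linearD /= hx hy mulrDr.
- by rewrite !mulrA -(ext_M ext) !(proj_T proj) // mulr0.
- rewrite !mulrA ext_commYX -(mulrA _ (i k)) (ext_commDb _ hk).
  rewrite -super_scalerAr -super_scalerAl linearZ.
  rewrite !mulrA -mulrA -(ext_M ext) /= !(proj_X proj) //.
  by case: a; case: eqP; rewrite /= ?andbF ?scaler0 ?mulr0 ?scale1r.
Qed.

Lemma projMr h x : e (x * i h) = e x * h.
Proof.
elim: (span x) => {x} [|x y _ hx _ hy|x y hT|j a l hj].
- by rewrite mul0r linear0 mul0r.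
- by rewrite mulrDl !linearD /= hx hy mulrDl.
- by rewrite -mulrA -(ext_M ext) !(proj_T proj) // mul0r.
- by rewrite -mulrA -(ext_M ext) !(proj_X proj) //; case: ifP; rewrite ?mul0r.
Qed.

Lemma proj_homog p x : homog p x -> homog p (e x).
Proof.
move/(homog_hspan (span x)); elim=> {p x} [p|p x y _ hx _ hy|p1 p2 x y hT _ _|j a p h hj hh].
- by rewrite linear0; apply: homog0.
- by rewrite linearD; apply: homogD.
- by rewrite (proj_T proj) //; apply: homog0.
- rewrite (proj_X proj) //; case: ifP => [/andP[_ /negPf ->] //|_].
  exact: homog0.
Qed.

Lemma projYD j (a : bool) : (j < r)%N ->
  e (Y ^+ j * D ^+ a) = ((j == 0) && ~~ a)%:R.
Proof.
move=> hj; rewrite -[X in e X]mulr1 -(ext_1 ext) (proj_X proj) //.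
by case: ifP.
Qed.

(** * Conjugation by [Y] and by [D] under the projection *)

Section Duality.
Variable s : R.
Hypotheses (r_gt0 : (0 < r)%N) (eYr : e (Y ^+ r) = s *: (1 : B)).
Hypotheses (eYrD : e (Y ^+ r * D) = 0) (eYr1D : e (Y ^+ r.+1 * D) = 0).
Hypotheses (eYTY' : hasT -> e (Y * T * Y') = 0).
Hypotheses (eYDTD : hasT -> e (Y ^+ r * D * T * D) = 0).

(** On [Y ^+ j * D] the conjugation produces [Y ^+ j.+2 * D], because [D * Y'] is [Y * D]. The
    exponents r and r + 1 are out of reach of [proj_X], whence the hypotheses [eYrD] and [eYr1D]. *)
Lemma proj_conjY x : e (Y * x * Y') = e x.
Proof.
elim: (span x) => {x} [|x y _ hx _ hy|x y hT|j a l hj].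
- by rewrite mulr0 mul0r linear0.
- by rewrite mulrDr mulrDl !linearD /= hx hy.
- rewrite (proj_T proj) // -!mulrA ext_commY' !mulrA -(ext_commY ext).
  by rewrite -!mulrA projMl !mulrA projMr eYTY' // mul0r mulr0.
- rewrite -!mulrA ext_commY' !mulrA !projMr; congr (_ * _).
  rewrite -exprS; case: a; last first.
    by rewrite !mulr1 exprSr -mulrA (ext_YY' ext) mulr1.
  rewrite /= !expr1 -mulrA -(ext_YD ext) mulrA -exprSr.
  rewrite -[RHS](_ : e (Y ^+ j.+2 * D) = _) //.
  have -> : e (Y ^+ j * D) = 0 by rewrite (@projYD j true) // andbF.
  move: hj; rewrite leq_eqVlt => /orP[/eqP -> //|].
  rewrite leq_eqVlt => /orP[/eqP -> //|h].
  by rewrite (@projYD _ true).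
Qed.

Lemma proj_commY x : e (Y * x) = e (x * Y).
Proof. by rewrite -[RHS]proj_conjY -!mulrA (ext_YY' ext) mulr1. Qed.

Lemma proj_commYX j x : e (Y ^+ j * x) = e (x * Y ^+ j).
Proof.
elim: j x => [|j IH] x; first by rewrite mulr1 mul1r.
by rewrite exprS -mulrA proj_commY -mulrA IH -mulrA.
Qed.

(** Carrying one factor [Y] around under [e] and using [D * Y = Y' * D] lowers the exponent by 2, so
    the exponents 0 and 1 suffice. *)
Lemma proj_YD j : e (Y ^+ j * D) = 0.
Proof.
elim/ltn_ind: j => -[|[|j]] IH.
- by rewrite (@projYD 0 true).
(* For r = 1 the exponent 1 is no longer below r, and [eYrD] takes over. *)
- case: (r_gt0); rewrite leq_eqVlt => /orP[/eqP r1|h].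
    by rewrite r1.
  by rewrite (@projYD 1 true).
- by rewrite exprS -mulrA proj_commY -mulrA -ext_Y'D mulrA exprSr
    -[X in X * D]mulrA (ext_YY' ext) mulr1 IH.
Qed.

(* Both sides are bimodule maps twisted by the parity, so it suffices to compare
   them on the spanning set. *)
Lemma proj_duality p x : homog p x ->
  e (Y ^+ r * D * x * D) = (s * (-1) ^+ p) *: e x.
Proof.
move/(homog_hspan (span x)); elim=> {p x} [p|p x y _ hx _ hy|p1 p2 x y hT hx hy|j a p h hj hh].
- by rewrite mulr0 mul0r !linear0.
- by rewrite mulrDr mulrDl !linearD /= hx hy.
- rewrite (proj_T proj) // scaler0 -(mulrA (Y ^+ r)) -(mulrA (Y ^+ r)).
  rewrite (conjD_i2 _ hx hy) -super_scalerAr linearZ /= !mulrA -ext_commYX.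
  by rewrite -!mulrA projMl !mulrA projMr eYDTD // mul0r mulr0 scaler0.
- rewrite -!mulrA (ext_commD ext hh) -!super_scalerAr linearZ /=.
  rewrite !mulrA !projMr signr_addb.
  have -> : (s * ((-1) ^+ a * (-1) ^+ p)) *: (e (Y ^+ j * D ^+ a) * h)
    = (-1) ^+ p *: (((s * (-1) ^+ a) *: e (Y ^+ j * D ^+ a)) * h).
    by rewrite -super_scalerAl scalerA mulrA mulrC.
  congr (_ *: (_ * h)).
  (* Since [D] inverts [Y], the power left is [Y ^+ (r - j)]. For 0 < [j] < r its exponent lies
     strictly between 0 and r, so [s] appears only for [j] = 0 and [a] = 0. *)
  rewrite (projYD _ hj) -(mulrA (Y ^+ r) D) ext_DYX !mulrA ext_YY'X ?(ltnW hj) //.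
  case: a; rewrite /= ?andbF ?andbT ?expr1 ?mulr1 -mulrA (ext_DD ext) mulr1.
    by rewrite scaler0 proj_YD.
  case: eqP => [->|/eqP j0]; first by rewrite subn0.
  have := @projYD (r - j) false; rewrite mulr1 => ->; last by rewrite ltn_subrL r_gt0 lt0n j0.
by rewrite andbT subn_eq0 leqNgt hj scaler0.
Qed.

End Duality.
End Projection.

End Extension.

(** * Two successive extensions *)

Section Tower.
Variables (R : comUnitRingType) (A B B0 : superAlgType R).
Variables (i : {linear B -> A}) (i0 : {linear B0 -> B}).
Variables (Y Y' D T : A) (X X' C : B) (hasT0 : bool) (T0 : B) (eps : R) (r : nat).

(* [B0] is H_{k-1}; [T0] is T_{k-1}, which exists only if [hasT0]. *)
Record tower : Prop := Tower {
  tow_ext : extension i Y Y' D;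
  tow_ext0 : extension i0 X X' C;
  tow_homogT : homog false T;
  tow_homogT0 : homog false T0;
  tow_TT : T * T = eps *: T + 1;
  tow_YT : Y * T = T * i X + eps *: (Y + i C * D * i X);
  tow_TY : T * Y = i X * T + eps *: (Y - i C * D * Y);
  tow_TC : T * i C = D * T;
  tow_TD : T * D = i C * T - eps *: (i C - D);
  tow_commT : forall x, i (i0 x) * T = T * i (i0 x);
  tow_braid : hasT0 -> T * i T0 * T = i T0 * T * i T0
}.

Hypothesis tow : tower.
Let ext := tow_ext tow.
Let ext0 := tow_ext0 tow.
Let homogT := tow_homogT tow.

Lemma tow_Y'T : Y' * T = T * i X' - eps *: (i X' + i C * Y' * D).
Proof.
have XX' : i X * i X' = 1 by rewrite -(ext_M ext) (ext_YY' ext0) (ext_1 ext).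
have E := tow_YT tow; move/(congr1 (fun z => Y' * z * i X')): E.
rewrite !(mulrDr, mulrDl) -!(super_scalerAr, super_scalerAl) !(mulrDr, mulrDl) !mulrA.
rewrite (ext_Y'Y ext) !mul1r -!(mulrA _ (i X)) XX' !mulr1 => ->.
by rewrite -(ext_commY' ext) addrK.
Qed.

Lemma tow_TY' : T * Y' = i X' * T - eps *: (i X' - i X' * i C * D).
Proof.
have X'X : i X' * i X = 1 by rewrite -(ext_M ext) (ext_Y'Y ext0) (ext_1 ext).
have E := tow_TY tow; move/(congr1 (fun z => i X' * z * Y')): E.
rewrite !(mulrDr, mulrDl) -!(super_scalerAr, super_scalerAl) !(mulrBr, mulrBl) !mulrA.
by rewrite X'X mul1r -!(mulrA _ Y) (ext_YY' ext) !mulr1 => ->; rewrite addrK.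
Qed.

Lemma tow_homogX j (a : bool) : homog a (X ^+ j * C ^+ a).
Proof.
have := homogM (homogX j (ext_homogY ext0)) (homogXb a (ext_homogD ext0)).
by rewrite addFb.
Qed.

(* Iterating this trades [T * i (X ^+ k * g) * T] for [Y ^+ k * T * i g * T]. *)
Lemma tow_step p g k : homog p g ->
  Y ^+ k.+1 * T * i g * T = Y ^+ k * T * i (X * g) * T
    + eps *: (i g * (Y ^+ k.+1 * T)
              + (-1) ^+ p *: (i (C * X * g) * (Y ^+ k * T) * i C)).
Proof.
move=> hg; have hXg : homog p (X * g) := homogM (ext_homogY ext0) hg.
transitivity (Y ^+ k * (Y * T) * i g * T); first by rewrite exprSr !mulrA.
rewrite (tow_YT tow) !(mulrDr, mulrDl) -!(super_scalerAr, super_scalerAl).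
rewrite !(mulrDr, mulrDl) !mulrA (ext_M ext) !mulrA.
congr (_ + _ *: (_ + _)).
  by rewrite -exprSr -(ext_commYX ext).
transitivity (i C * Y ^+ k * (D * i (X * g)) * T).
  by rewrite (ext_M ext) !mulrA (ext_commYX ext).
rewrite (ext_commDl ext hXg) -super_scalerAr -super_scalerAl.
congr (_ *: _); rewrite !mulrA -(mulrA _ D) -(tow_TC tow) -(mulrA C) (ext_M ext C).
by rewrite !mulrA -(mulrA (i C) (Y ^+ k)) -(ext_commYX ext) mulrA.
Qed.

Lemma tow_step0 (a : bool) k :
  Y ^+ k * T * i (C ^+ a) * T = eps *: (Y ^+ k * T * i (C ^+ a)) + Y ^+ k * D ^+ a.
Proof.
have TCa : T * i (C ^+ a) = D ^+ a * T.
  by case: a; rewrite ?expr1 ?(tow_TC tow) // !expr0 (ext_1 ext) mulr1 mul1r.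
rewrite -(mulrA _ T (i _)) TCa -!mulrA (tow_TT tow) !mulrDr mulr1.
by rewrite -!super_scalerAr.
Qed.

Lemma tow_step1 k : Y ^+ k.+1 * T = Y ^+ k * T * i X
  + eps *: (Y ^+ k.+1 + i C * (Y ^+ k * D) * i X).
Proof.
rewrite exprSr -[LHS]mulrA (tow_YT tow) mulrDr -super_scalerAr mulrDr !mulrA.
by rewrite (ext_commYX ext).
Qed.

(** * Stability of the Mackey sum under left multiplication *)

Section Closure.
Hypothesis r_gt0 : (0 < r)%N.
Notation span0 := (mspan i0 X C hasT0 T0 r).
Notation span := (mspan i Y D true T r).
Hypothesis spanB : forall x, span0 x.

Let sB := @mspanB _ _ _ i Y D true T r.
Let sZ := @mspanZ _ _ _ i Y D true T r.
Let sD := @mspanD _ _ _ i Y D true T r.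
Let sT x y := @mspanT _ _ _ i Y D true T r x y isT.
Let sr x h := @mspan_mulr _ _ _ i Y Y' D true T r ext x h.
Let sl x h := @mspan_mull _ _ _ i Y Y' D true T r ext x h.

Let s_Ti h : span (T * i h).
Proof. by have := sT 1 h; rewrite (ext_1 ext) mul1r. Qed.

Let s_Y j : (j < r)%N -> span (Y ^+ j).
Proof.
by move=> hj; have := @mspanX _ _ _ i Y D true T r j false 1 hj;
  rewrite expr0 (ext_1 ext) !mulr1.
Qed.

Let s_YD j : (j < r)%N -> span (Y ^+ j * D).
Proof.
by move=> hj; have := @mspanX _ _ _ i Y D true T r j true 1 hj;
  rewrite expr1 (ext_1 ext) !mulr1.
Qed.

Let s_YT j : (j < r)%N -> span (Y ^+ j * T).
Proof.
elim: j => [|j IH] hj; first by have := s_Ti 1; rewrite (ext_1 ext) mulr1 mul1r.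
rewrite tow_step1; apply: sD; first exact/sr/IH/ltnW.
by apply/sZ/sD; [exact: s_Y|apply/sr/sl/s_YD/ltnW].
Qed.

Let s_YTC j : (j < r)%N -> span (Y ^+ j * T * i C).
Proof. by move=> hj; apply/sr/s_YT. Qed.

(** [tow_step], solved for its term with [X * g], trades an [X] between the two [T] for a [Y] in
    front until only [C ^+ a] separates them. The bound on [j + k] keeps every power of [Y] below
    r. *)
Let s_YTXT k j (a : bool) : (j + k < r)%N ->
  span (Y ^+ j * T * i (X ^+ k * C ^+ a) * T).
Proof.
elim: k j => [|k IH] j hjk.
  rewrite addn0 in hjk; rewrite mul1r tow_step0; apply: sD.
    by apply/sZ/sr/s_YT.
  by case: a; [exact: s_YD|rewrite mulr1; apply: s_Y].
have := @tow_step a (X ^+ k * C ^+ a) j (tow_homogX k a).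
rewrite mulrA -exprS => /(canLR (addrK _)) <-.
rewrite -addSnnS in hjk; have hj := leq_ltn_trans (leq_addr _ _) hjk.
apply: sB; first exact: IH.
apply/sZ/sD; first exact/sl/s_YT.
by rewrite -mulrA; apply/sZ/sl/s_YTC/ltnW.
Qed.

(** On the summand through [T0] the braid relation leaves a single [T]. On the others the factor
    from H_{k-1} commutes with [T] and moves out, which leaves [s_YTXT]. *)
Let s_TbT y : span (T * i y * T).
Proof.
elim: (spanB y) => {y} [|x y _ hx _ hy|x y hT|j a h hj].
- by rewrite linear0 mulr0 mul0r; constructor.
- by rewrite linearD mulrDr mulrDl; constructor.
- rewrite !(ext_M ext) !mulrA -(tow_commT tow) -!mulrA (tow_commT tow) !mulrA.
  rewrite -!(mulrA (i (i0 x))) (tow_braid tow) // !mulrA -(ext_M ext) -mulrA -(ext_M ext).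
  exact: sT.
- rewrite (ext_M ext) -!mulrA (tow_commT tow) !mulrA; apply: sr.
  by have := @s_YTXT j 0 a hj; rewrite mul1r.
Qed.

(** The two expansions of [Y ^+ r * T * T], by the quadratic relation and by [tow_step], share the
    term [eps *: (Y ^+ r * T)]. Cancelling it expresses [Y ^+ r] through [Y ^+ r.-1 * T * i X * T],
    which reduces to [T * i (X ^+ r) * T]; [s_TbT] covers this because [spanB] holds for every
    element of H_k. *)
Let s_Yr : span (Y ^+ r).
Proof.
have H k j : (j + k = r)%N -> (0 < k)%N -> span (Y ^+ j * T * i (X ^+ k) * T).
  elim: j k => [|j IH] k hjk k0; first by rewrite mul1r; apply: s_TbT.
  have := @tow_step false (X ^+ k) j (homogX k (ext_homogY ext0)).
  rewrite -exprS => ->; rewrite addSnnS in hjk.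
  apply: sD; first exact: IH.
  apply/sZ/sD; first by apply/sl/s_YT; rewrite -hjk addnS ltnS -addn1 leq_add2l.
  rewrite -mulrA; apply/sZ/sl/s_YTC; rewrite -hjk addnS ltnS; exact: leq_addr.
have := @tow_step0 false r; have := @tow_step false 1 r.-1 homog1.
rewrite !mulr1 prednK // scale1r => -> E.
have -> : Y ^+ r = Y ^+ r.-1 * T * i X * T
    + eps *: (i (C * X) * (Y ^+ r.-1 * T) * i C).
  apply: (addrI (eps *: (Y ^+ r * T))).
  by rewrite addrCA -scalerDr; move: E; rewrite (ext_1 ext) !(mul1r, mulr1) => <-.
have r1 : (r.-1 < r)%N by rewrite prednK.
apply: sD; last by apply/sZ; rewrite -mulrA; apply/sl/s_YTC.
by have := H 1%N r.-1; rewrite expr1; apply; rewrite // addn1 prednK.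
Qed.

Let s_mulD x : span x -> span (x * D).
Proof.
elim=> {x} [|x y _ hx _ hy|x y hT|j a h hj].
- by rewrite mul0r; constructor.
- by rewrite mulrDl; constructor.
- have [y0 [y1 [h0 h1 ->]]] := homog_split y.
  suff H p z : homog p z -> span (i x * T * i z * D).
    by rewrite linearD mulrDr mulrDl; apply: sD; [apply: H h0|apply: H h1].
  move=> hz; rewrite -mulrA (ext_commD ext hz) -super_scalerAr; apply: sZ.
  rewrite mulrA; apply: sr; rewrite -mulrA (tow_TD tow) mulrBr; apply: sB.
    by have := sT (x * C) 1; rewrite (ext_1 ext) mulr1 mulrA (ext_M ext).
  rewrite -super_scalerAr; apply/sZ; rewrite mulrBr -(ext_M ext); apply: sB.
    exact: mspan_i.
  by apply: sl; have := s_YD r_gt0; rewrite mul1r.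
- have [h0 [h1 [hh0 hh1 ->]]] := homog_split h.
  suff H p z : homog p z -> span (Y ^+ j * D ^+ a * i z * D).
    by rewrite linearD mulrDr mulrDl; apply: sD; [apply: H hh0|apply: H hh1].
  move=> hz; rewrite -mulrA (ext_commD ext hz) -super_scalerAr; apply: sZ.
  rewrite mulrA; apply: sr; rewrite -mulrA; case: a.
    by rewrite (ext_DD ext) mulr1; apply: s_Y.
  by rewrite mul1r; apply: s_YD.
Qed.

Let s_YrD (a : bool) : span (Y ^+ r * D ^+ a).
Proof. by case: a; [apply: s_mulD|rewrite mulr1]. Qed.

Let s_mulY x : span x -> span (Y * x).
Proof.
elim=> {x} [|x y _ hx _ hy|x y hT|j a h hj].
- by rewrite mulr0; constructor.
- by rewrite mulrDr; constructor.
- rewrite !mulrA -(ext_commY ext); apply: sr; rewrite -mulrA; apply: sl.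
  rewrite -[Y]expr1 tow_step1 mul1r; apply: sD => //; apply/sZ/sD.
    rewrite expr1; move: r_gt0; rewrite leq_eqVlt => /orP[/eqP r1|r1].
      by have := s_Yr; rewrite -r1 expr1.
    by have := s_Y r1; rewrite expr1.
  by rewrite mul1r; apply/sr/sl; have := s_YD r_gt0; rewrite mul1r.
- rewrite !mulrA -exprS; apply: sr.
  move: hj; rewrite leq_eqVlt => /orP[/eqP -> //|hj].
  by case: a; [exact: s_YD|rewrite mulr1; apply: s_Y].
Qed.

(** [T'] is the inverse of [T]. Writing [Y'] as [Y' * T * T'] and pushing first [Y'], then [Y], to
    the right leaves only words in [T] and H_k with at most two [T]. *)
Let s_Y' : span Y'.
Proof.
pose T' := T - eps *: (1 : A).
have TT' : T * T' = 1.
  by rewrite mulrBr (tow_TT tow) -super_scalerAr mulr1 addrAC subrr add0r.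
have E1 : Y' * T = T' * i X' - eps *: (i C * (D * Y)).
  rewrite tow_Y'T scalerDr opprD addrA mulrBl -super_scalerAl mul1r.
  by rewrite -mulrA (ext_Y'D ext).
have E2 : Y * T' = (T + eps *: (i C * D)) * i X.
  rewrite mulrBr -super_scalerAr mulr1 (tow_YT tow) mulrDl -super_scalerAl.
  by rewrite scalerDr addrCA addrC addrK.
have CDCD : i C * D * (i C * D) = - 1.
  rewrite -mulrA (mulrA D) (ext_commDl ext (ext_homogD ext0)) expr1 scaleN1r.
  rewrite mulNr mulrN -mulrA (ext_DD ext) mulr1 -(ext_M ext) (ext_DD ext0).
  by rewrite (ext_1 ext).
have E3 : i C * (D * Y) * T' = i C * T * i C * i X - eps *: i X.
  rewrite -!mulrA E2 !mulrA mulrDr -super_scalerAr CDCD mulrDl.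
  rewrite -(mulrA _ D) -(tow_TC tow).
  by rewrite !mulrA scalerN mulNr -super_scalerAl mul1r.
have -> : Y' = T' * i X' * T' - eps *: (i C * T * i C * i X - eps *: i X).
  by rewrite -[LHS]mulr1 -TT' mulrA E1 mulrBl -super_scalerAl E3.
apply: sB; last first.
  by apply/sZ/sB; [rewrite -mulrA -(ext_M ext); apply: sT|apply/sZ/mspan_i].
have -> : T' * i X' * T' = T * i X' * T - eps *: (i X' * T)
    - eps *: (T * i X' - eps *: i X').
  by rewrite /T' mulrBr -super_scalerAr mulr1 !mulrBl -!super_scalerAl mul1r.
apply: sB.
  apply: sB; first exact: s_TbT.
  by apply/sZ/sl; have := s_Ti 1; rewrite (ext_1 ext) mulr1.
by apply/sZ/sB => //; apply/sZ/mspan_i.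
Qed.

Let s_mulY' x : span x -> span (Y' * x).
Proof.
elim=> {x} [|x y _ hx _ hy|x y hT|j a h hj].
- by rewrite mulr0; constructor.
- by rewrite mulrDr; constructor.
- rewrite !mulrA -(ext_commY' ext); apply: sr; rewrite -mulrA; apply: sl.
  rewrite tow_Y'T; apply: sB => //; apply/sZ/sD; first exact: mspan_i.
  by rewrite -mulrA; apply/sl/s_mulD/s_Y'.
- rewrite !mulrA; apply: sr; case: j hj => [|j] hj.
    by rewrite mulr1; case: a; [apply: s_mulD|rewrite mulr1]; apply: s_Y'.
  rewrite exprS mulrA (ext_Y'Y ext) mul1r; case: a; first exact/s_YD/ltnW.
  by rewrite mulr1; apply/s_Y/ltnW.
Qed.

Let s_mulY'X j x : span x -> span (Y' ^+ j * x).
Proof.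
by move=> hx; elim: j => [|j IH]; rewrite ?mul1r // exprS -mulrA; apply: s_mulY'.
Qed.

Let s_mulYX j x : span x -> span (Y ^+ j * x).
Proof.
by move=> hx; elim: j => [|j IH]; rewrite ?mul1r // exprS -mulrA; apply: s_mulY.
Qed.

Let s_lD x : span x -> span (D * x).
Proof.
elim=> {x} [|x y _ hx _ hy|x y hT|j a h hj].
- by rewrite mulr0; constructor.
- by rewrite mulrDr; constructor.
- have [x0 [x1 [h0 h1 ->]]] := homog_split x.
  suff H p z : homog p z -> span (D * (i z * T * i y)).
    by rewrite linearD !mulrDl mulrDr; apply: sD; [apply: H h0|apply: H h1].
  move=> hz; rewrite !mulrA (ext_commDl ext hz) -!super_scalerAl; apply: sZ.
  by rewrite -(mulrA _ D) -(tow_TC tow) mulrA -mulrA -(ext_M ext); apply: sT.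
- rewrite !mulrA (ext_DYX ext); apply: sr; rewrite -mulrA; apply: s_mulY'X.
  case: a; first by rewrite (ext_DD ext) -(ext_1 ext); apply: mspan_i.
  by rewrite mulr1; have := s_YD r_gt0; rewrite mul1r.
Qed.

Let s_lT x : span x -> span (T * x).
Proof.
elim=> {x} [|x y _ hx _ hy|x y hT|j a h hj].
- by rewrite mulr0; constructor.
- by rewrite mulrDr; constructor.
- rewrite !mulrA; apply: sr; exact: s_TbT.
- rewrite mulrA; apply: sr => {hj}.
  have s0 k : span (Y ^+ k * D ^+ a).
    apply: s_mulYX; have := @mspanX _ _ _ i Y D true T r 0 a 1 r_gt0.
    by rewrite mul1r (ext_1 ext) mulr1.
  elim: j => [|j IH].
    rewrite mul1r; case: a {s0}; last by have := s_Ti 1; rewrite (ext_1 ext).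
    rewrite expr1 (tow_TD tow); apply: sB.
      by have := sT C 1; rewrite (ext_1 ext) mulr1.
    by apply/sZ/sB; [exact: mspan_i|have := s_YD r_gt0; rewrite mul1r].
  have -> : T * (Y ^+ j.+1 * D ^+ a) = i X * (T * (Y ^+ j * D ^+ a)) +
      eps *: (Y * (Y ^+ j * D ^+ a) - i C * (D * (Y * (Y ^+ j * D ^+ a)))).
    rewrite exprS -mulrA mulrA (tow_TY tow) mulrDl -super_scalerAl mulrBl.
    by rewrite !mulrA.
  apply: sD; first exact: sl.
  apply/sZ/sB; first exact: s_mulY.
  exact/sl/s_lD/s_mulY.
Qed.

Lemma tow_span_closed x : span x ->
  [/\ span (T * x), span (Y * x), span (Y' * x), span (D * x)
    & forall h, span (i h * x)].
Proof.
move=> hx; split; [exact: s_lT|exact: s_mulY|exact: s_mulY'|exact: s_lD|].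
by move=> h; apply: sl.
Qed.

End Closure.

End Tower.

(** * Values of the projection on words in [T], [Y] and [D] *)

Section TowerProjection.
Variables (R : comUnitRingType) (A B B0 : superAlgType R).
Variables (i : {linear B -> A}) (i0 : {linear B0 -> B}).
Variables (Y Y' D T : A) (X X' C : B) (hasT0 : bool) (T0 : B) (eps : R) (r : nat).
Hypothesis tow : tower i i0 Y Y' D T X X' C hasT0 T0 eps.
Let ext := tow_ext tow.
Let ext0 := tow_ext0 tow.
Hypothesis r_gt0 : (0 < r)%N.
Hypothesis spanA : forall x, mspan i Y D true T r x.
Hypothesis spanB : forall x, mspan i0 X C hasT0 T0 r x.
Variables (e : {linear A -> B}) (e0 : {linear B -> B0}).
Hypothesis proj : projection i Y D true T r e.
Hypothesis proj0 : projection i0 X C hasT0 T0 r e0.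
Let eMl := projMl ext proj spanA.
Let eMr := projMr ext proj spanA.

Lemma proj_YT0 : e T = 0.
Proof. by have := proj_T proj 1 1 isT; rewrite (ext_1 ext) mulr1 mul1r. Qed.

Lemma proj_YT_step j : e (Y ^+ j.+1 * T) = e (Y ^+ j * T) * X +
  eps *: (e (Y ^+ j.+1) + C * e (Y ^+ j * D) * X).
Proof. by rewrite (tow_step1 tow) linearD linearZ linearD /= !eMr eMl. Qed.

Lemma proj_Y j : (j < r)%N -> e (Y ^+ j) = (j == 0)%:R.
Proof. by move=> hj; have := projYD ext proj false hj; rewrite mulr1 andbT. Qed.

Lemma proj_YD_small j : (j < r)%N -> e (Y ^+ j * D) = 0.
Proof. by move=> hj; have := projYD ext proj true hj; rewrite andbF. Qed.

Lemma proj_YT j : (j < r)%N -> e (Y ^+ j * T) = 0.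
Proof.
elim: j => [|j IH] hj; first by rewrite mul1r proj_YT0.
rewrite proj_YT_step (IH (ltnW hj)) proj_Y // (proj_YD_small (ltnW hj)).
by rewrite mulr0n !(mulr0, mul0r, addr0, scaler0).
Qed.

Lemma proj_YTr : e (Y ^+ r * T) = eps *: e (Y ^+ r).
Proof.
rewrite -(prednK r_gt0) proj_YT_step proj_YT ?prednK // (@proj_YD_small r.-1) ?prednK //.
by rewrite mulr0 !mul0r add0r addr0.
Qed.

Lemma proj_YTgT_step p g k : homog p g ->
  e (Y ^+ k.+1 * T * i g * T) = e (Y ^+ k * T * i (X * g) * T)
    + eps *: (g * e (Y ^+ k.+1 * T)
              + (-1) ^+ p *: (C * X * g * e (Y ^+ k * T) * C)).
Proof.
move=> hg; rewrite (tow_step tow _ hg) !(linearD, linearZ) /= eMr !eMl.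
by rewrite scalerDr !scalerA mulrC.
Qed.

(** Every correction in [proj_YTgT_step] contains some [e (Y ^+ j * T)] with [j] < r, which is 0. *)
Lemma proj_YTgT p g k : homog p g -> (k < r)%N ->
  e (Y ^+ k * T * i g * T) = e (T * i (X ^+ k * g) * T).
Proof.
elim: k p g => [|k IH] p g hg hk; first by rewrite !mul1r.
rewrite (proj_YTgT_step _ hg) (proj_YT hk) (proj_YT (ltnW hk)).
rewrite !mulr0 mul0r scaler0 addr0 scaler0 addr0 (IH p) ?(ltnW hk) //.
  by rewrite exprSr mulrA.
exact: (homogM (ext_homogY ext0) hg).
Qed.

Lemma proj_YTCT (a : bool) k : e (Y ^+ k * T * i (C ^+ a) * T)
  = eps *: (e (Y ^+ k * T) * C ^+ a) + e (Y ^+ k * D ^+ a).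
Proof. by rewrite (tow_step0 tow) linearD linearZ /= eMr. Qed.

(** Both sides vanish on the [T0] summand, the left one because the braid relation puts the product
    into H_k T H_k. On [X ^+ j * C ^+ a] the two factors reappear outside as [Y ^+ j] and
    [D ^+ a]. *)
Lemma proj_TbT b : e (T * i b * T) = i0 (e0 b).
Proof.
elim: (spanB b) => {b} [|x y _ hx _ hy|x y hT|j a h hj].
- by rewrite linear0 mulr0 mul0r !linear0.
- by rewrite linearD mulrDr mulrDl !linearD /= hx hy.
- rewrite (proj_T proj0) // linear0.
  rewrite !(ext_M ext) !mulrA -(tow_commT tow) -!mulrA (tow_commT tow) !mulrA.
  rewrite -!(mulrA (i (i0 x))) (tow_braid tow) // !mulrA -(ext_M ext) -mulrA -(ext_M ext).
  exact: proj_T proj _ _ _.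
- rewrite (ext_M ext) -!mulrA (tow_commT tow) !mulrA eMr.
  have hC : homog a (C ^+ a) := homogXb a (ext_homogD ext0).
  rewrite -(proj_YTgT hC hj) proj_YTCT (proj_YT hj) mul0r scaler0 add0r.
  rewrite (projYD ext proj a hj) (proj_X proj0) //.
  by case: ifP => _; rewrite ?mul1r // mul0r linear0.
Qed.

Variable s : R.
Hypotheses (e0Xr : e0 (X ^+ r) = s *: (1 : B0)).
Hypotheses (e0XC : forall j, e0 (X ^+ j * C) = 0).

Let r1r : (r.-1 < r)%N. Proof. by rewrite prednK. Qed.

(** The comparison behind [s_Yr], now under [e]: the terms [eps *: e (Y ^+ r * T)] cancel again, and
    what remains is [e (T * i (X ^+ r) * T)], known from the level below. *)
Lemma proj_Yr : e (Y ^+ r) = s *: (1 : B).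
Proof.
have := proj_YTCT false r; have := @proj_YTgT_step false 1 r.-1 homog1.
rewrite expr0 !mulr1 prednK // scale1r => ->.
rewrite (proj_YTgT (ext_homogY ext0) r1r) -exprSr prednK // proj_TbT e0Xr.
rewrite (proj_YT r1r) !(mulr0, mul0r, mul1r) addr0 addrC => /addrI <-.
by rewrite linearZ /= (ext_1 ext0).
Qed.

Lemma proj_YrT : e (Y ^+ r * T) = (eps * s) *: (1 : B).
Proof. by rewrite proj_YTr proj_Yr scalerA. Qed.

Let homC : homog true C := ext_homogD ext0.

(** The same comparison with [C] between the two [T]. The remaining terms are [e (Y ^+ r * T)] times
    [C], on the left and on the right; they agree because [proj_YrT] makes this value a scalar. *)
Lemma proj_YrD : e (Y ^+ r * D) = 0.
Proof.
have := proj_YTCT true r; have := proj_YTgT_step r.-1 homC.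
rewrite expr1 prednK // => ->.
have hXC : homog true (X * C) := homogM (ext_homogY ext0) homC.
rewrite (proj_YTgT hXC r1r) mulrA -exprSr prednK // proj_TbT e0XC linear0.
rewrite (proj_YT r1r) !(mulr0, mul0r) scaler0 addr0 add0r proj_YrT.
rewrite -super_scalerAr -super_scalerAl mulr1 mul1r => /esym/eqP.
by rewrite -subr_eq0 addrC addKr => /eqP.
Qed.

Lemma proj_Yr1T : e (Y ^+ r.+1 * T) = (eps * s) *: X + eps *: e (Y ^+ r.+1).
Proof.
rewrite proj_YT_step proj_YrT proj_YrD mulr0 mul0r addr0.
by rewrite -super_scalerAl mul1r.
Qed.

(** At exponent r + 1 the value [e (Y ^+ r.+1)] is not computed; it is enough that it commutes with
    [C], as [Y] commutes with H_k. The terms in [C * X] cancel, and the term in [X * C] occurs in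
    both expansions. *)
Lemma proj_Yr1D : e (Y ^+ r.+1 * D) = 0.
Proof.
have := proj_YTCT true r.+1; have := proj_YTgT_step r homC.
rewrite expr1 => ->.
have hXC : homog true (X * C) := homogM (ext_homogY ext0) homC.
have hXXC : homog true (X * (X * C)) := homogM (ext_homogY ext0) hXC.
have := proj_YTgT_step r.-1 hXC; rewrite prednK // => ->.
rewrite (proj_YTgT hXXC r1r) !mulrA -!exprSr prednK // proj_TbT e0XC linear0.
rewrite (proj_YT r1r) !(mulr0, mul0r) scaler0 addr0 add0r proj_YrT proj_Yr1T.
rewrite expr1 scaleN1r.
have comC : C * e (Y ^+ r.+1) = e (Y ^+ r.+1) * C.
  by rewrite -eMl -eMr (ext_commYX ext).
rewrite -!(super_scalerAr, super_scalerAl) !mulr1 -(mulrA _ C C) (ext_DD ext0) mulr1.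
rewrite !(mulrDl, mulrDr) -!(super_scalerAr, super_scalerAl) comC.
rewrite (addrC (_ *: (C * X))) addrK -scalerDr -[LHS]addr0 => /addrI <-.
by [].
Qed.

(** Supplies the hypothesis [eYTY'] of the duality: the value [eps *: e Y] of [e (Y * T)] cancels
    the correction that arises when [Y'] crosses [T]. *)
Lemma proj_YTY' : e (Y * T * Y') = 0.
Proof.
have -> : Y * T * Y' = i X' * (Y * T) - eps *: (i X' * Y - i X' * (i C * (Y * D))).
  rewrite -mulrA (tow_TY' tow) mulrBr -super_scalerAr mulrBr !mulrA.
  rewrite -!(mulrA Y (i X') (i C)) -(ext_M ext) -!(ext_commY ext).
  by rewrite (ext_M ext).
rewrite !(linearB, linearZ) /= !eMl.
have := @proj_YT_step 0; rewrite !mul1r proj_YT0 mul0r expr1 add0r => ->.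
have YD1 : e (Y * D) = 0.
  move: r_gt0; rewrite leq_eqVlt => /orP[/eqP r1|r1].
    by have := proj_YrD; rewrite -r1 expr1.
  by have := proj_YD_small r1; rewrite expr1.
have := proj_YD_small r_gt0; rewrite mul1r => ->.
by rewrite YD1 !(mulr0, mul0r, oppr0, addr0) -super_scalerAr scalerN subrr.
Qed.

Lemma proj_YDTD : e (Y ^+ r * D * T * D) = 0.
Proof.
have -> : Y ^+ r * D * T * D = - (Y ^+ r * T * D * i C).
  rewrite -(mulrA _ D T) -(tow_TC tow) -!mulrA (ext_commD ext homC) expr1 scaleN1r.
  by rewrite !mulrN.
have -> : Y ^+ r * T * D = i C * (Y ^+ r * T) - eps *: (i C * Y ^+ r - Y ^+ r * D).
  rewrite -mulrA (tow_TD tow) mulrBr -super_scalerAr mulrBr !mulrA.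
  by rewrite -(ext_commYX ext).
rewrite linearN /= eMr !(linearB, linearZ) /= !eMl proj_YrT proj_YrD proj_Yr.
by rewrite oppr0 subr0 -!super_scalerAr scalerN scalerA subrr mul0r oppr0.
Qed.

Lemma tower_duality p x : homog p x ->
  e (Y ^+ r * D * x * D) = (s * (-1) ^+ p) *: e x.
Proof.
apply: (proj_duality ext (tow_homogT tow) proj spanA r_gt0 proj_Yr proj_YrD proj_Yr1D).
- by move=> _; apply: proj_YTY'.
- by move=> _; apply: proj_YDTD.
Qed.

Lemma tower_YD j : e (Y ^+ j * D) = 0.
Proof.
apply: (proj_YD ext proj spanA r_gt0 proj_YrD proj_Yr1D).
by move=> _; apply: proj_YTY'.
Qed.

Lemma tower_commYX j x : e (Y ^+ j * x) = e (x * Y ^+ j).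
Proof.
apply: (proj_commYX ext proj spanA proj_YrD proj_Yr1D).
by move=> _; apply: proj_YTY'.
Qed.

Lemma proj_YTD k : e (Y ^+ k * T * D) = C * (e (Y ^+ k * T) - eps *: e (Y ^+ k)).
Proof.
have -> : Y ^+ k * T * D = i C * (Y ^+ k * T) - eps *: (i C * Y ^+ k - Y ^+ k * D).
  rewrite -mulrA (tow_TD tow) mulrBr -super_scalerAr mulrBr !mulrA.
  by rewrite -(ext_commYX ext).
rewrite linearB linearZ linearB /= !eMl tower_YD subr0 mulrBr.
by rewrite -super_scalerAr.
Qed.

(** At [k] = r both terms of [proj_YTD] are the scalar [eps * s]; for 0 < [k] < r both are 0. At [k]
    = 0 they would differ, [e (Y ^+ 0)] being 1. *)
Lemma proj_YTD0 k : (0 < k <= r)%N -> e (Y ^+ k * T * D) = 0.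
Proof.
case/andP=> k0; rewrite proj_YTD leq_eqVlt => /orP[/eqP ->|hk].
  by rewrite proj_YrT proj_Yr scalerA subrr mulr0.
by rewrite (proj_YT hk) (proj_Y hk) eqn0Ngt k0 scaler0 subrr mulr0.
Qed.

Lemma proj_TgDY k g : (0 < k <= r)%N -> e (T * i g * D * Y ^+ k) = 0.
Proof.
move=> hk; have [g0 [g1 [h0 h1 ->]]] := homog_split g.
suff H p h : homog p h -> e (T * i h * D * Y ^+ k) = 0.
  by rewrite linearD mulrDr !mulrDl linearD /= (H _ _ h0) (H _ _ h1) addr0.
move=> hh; rewrite -!mulrA (mulrA (i h)) (ext_commD ext hh) -super_scalerAl -super_scalerAr.
rewrite -mulrA (ext_commYX ext) !mulrA linearZ /= eMr -tower_commYX mulrA.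
by rewrite proj_YTD0 // mul0r scaler0.
Qed.

(** Each [Y] pushed left through [T] becomes an [X] next to [b]. Of the two corrections, the one
    with [D] dies by [proj_TgDY]; the other contains [e (Y ^+ k * T)], which is 0 below r and
    [eps * s] at r. Hence the constant [eps ^+ 2 * s]. *)
Lemma proj_TbTY k b : (k <= r)%N -> e (T * i b * T * Y ^+ k) =
  i0 (e0 (b * X ^+ k)) + (if k == r then eps ^+ 2 * s else 0) *: b.
Proof.
elim: k b => [|k IH] b hk.
  by rewrite !mulr1 proj_TbT eq_sym (gtn_eqF r_gt0) scale0r addr0.
have -> : T * i b * T * Y ^+ k.+1 = T * i (b * X) * T * Y ^+ k +
    eps *: (T * Y ^+ k.+1 * i b - T * i (b * C) * D * Y ^+ k.+1).
  transitivity (T * i b * (T * Y) * Y ^+ k); first by rewrite exprS !mulrA.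
  rewrite (tow_TY tow) mulrDr mulrDl.
  rewrite !(ext_M ext) -!super_scalerAr -super_scalerAl mulrBr mulrBl !mulrA.
  rewrite -!(mulrA _ Y (Y ^+ k)) -exprS; congr (_ + _ *: (_ - _)).
  by rewrite -!mulrA (ext_commYX ext).
rewrite !(linearB, linearD, linearZ) /= IH ?(ltnW hk) // (ltn_eqF hk) scale0r addr0.
rewrite proj_TgDY // subr0 eMr -tower_commYX -mulrA -exprS; congr (_ + _).
move: hk; rewrite leq_eqVlt => /orP[/eqP ->|hk].
  by rewrite eqxx proj_YrT -super_scalerAl mul1r scalerA mulrA.
by rewrite (ltn_eqF hk) (proj_YT hk) mul0r scaler0 scale0r.
Qed.

End TowerProjection.

(** * Traces *)

Definition ssign (R : comUnitRingType) (super p q : bool) : R :=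
  if super then (-1) ^+ (p && q) else 1.

Definition trace_form (R : comUnitRingType) (super : bool) (A : superAlgType R)
    (t : A -> R) : Prop :=
  forall p q x y, homog p x -> homog q y -> t (x * y) = ssign R super p q * t (y * x).

Section TraceStep.
Variables (R : comUnitRingType) (A B : superAlgType R) (i : {linear B -> A}).
Variables (Y Y' D : A) (r : nat) (s : R) (e : {linear A -> B}).
Hypothesis ext : extension i Y Y' D.
Hypothesis eMl : forall h x, e (i h * x) = h * e x.
Hypothesis eMr : forall h x, e (x * i h) = e x * h.
Hypothesis e_homog : forall p x, homog p x -> homog p (e x).
Hypothesis eY : forall x, e (Y * x) = e (x * Y).
Hypothesis eD : forall p x, homog p x ->
  e (Y ^+ r * D * x * D) = (s * (-1) ^+ p) *: e x.
(** The exponents in [z]. A list treats [Y ^+ m] and [Y ^+ m + Y ^+ m.+1] at once; [ks_sym] is their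
    common invariance under k -> r - k. *)
Variable ks : seq nat.
Hypothesis ks_le : forall k, k \in ks -> (k <= r)%N.
Hypothesis ks_sym : \sum_(k <- ks) Y ^+ (r - k) = \sum_(k <- ks) Y ^+ k.
Let z := \sum_(k <- ks) Y ^+ k.

Lemma trz_commY : z * Y = Y * z.
Proof. by rewrite mulr_suml mulr_sumr; apply: eq_bigr => k _; rewrite -exprS -exprSr. Qed.

Lemma trz_commYX j : z * Y ^+ j = Y ^+ j * z.
Proof.
elim: j => [|j IH]; first by rewrite mulr1 mul1r.
by rewrite exprS mulrA trz_commY -mulrA IH mulrA.
Qed.

Lemma trz_comm h : z * i h = i h * z.
Proof. by rewrite mulr_suml mulr_sumr; apply: eq_bigr => k _; rewrite (ext_commYX ext). Qed.

Lemma trz_homog : homog false z.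
Proof. by apply: homog_sum => k _; apply: homogX (ext_homogY ext). Qed.

Lemma trz_conj : D * z * D * Y ^+ r = z.
Proof.
rewrite -[RHS]ks_sym mulr_sumr !mulr_suml.
rewrite big_seq [RHS]big_seq; apply: eq_bigr => k /ks_le hk.
rewrite (ext_DYX ext) -!mulrA (mulrA D) (ext_DD ext) mul1r.
by rewrite -{1}(subnKC hk) exprD mulrA -(exprMn_comm) ?(ext_Y'Y ext) ?expr1n ?mul1r //;
  rewrite /GRing.comm (ext_Y'Y ext) (ext_YY' ext).
Qed.

Lemma tr_commYX j x : e (Y ^+ j * x) = e (x * Y ^+ j).
Proof.
elim: j x => [|j IH] x; first by rewrite mulr1 mul1r.
by rewrite exprS -mulrA eY -mulrA IH -mulrA.
Qed.

(** Replace [z] by [D * z * D * Y ^+ r], carry [Y ^+ r] to the front under [e], and apply [eD] to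
    [x * D * z], whose parity is opposite to that of [x]. *)
Lemma tr_D q x : homog q x -> e (D * x * z) = (s * (-1) ^+ (~~ q)) *: e (x * D * z).
Proof.
move=> hx; have hxD : homog (~~ q) (x * D * z).
  have := homogM (homogM hx (ext_homogD ext)) trz_homog.
  by rewrite addbF addbT.
rewrite -eD // -{1}trz_conj !mulrA -tr_commYX !mulrA.
by rewrite -!mulrA (mulrA D) -mulrA.
Qed.

Variable super : bool.
Hypothesis s_def : s = if super then - 1 else 1.
Variable tB : {linear B -> R^o}.
Hypothesis tB_even : forall x, homog true x -> tB x = 0.
Hypothesis tB_trace : trace_form super tB.
Let tA x := tB (e (x * z)).

Lemma tr_even x : homog true x -> tA x = 0.
Proof.
move=> hx; apply/tB_even/e_homog.
exact: (homogM hx trz_homog).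
Qed.

Definition tr_commutes q y := forall p x, homog p x ->
  tA (x * y) = ssign R super p q * tA (y * x).

Lemma tr_commutes_i q h : homog q h -> tr_commutes q (i h).
Proof.
move=> hh p x hx; rewrite /tA -mulrA -trz_comm mulrA eMr -[i h * x * z]mulrA eMl.
by apply: tB_trace => //; apply: e_homog; have := homogM hx trz_homog; rewrite addbF.
Qed.

Lemma tr_commutes_Y : tr_commutes false Y.
Proof.
move=> p x hx; rewrite /tA -mulrA -trz_commY mulrA -eY mulrA /ssign andbF.
by case: super; rewrite mul1r.
Qed.

(** For even [x] the products with [D] are odd and [tB] kills their images; for odd [x] the factor
    in [tr_D] is [s] itself, which is the sign required by [ssign]. *)
Lemma tr_commutes_D : tr_commutes true D.
Proof.
move=> p x hx; rewrite /tA (tr_D hx) linearZ /= s_def /ssign andbT.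
have hw : homog (~~ p) (e (x * D * z)).
  have := homogM (homogM hx (ext_homogD ext)) trz_homog.
  by rewrite addbF addbT; apply: e_homog.
case: p hx hw => /= hx hw; last by rewrite (tB_even hw) scaler0 mulr0.
by case: super => /=; rewrite mulr1 ?scaleN1r ?scale1r ?mulN1r ?opprK ?mul1r.
Qed.

Lemma tr_commutesM p q x y : homog p x -> homog q y -> tr_commutes p x -> tr_commutes q y ->
  tr_commutes (p (+) q) (x * y).
Proof.
move=> hx hy cx cy u w hw.
rewrite mulrA (cy _ _ (homogM hw hx)) mulrA (cx _ _ (homogM hy hw)) !mulrA.
congr (_ * _); rewrite /ssign; case: super; last by rewrite mul1r.
by case: u {hw}; case: p {hx cx}; case: q {hy cy}; rewrite //= ?mulr1 ?mul1r ?mulrNN ?mulr1.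
Qed.

End TraceStep.

(** * The trace property of [T], from two levels below *)

Section TraceTower.
Variables (R : comUnitRingType) (A B B0 : superAlgType R).
Variables (i : {linear B -> A}) (i0 : {linear B0 -> B}).
Variables (Y Y' D T : A) (X X' C : B) (hasT0 : bool) (T0 : B) (eps : R) (r : nat).
Hypothesis tow : tower i i0 Y Y' D T X X' C hasT0 T0 eps.
Let ext := tow_ext tow.
Let ext0 := tow_ext0 tow.
Hypothesis r_gt0 : (0 < r)%N.
Hypothesis spanA : forall x, mspan i Y D true T r x.
Hypothesis spanB : forall x, mspan i0 X C hasT0 T0 r x.
Variables (e : {linear A -> B}) (e0 : {linear B -> B0}).
Hypothesis proj : projection i Y D true T r e.
Hypothesis proj0 : projection i0 X C hasT0 T0 r e0.
Let eMl := projMl ext proj spanA.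
Let eMr := projMr ext proj spanA.
Let eMl0 := projMl ext0 proj0 spanB.
Let eMr0 := projMr ext0 proj0 spanB.
Variable s : R.
Hypotheses (e0Xr : e0 (X ^+ r) = s *: (1 : B0)).
Hypotheses (e0XC : forall j, e0 (X ^+ j * C) = 0).
Variable ks : seq nat.
Hypothesis ks_le : forall k, k \in ks -> (k <= r)%N.
Hypothesis ks_sym : \sum_(k <- ks) Y ^+ (r - k) = \sum_(k <- ks) Y ^+ k.
Let z := \sum_(k <- ks) Y ^+ k.
Let z0 := \sum_(k <- ks) X ^+ k.
Variable super : bool.
Hypothesis s_def : s = if super then - 1 else 1.
Variables (tB : {linear B -> R^o}) (t0 : {linear B0 -> R^o}).
Hypothesis tB_even : forall x, homog true x -> tB x = 0.
Hypothesis tB_trace : trace_form super tB.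
Hypothesis tB_def : forall x, tB x = t0 (e0 (x * z0)).

Let eYX := tower_commYX tow r_gt0 spanA spanB proj proj0 e0Xr e0XC.
Let eD := tower_duality tow r_gt0 spanA spanB proj proj0 e0Xr e0XC.

Let kappa := \sum_(k <- ks) (if k == r then eps ^+ 2 * s else 0).

Lemma proj_TbTz b : e (T * i b * T * z) = i0 (e0 (b * z0)) + kappa *: b.
Proof.
rewrite !mulr_sumr !linear_sum scaler_suml -big_split /=.
rewrite big_seq [RHS]big_seq; apply: eq_bigr => k /ks_le hk.
by rewrite (proj_TbTY tow r_gt0 spanA spanB proj proj0 e0Xr e0XC).
Qed.

Let tB_i0r b w : tB (b * i0 w) = t0 (e0 (b * z0) * w).
Proof. by rewrite tB_def -mulrA -(trz_comm ext0) mulrA eMr0. Qed.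

Let tB_i0l b w : tB (i0 w * b) = t0 (w * e0 (b * z0)).
Proof. by rewrite tB_def -mulrA eMl0. Qed.

Let hD := ext_homogD ext.
Let hT := tow_homogT tow.
Let e_homog := proj_homog ext hT proj spanA.
Let z_homog : homog false z := trz_homog ext ks.

(** The duality for the odd element [T * (Y ^+ j * D) * z], with [Y ^+ r] carried to the back under
    [e], where it meets [D * z * D]. *)
Lemma proj_TYDz j : e (Y ^+ j * D * T * z) = - s *: e (T * (Y ^+ j * D) * z).
Proof.
have h : homog true (T * (Y ^+ j * D) * z).
  by have := homogM (homogM hT (homogM (homogX j (ext_homogY ext)) hD)) z_homog.
have := eD h; rewrite expr1 mulrN1 => <-.
have -> : Y ^+ r * D * (T * (Y ^+ j * D) * z) * D
  = Y ^+ r * (D * T * Y ^+ j * (D * z * D)) by rewrite !mulrA.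
rewrite eYX -(mulrA _ (D * z * D)) (trz_conj ext ks_le ks_sym).
by rewrite -!mulrA eYX -!mulrA trz_commYX.
Qed.

Let tA x := tB (e (x * z)).

(** On H_k T H_k both sides become [t0 (e0 (x * z0) * e0 (y * z0))] plus [kappa] times [tB (x * y)];
    [tB_def], that the form on H_k is itself a twisted form over H_{k-1}, is essential to this. On
    the other summands [Y ^+ j * D ^+ a] passes [T] under [e], and the trace property of [tB] moves
    the factor from H_k. *)
Lemma tower_traceT x : tA (x * T) = tA (T * x).
Proof.
rewrite /tA; elim: (spanA x) => {x} [|x y _ hx _ hy|x y _|j a h hj].
- by rewrite mul0r mulr0.
- by rewrite mulrDl mulrDr !mulrDl !linearD /= hx hy.
- have -> : i x * T * i y * T * z = i x * (T * i y * T * z) by rewrite !mulrA.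
  rewrite eMl proj_TbTz.
  have -> : T * (i x * T * i y) * z = T * i x * T * z * i y.
    by rewrite -[RHS]mulrA (trz_comm ext) !mulrA.
  rewrite eMr proj_TbTz mulrDl mulrDr !linearD /= tB_i0r tB_i0l.
  by rewrite -super_scalerAl -super_scalerAr.
- have [h0 [h1 [hh0 hh1 ->]]] := homog_split h.
  suff H q g : homog q g -> tB (e (Y ^+ j * D ^+ a * i g * T * z))
      = tB (e (T * (Y ^+ j * D ^+ a * i g) * z)).
    rewrite linearD mulrDr mulrDl mulrDr !mulrDl !linearD /=.
    by rewrite (H _ _ hh0) (H _ _ hh1).
  move=> hg {h h0 h1 hh0 hh1 hj}.
  have -> : T * (Y ^+ j * D ^+ a * i g) * z = T * (Y ^+ j * D ^+ a) * z * i g.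
    by rewrite -[RHS]mulrA (trz_comm ext) !mulrA.
  have -> : Y ^+ j * D ^+ a * i g * T * z =
    (-1) ^+ (q && a) *: (i g * (Y ^+ j * D ^+ a * T * z)).
    rewrite !mulrA (ext_commYX ext) -(mulrA _ (i g) (D ^+ a)) (ext_commDb ext a hg).
    rewrite -super_scalerAr -!super_scalerAl scalerA -signr_addb addbb scale1r.
    by rewrite !mulrA.
  rewrite linearZ /= eMl eMr linearZ /=.
  case: a; last first.
    rewrite andbF scale1r !mulr1.
    have -> : e (T * Y ^+ j * z) = e (Y ^+ j * T * z).
      by rewrite -(mulrA (Y ^+ j)) eYX -!mulrA trz_commYX.
    rewrite (tB_trace hg (e_homog (homogM (homogM (homogX j (ext_homogY ext)) hT) z_homog))).
    by rewrite /ssign andbF; case: super; rewrite mul1r.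
  rewrite expr1 andbT proj_TYDz.
  have hw : homog true (e (T * (Y ^+ j * D) * z)).
    exact: e_homog (homogM (homogM hT (homogM (homogX j (ext_homogY ext)) hD)) z_homog).
  rewrite -super_scalerAr linearZ /= (tB_trace hw hg) s_def.
  (* For even [g] the argument of [tB] is odd. For odd [g], moving it past [D] and the factor [- s]
     together give [s], the value of [ssign] on two odd elements. *)
  case: q hg => hg; last first.
    by rewrite tB_even ?scaler0 ?mulr0 //; have := homogM hg hw; rewrite addFb.
  by rewrite /ssign; case: super => /=;
    rewrite ?opprK ?expr1 ?scale1r ?scaleN1r ?mulN1r ?mul1r ?opprK.
Qed.

End TraceTower.

(** * Nondegeneracy *)

(* A substitute for dual bases: a spanning family with such a pairing is a
   basis with invertible Gram determinant, so no basis theorem is needed. *)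
Record triangular (R : comUnitRingType) (A B : superAlgType R) (e : A -> B)
    (M : seq (A * A)) : Prop := Triangular {
  tri_pairwise : pairwise (fun p q => e (q.1 * p.2) == 0) M;
  tri_unit : forall p, p \in M ->
    exists2 u : R, u \is a GRing.unit & e (p.1 * p.2) = u *: (1 : B);
  tri_homog : forall p, p \in M -> exists c, homog c p.2
}.

Section Rspan.
Variables (R : comUnitRingType) (A B : superAlgType R) (i : B -> A).

Inductive rspan (M : seq (A * A)) : A -> Prop :=
| rspan0 : rspan M 0
| rspanD x y : rspan M x -> rspan M y -> rspan M (x + y)
| rspanM p h : p \in M -> rspan M (p.2 * i h).

Inductive lspan (M : seq (A * A)) : A -> Prop :=
| lspan0 : lspan M 0
| lspanD x y : lspan M x -> lspan M y -> lspan M (x + y)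
| lspanZ p (a : R) : p \in M -> lspan M (a *: p.2).

End Rspan.

Section Nondegenerate.
Variables (R : comUnitRingType) (A : superAlgType R) (t : {linear A -> R^o}).
Variables (M : seq (A * A)) (u u' : A).
Hypotheses (uu' : u * u' = 1) (u'u : u' * u = 1) (hu : homog false u).
Hypothesis tri : triangular t M.
Hypothesis span : forall x, lspan M x.

Let d := size M.
Let m0 : A * A := (0, 0).
(** The factor [u'] undoes the twist, so that the twisted form pairs the [g k] with the [b l] by the
    triangular matrix of [M]. *)
Let b (k : 'I_d) : A := (nth m0 M k).2 * u'.
Let g (k : 'I_d) : A := (nth m0 M k).1.
Let tu x := t (x * u).

Let span_coef x : exists c : 'I_d -> R, x = \sum_k c k *: b k.
Proof.
suff [c hc] : exists c : 'I_d -> R, x * u = \sum_k c k *: (nth m0 M k).2.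
  exists c; rewrite -[LHS]mulr1 -uu' mulrA hc mulr_suml.
  by apply: eq_bigr => k _; rewrite super_scalerAl.
elim: (span (x * u)) => [|y z _ [c1 ->] _ [c2 ->]|p a hp].
- by exists (fun=> 0); rewrite big1 // => k _; rewrite scale0r.
- exists (fun k => c1 k + c2 k); rewrite -big_split /=.
  by apply: eq_bigr => k _; rewrite scalerDl.
- have hk : (index p M < d)%N by rewrite index_mem.
  exists (fun k => if k == Ordinal hk then a else 0).
  rewrite (bigD1 (Ordinal hk)) //= eqxx nth_index // big1 ?addr0 // => k /negPf ->.
  by rewrite scale0r.
Qed.

Let P : 'M[R]_d := \matrix_(k, l) tu (g k * b l).

Let PE k l : P k l = t (g k * (nth m0 M l).2).
Proof. by rewrite mxE /tu /b -!mulrA u'u mulr1. Qed.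

Let P_unit : \det P \is a GRing.unit.
Proof.
rewrite -det_tr det_trig; last first.
  apply/is_trig_mxP => k l hkl; rewrite mxE PE; apply/eqP.
  exact: ((pairwiseP m0 (tri_pairwise tri)) k l (ltn_ord k) (ltn_ord l) hkl).
rewrite rpred_prod // => k _; rewrite mxE PE.
have [v hv] := tri_unit tri (mem_nth m0 (ltn_ord k)).
by rewrite /g => ->; rewrite -[_ *: _]/(v * 1) mulr1.
Qed.

(** The triangular matrix [P] is invertible, which makes the spanning family [b] linearly
    independent. Expanding the [g k] in this family factors [P] as [N] times the Gram matrix of [b],
    whose determinant therefore divides a unit. *)
Lemma triangular_nondegenerate : Defs.nondegenerate (fun x => t (x * u)).
Proof.
exists d, b; split.
- move=> x; have [c Dx] := span_coef x; exists [ffun k => c k]; split.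
    by rewrite Dx; apply: eq_bigr => k _; rewrite ffunE.
  move=> c'; rewrite Dx => E; apply/ffunP => k; rewrite ffunE.
  have H (f : 'I_d -> R) l : tu (g l * \sum_k f k *: b k) = (P *m \col_k f k) l 0.
    rewrite /tu mulr_sumr mulr_suml linear_sum mxE; apply: eq_bigr => k' _.
    by rewrite -super_scalerAr -super_scalerAl linearZ !mxE /tu -[LHS]/(f k' * _) mulrC.
  have E2 : P *m \col_k c k = P *m \col_k c' k.
    by apply/colP => l; rewrite -!H E.
  have PU : P \in unitmx by [].
  by move/(congr1 (mulmx (invmx P)))/colP/(_ k): E2; rewrite !mulKmx // !mxE.
- move=> k; have [c hc] := tri_homog tri (mem_nth m0 (ltn_ord k)).
  by exists c; have := homogM hc (homog_inv hu uu' u'u); rewrite addbF.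
- have [N PN] : exists N : 'M[R]_d, P = N *m \matrix_(k, l) t (b k * b l * u).
    have [c hc] := fin_all_exists (fun k : 'I_d => span_coef (g k)).
    exists (\matrix_(k, l) c k l); apply/matrixP => k l; rewrite !mxE {1}hc.
    rewrite /tu !mulr_suml linear_sum; apply: eq_bigr => k' _.
    by rewrite !mxE -!super_scalerAl linearZ.
  by move: P_unit; rewrite PN det_mulmx unitrM => /andP[].
Qed.

End Nondegenerate.

(** * Composition of triangular pairings along the tower *)

Section TriangularTower.
Variables (R : comUnitRingType) (A B : superAlgType R) (i : {linear B -> A}).
Variables (e : {linear A -> B}) (tB : {linear B -> R^o}).
Hypothesis iM : {morph i : x y / x * y}.
Hypothesis i_homog : forall p x, homog p x -> homog p (i x).
Hypothesis eMl : forall h x, e (i h * x) = h * e x.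
Hypothesis eMr : forall h x, e (x * i h) = e x * h.
Variables (M : seq (A * A)) (N : seq (B * B)).
Hypothesis triM : triangular e M.
Hypothesis triN : triangular tB N.
Let t x := tB (e x).

Definition pair_mul (p : A * A) (c : B * B) := (i c.1 * p.1, p.2 * i c.2).

Let tE p q c c' : t ((pair_mul p c).1 * (pair_mul q c').2) = tB (c.1 * e (p.1 * q.2) * c'.2).
Proof. by rewrite /t /= !mulrA eMr -!mulrA eMl !mulrA. Qed.

(** Bilinearity over H_k puts [e (p.1 * q.2)] between two factors from [N]. It is 0 when [q]
    precedes [p] in [M], and a unit for [p] equal to [q], where the pairing of [N] takes over: the
    list is triangular in lexicographic order. *)
Lemma triangular_comp : triangular (B := R^o) t [seq pair_mul p c | p <- M, c <- N].
Proof.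
split.
- case: triM => pw unitM _; elim: M pw unitM => //= p M' IH /andP[/allP pM' pwM'] unitM.
  rewrite pairwise_cat; apply/and3P; split.
  + apply/allrelP => x y /mapP[c cN ->] /allpairsP[[q c'] /= [qM' c'N ->]].
    by rewrite tE (eqP (pM' _ qM')) mulr0 mul0r linear0.
  + rewrite pairwise_map; have [v vU pE] := unitM p (mem_head _ _).
    apply: sub_pairwise (tri_pairwise triN) => c c' /= /eqP h.
    by rewrite tE pE -super_scalerAr mulr1 -super_scalerAl linearZ /= h scaler0.
  + by apply: IH => // q qM'; apply: unitM; rewrite inE qM' orbT.
- move=> x /allpairsP[[p c] /= [pM cN ->]]; rewrite tE.
  have [v vU ->] := tri_unit triM pM; have [w wU E] := tri_unit triN cN.
  exists (v * w); first by rewrite unitrM vU.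
  by rewrite -super_scalerAr mulr1 -super_scalerAl linearZ /= E scalerA.
- move=> x /allpairsP[[p c] /= [pM cN ->]].
  have [a ha] := tri_homog triM pM; have [a' ha'] := tri_homog triN cN.
  by exists (a (+) a'); apply: homogM => //; apply: i_homog.
Qed.

Lemma lspan_comp : (forall x, rspan i M x) -> (forall y, lspan N y) ->
  forall x, lspan [seq pair_mul p c | p <- M, c <- N] x.
Proof.
move=> sM sN x; elim: (sM x) => {x} [|x y _ hx _ hy|p h pM].
- exact: lspan0.
- exact: lspanD.
- elim: (sN h) => {h} [|x y _ hx _ hy|c a cN].
  + by rewrite linear0 mulr0; apply: lspan0.
  + by rewrite linearD mulrDr; apply: lspanD.
  + rewrite linearZ /= -super_scalerAr.
    by apply: (@lspanZ _ _ _ (pair_mul p c)); apply/allpairsP; exists (p, c).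
Qed.

End TriangularTower.

(** * Explicit triangular pairings at one level *)

Section Frame.
Variables (R : comUnitRingType) (A B : superAlgType R) (i : {linear B -> A}).
Variables (Y Y' D : A) (r : nat) (s : R) (e : {linear A -> B}).

(* The partner of [Y ^+ m] is [Y ^+ (r - m)] since [e (Y ^+ r)] is a unit while
   [e (Y ^+ j) = 0] for [0 < j < r]. *)
Fixpoint frame n : seq (A * A) := if n is m.+1 then
  frame m ++ [:: (if m == 0 then 1 else Y ^+ (r - m), Y ^+ m); (Y ^+ m * D, Y ^+ m * D)]
  else [::].

Hypothesis ext : extension i Y Y' D.
Hypothesis r_gt0 : (0 < r)%N.
Hypothesis s_unit : s \is a GRing.unit.
Hypothesis eY : forall j, (j < r)%N -> e (Y ^+ j) = (j == 0)%:R.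
Hypothesis eYr : e (Y ^+ r) = s *: (1 : B).
Hypothesis eYD : forall j, e (Y ^+ j * D) = 0.

Variant frame_spec n : A * A -> Prop :=
| FrameY m of (m < n)%N : frame_spec n (if m == 0 then 1 else Y ^+ (r - m), Y ^+ m)
| FrameD m of (m < n)%N : frame_spec n (Y ^+ m * D, Y ^+ m * D).

Lemma frameP n p : p \in frame n -> frame_spec n p.
Proof.
elim: n => //= n IH; rewrite mem_cat !inE => /or3P[/IH[]|/eqP ->|/eqP ->];
  by constructor => //; apply: ltnW.
Qed.

Lemma frame_mem (n : nat) j (a : bool) : (j < n)%N ->
  exists2 p, p \in frame n & p.2 = Y ^+ j * D ^+ a.
Proof.
elim: n => // n IH; rewrite ltnS leq_eqVlt => /orP[/eqP -> {IH}|/IH[p pn E]] /=.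
  case: a.
    by exists (Y ^+ n * D, Y ^+ n * D); rewrite // mem_cat !inE eqxx !orbT.
  exists (if n == 0 then 1 else Y ^+ (r - n), Y ^+ n); last by rewrite mulr1.
  by rewrite mem_cat inE eqxx orbT.
by exists p; rewrite // mem_cat pn.
Qed.

Let YDY m j : (j <= m)%N -> Y ^+ m * D * Y ^+ j = Y ^+ (m - j) * D.
Proof. by move=> h; rewrite -mulrA (ext_DYX ext) mulrA (ext_YY'X ext). Qed.

Let YDYD m j : (j <= m)%N -> Y ^+ m * D * (Y ^+ j * D) = Y ^+ (m - j).
Proof. by move=> h; rewrite mulrA YDY // -mulrA (ext_DD ext) mulr1. Qed.

(** A later left factor times an earlier right factor is a power of [Y] times [D], or
    [Y ^+ (r - (m - j))], or [Y ^+ (m - j)] with 0 < [m - j] < r; [e] kills all of these. *)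
Lemma frame_triangular n : (n <= r)%N -> triangular e (frame n).
Proof.
move=> nr; split.
- elim: n nr => //= m IH mr; rewrite pairwise_cat IH ?(ltnW mr) //= !andbT.
  rewrite YDY // eYD eqxx andbT.
  apply/allrelP => p q /frameP pm; rewrite !inE => /orP[] /eqP ->; case: pm => j jm /=.
  + case: (m =P 0%N) => m0; first by rewrite m0 in jm.
    rewrite -exprD eY; last first.
      by rewrite -ltn_subRL subKn // ltnW.
    by rewrite addn_eq0 subn_eq0 leqNgt mr.
  + by case: (m =P 0%N) => m0; [rewrite m0 in jm|rewrite mulrA -exprD eYD].
  + by rewrite YDY ?eYD // ltnW.
  + rewrite YDYD ?(ltnW jm) // eY ?(leq_ltn_trans (leq_subr _ _) mr) //.
    by rewrite subn_eq0 leqNgt jm.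
- move=> p /frameP[m mn|m mn] /=.
  + case: eqP => [->|/eqP m0].
      by exists 1; rewrite ?unitr1 // mulr1 scale1r (@eY 0).
    by exists s => //; rewrite -exprD subnK // ltnW // (leq_trans mn).
  + by exists 1; rewrite ?unitr1 // YDYD // subnn (@eY 0) // scale1r.
- move=> p /frameP[m mn|m mn] /=.
  + by exists false; apply: homogX (ext_homogY ext).
  + by exists true; have := homogM (homogX m (ext_homogY ext)) (ext_homogD ext).
Qed.

Lemma frame_rspan T x : mspan i Y D false T r x -> rspan i (frame r) x.
Proof.
elim=> {x} [|x y _ hx _ hy|x y //|j a h hj].
- exact: rspan0.
- exact: rspanD.
- by have [p pr <-] := frame_mem a hj; apply: rspanM.
Qed.

End Frame.

Section TowerFrame.
Variables (R : comUnitRingType) (A B B0 : superAlgType R).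
Variables (i : {linear B -> A}) (i0 : {linear B0 -> B}).
Variables (Y Y' D T : A) (X X' C : B) (hasT0 : bool) (T0 : B) (eps : R) (r : nat).
Hypothesis tow : tower i i0 Y Y' D T X X' C hasT0 T0 eps.
Let ext := tow_ext tow.
Let ext0 := tow_ext0 tow.
Hypothesis r_gt0 : (0 < r)%N.
Hypothesis spanA : forall x, mspan i Y D true T r x.
Hypothesis spanB : forall x, mspan i0 X C hasT0 T0 r x.
Variables (e : {linear A -> B}) (e0 : {linear B -> B0}).
Hypothesis proj : projection i Y D true T r e.
Hypothesis proj0 : projection i0 X C hasT0 T0 r e0.
Let eMl := projMl ext proj spanA.
Let eMr := projMr ext proj spanA.
Variable s : R.
Hypothesis s_unit : s \is a GRing.unit.
Hypotheses (e0Xr : e0 (X ^+ r) = s *: (1 : B0)).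
Hypotheses (e0XC : forall j, e0 (X ^+ j * C) = 0).

Variable M : seq (B * B).
Hypothesis triM : triangular e0 M.
Hypothesis spanM : forall x, rspan i0 M x.

(** As H_{k-1} commutes with [T], the elements [i p.2 * T], with [p] in the list of the level below,
    span H_k T H_k as a right H_k-module. By [proj_TbT] their partners [T * i p.1] reproduce the
    pairing under [e0]. *)
Definition tower_frame : seq (A * A) :=
  [seq (T * i p.1, i p.2 * T) | p <- M] ++ frame Y D r r.

Let tri_frame : triangular e (frame Y D r r).
Proof.
apply: (frame_triangular ext (s := s)) => //.
- by move=> j hj; apply: (proj_Y tow proj).
- exact: (proj_Yr tow r_gt0 spanA spanB proj proj0 e0Xr).
- exact: (tower_YD tow r_gt0 spanA spanB proj proj0 e0Xr e0XC).
Qed.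

(** Reduces to [e (Y ^+ k * T)] = 0, valid for [k] < r. Pairing [Y ^+ 0] with 1 and not with
    [Y ^+ r] in [frame] keeps the exponents in this range. *)
Let cross k (a : bool) c b : (k < r)%N -> homog c b -> e (Y ^+ k * D ^+ a * (i b * T)) = 0.
Proof.
move=> hk hb.
have -> : Y ^+ k * D ^+ a * (i b * T) = (-1) ^+ (c && a) *: (i b * (Y ^+ k * T * i (C ^+ a))).
  have -> : Y ^+ k * T * i (C ^+ a) = Y ^+ k * D ^+ a * T.
    by case: a; rewrite -?mulrA ?expr1 ?(tow_TC tow) // !expr0 (ext_1 ext) mulr1 mul1r.
  rewrite !mulrA (ext_commYX ext) -(mulrA _ (i b) (D ^+ a)) (ext_commDb ext a hb).
  rewrite -super_scalerAr -super_scalerAl scalerA -signr_addb addbb scale1r.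
  by rewrite !mulrA.
rewrite linearZ /= eMl eMr (proj_YT tow spanA proj hk).
by rewrite mul0r mulr0 scaler0.
Qed.

Lemma tower_frame_triangular : triangular e tower_frame.
Proof.
have [pwM uM hM] := triM; have [pwF uF hF] := tri_frame.
have TT := proj_TbT tow spanA spanB proj proj0.
have TE p q : e (T * i q.1 * (i p.2 * T)) = i0 (e0 (q.1 * p.2)).
  by rewrite -TT (ext_M ext) !mulrA.
split.
- rewrite pairwise_cat pwF andbT; apply/andP; split.
  + apply/allrelP => x y /mapP[p pM ->] /frameP yF /=.
    have [c hc] := hM _ pM; apply/eqP.
    case: yF => m mr; rewrite /=.
    - case: eqP => m0.
        by have := @cross 0 false _ _ r_gt0 hc; rewrite !mulr1.
      have rm : (r - m < r)%N by rewrite ltn_subrL r_gt0 andbT lt0n; apply/eqP.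
      by have := @cross _ false _ _ rm hc; rewrite mulr1.
    - exact: (@cross m true _ _ mr hc).
  + rewrite pairwise_map; apply: sub_pairwise pwM => p q /= /eqP h.
    by rewrite TE h linear0.
- move=> x; rewrite mem_cat => /orP[/mapP[p pM ->]|/uF //] /=.
  have [u uU E] := uM _ pM; exists u => //.
  by rewrite TE E linearZ /= (ext_1 ext0).
- move=> x; rewrite mem_cat => /orP[/mapP[p pM ->]|/hF //] /=.
  have [c hc] := hM _ pM; exists c.
  by have := homogM (ext_homog ext hc) (tow_homogT tow); rewrite addbF.
Qed.

Lemma tower_frame_rspan x : rspan i tower_frame x.
Proof.
elim: (spanA x) => {x} [|x y _ hx _ hy|x y _|j a h hj].
- exact: rspan0.
- exact: rspanD.
- elim: (spanM x) => {x} [|x x' _ hx _ hx'|p h pM].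
  + by rewrite linear0 !mul0r; apply: rspan0.
  + by rewrite linearD !mulrDl; apply: rspanD.
  + rewrite (ext_M ext) -(mulrA (i p.2)) (tow_commT tow) mulrA -mulrA -(ext_M ext).
    apply: (@rspanM _ _ _ _ _ (T * i p.1, i p.2 * T)).
    by rewrite mem_cat; apply/orP; left; apply/mapP; exists p.
- have [p pr <-] := @frame_mem _ _ Y D r r j a hj; apply: rspanM.
  by rewrite mem_cat pr orbT.
Qed.

End TowerFrame.

(** * The cyclotomic algebras *)

Section FreeInduction.
Import finmap monalg.

(** The predicate carries the parity, because the supercommutation rule to be propagated from the
    generators has a sign that depends on it. *)
Lemma free_ind (R : comNzRingType) (G : choiceType) (par : G -> bool)
    (P : bool -> free_alg R par -> Prop) :
  (forall p, P p 0) ->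
  (forall p a x y, P p x -> P p y -> P p (a *: x + y)) ->
  P false 1 ->
  (forall p r x y, P p x -> P r y -> P (p (+) r) (x * y)) ->
  (forall g, P (par g) (free_gen R par g)) ->
  forall p x, homog p x -> P p x.
Proof.
move=> P0 PL P1 PM Pg p x hx.
have Pw (s : seq G) : P (odd (count par s)) << FMonom s >>.
  elim: s => [|g s IH]; first by rewrite -fmoneE.
  have -> : << FMonom (g :: s) >> = free_gen R par g * << FMonom s >> :> free_alg R par.
    by rewrite [RHS]malgM_def fgmulUU mulr1; congr << _ >>; apply: val_inj; rewrite /= fmM fmU.
  by rewrite /= oddD oddb; apply: PM.
rewrite [x]monalgE big_seq; apply: (big_ind (P p)) => // [u v hu hv|w wx].
  by rewrite -[u]scale1r; apply: PL.
have -> : << x@_w *g w >> = x@_w *: << w >> + 0 :> free_alg R par.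
  by rewrite addr0; apply/malgP => k; rewrite mcoeffZ !mcoeffU mulrnAr mulr1.
apply: PL => //; have := Pw w; rewrite fmK.
by rewrite -/(wpar par w) (hx w) // mcoeff_neq0.
Qed.

Lemma free_ind_morph (R : comNzRingType) (G : choiceType) (par : G -> bool)
    (B : superAlgType R) (f : free_alg R par -> B) (P : bool -> B -> Prop) :
  linear f -> {morph f : x y / x * y} -> f 1 = 1 ->
  (forall p, P p 0) ->
  (forall p a x y, P p x -> P p y -> P p (a *: x + y)) ->
  P false 1 ->
  (forall p r x y, P p x -> P r y -> P (p (+) r) (x * y)) ->
  (forall g, P (par g) (f (free_gen R par g))) ->
  forall p x, homog p x -> P p (f x).
Proof.
move=> fL fM f1 P0 PL P1 PM Pg p x hx.
apply: (@free_ind R G par (fun p x => P p (f x))) hx.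
- have fD u v : f (u + v) = f u + f v by rewrite -[u]scale1r fL !scale1r.
  have -> // : f 0 = 0 by apply: (addrI (f 0)); rewrite -fD !addr0.
- by move=> r a u v hu hv; rewrite fL; apply: PL.
- by rewrite f1.
- by move=> r r' u v hu hv; rewrite fM; apply: PM.
- exact: Pg.
Qed.

End FreeInduction.

Section DoubleQuotient.
Variables (R : comNzRingType) (A : superAlgType R) (S : homset A) (S' : homset (squot S)).

Definition squot_pi2 (x : A) : squot S' := squot_pi S' (squot_pi S x).

Lemma squot_pi2_linear : linear squot_pi2.
Proof. by move=> a x y; rewrite /squot_pi2 !squot_pi_linear. Qed.

Lemma squot_pi2M : {morph squot_pi2 : x y / x * y}.
Proof. by move=> x y; rewrite /squot_pi2 !squot_piM. Qed.

Lemma squot_pi2_homog p (x : squot S') : homog p x -> exists2 y, homog p y & x = squot_pi2 y.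
Proof. by case=> y [w hw ->] ->; exists w. Qed.

Lemma squot_pi2_eq x y : S (x - y) -> squot_pi2 x = squot_pi2 y.
Proof. by move=> h; congr squot_pi; apply/squot_piP/in_idealS. Qed.

End DoubleQuotient.

(** Turns the inductive presentation into equations: a morphism that identifies the two sides of
    every relation makes the relations true between the images of the generators. *)
Lemma hc_rel_morph (R : comUnitRingType) (q : R) n (A B : superAlgType R) (v : letter -> A)
    (v' : letter -> B) (f : A -> B) :
  linear f -> {morph f : x y / x * y} -> f 1 = 1 -> (forall x, v' x = f (v x)) ->
  (forall l r, hc_rel q n v l r -> f l = f r) ->
  forall l r, hc_rel q n v' l r -> l = r.
Proof.
move=> fL fM f1 fv fE l r.
have fD x y : f (x + y) = f x + f y by rewrite -[x]scale1r fL !scale1r.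
have f0 : f 0 = 0 by apply: (addrI (f 0)); rewrite -fD !addr0.
have fZ a x : f (a *: x) = a *: f x by rewrite -[_ *: _]addr0 fL f0 addr0.
have fN x : f (- x) = - f x by rewrite -scaleN1r fZ scaleN1r.
case=> [j hj|j k hj hk hjk|j j0 hj|j k hj hk|j hj|j hj|j hj|j k hj hk jk|j hj|j hj
  |j k hj hk jk jk1|j hj|j hj|j k hj hk jk jk1|j hj|j k hj hk jk].
- have := fE _ _ (rel_TT q v hj); rewrite !expr2 !(fD, fN, fZ, fM, f1) -!fv; exact.
- have := fE _ _ (rel_TTC q v hj hk hjk); rewrite !(fD, fN, fZ, fM, f1) -!fv; exact.
- have := fE _ _ (rel_braid q v j0 hj); rewrite !(fD, fN, fZ, fM, f1) -!fv; exact.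
- have := fE _ _ (rel_XX q v hj hk); rewrite !(fD, fN, fZ, fM, f1) -!fv; exact.
- have := fE _ _ (rel_XXinv q v hj); rewrite !(fD, fN, fZ, fM, f1) -!fv; exact.
- have := fE _ _ (rel_XinvX q v hj); rewrite !(fD, fN, fZ, fM, f1) -!fv; exact.
- have := fE _ _ (rel_CC q v hj); rewrite !expr2 !(fD, fN, fZ, fM, f1) -!fv; exact.
- have := fE _ _ (rel_CCN q v hj hk jk); rewrite !(fD, fN, fZ, fM, f1) -!fv; exact.
- have := fE _ _ (rel_TX q v hj); rewrite !(fD, fN, fZ, fM, f1) -!fv; exact.
- have := fE _ _ (rel_TXS q v hj); rewrite !(fD, fN, fZ, fM, f1) -!fv; exact.
- have := fE _ _ (rel_TXC q v hj hk jk jk1); rewrite !(fD, fN, fZ, fM, f1) -!fv; exact.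
- have := fE _ _ (rel_TC q v hj); rewrite !(fD, fN, fZ, fM, f1) -!fv; exact.
- have := fE _ _ (rel_TCS q v hj); rewrite !(fD, fN, fZ, fM, f1) -!fv; exact.
- have := fE _ _ (rel_TCC q v hj hk jk jk1); rewrite !(fD, fN, fZ, fM, f1) -!fv; exact.
- have := fE _ _ (rel_XC q v hj); rewrite !(fD, fN, fZ, fM, f1) -!fv; exact.
- have := fE _ _ (rel_XCC q v hj hk jk); rewrite !(fD, fN, fZ, fM, f1) -!fv; exact.
Qed.

Section Cyclotomic.
Variables (R : comUnitRingType) (q : R) (ct : cyc_type) (m : nat) (Q : 'I_m -> R).
Local Notation H := (cyc_alg q ct Q).
Local Notation gen := (cyc_gen q ct Q).

HB.instance Definition _ k := GRing.isLinear.Build R (H k) (H k.+1) *:%R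
  (@cyc_map R q ct m Q k) (@cyc_map_linear R q ct m Q k).
Local Notation iota k := (@cyc_map R q ct m Q k : {linear H k -> H k.+1}).

Definition cyc_pi k : hc_free R k.+1 -> H k.+1 :=
  @squot_pi2 R _ (Homset (@hc_set_homog R q k.+1)) (Homset (@cyc_set_homog R q ct m Q k.+1)).

Lemma cyc_pi_linear k : linear (@cyc_pi k).
Proof. exact: squot_pi2_linear. Qed.

Lemma cyc_piM k : {morph @cyc_pi k : x y / x * y}.
Proof. exact: squot_pi2M. Qed.

Lemma cyc_pi1 k : @cyc_pi k 1 = 1.
Proof. by []. Qed.

Lemma cyc_pi_gen k l : gen k.+1 l = @cyc_pi k (hc_free_gen R k.+1 l).
Proof. by []. Qed.

Lemma cyc_pi_rel k l r : hc_rel q k.+1 (hc_free_gen R k.+1) l r -> @cyc_pi k l = @cyc_pi k r.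
Proof. by move=> h; apply: squot_pi2_eq; exists l, r. Qed.

Lemma cyc_ind k (P : bool -> H k -> Prop) :
  (forall p, P p 0) ->
  (forall p a x y, P p x -> P p y -> P p (a *: x + y)) ->
  P false 1 ->
  (forall p r x y, P p x -> P r y -> P (p (+) r) (x * y)) ->
  (forall l, letter_ok k l -> P (letter_odd l) (gen k l)) ->
  forall p x, homog p x -> P p x.
Proof.
case: k P => [|k] P P0 PL P1 PM Pg p x.
  case: p => hx; first by rewrite hx.
  by rewrite -[x]mulr1 -[x * 1]addr0; apply: PL.
move/squot_pi2_homog => [y hy ->].
have Pg' g : P (letter_odd (val g)) (@cyc_pi k (free_gen R _ g)).
  have := Pg (val g) (valP g).
  by rewrite cyc_pi_gen hc_free_gen_val.
exact: (free_ind_morph (@cyc_pi_linear k) (@cyc_piM k) (cyc_pi1 k) P0 PL P1 PM Pg' hy).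
Qed.

Lemma cyc_homog_gen k l : homog (letter_odd l) (gen k l).
Proof.
case: k => [|k]; first exact: homog0.
exists (hc_gen q k.+1 l) => //; exact: hc_gen_homog.
Qed.

Lemma cyc_rel k l r : hc_rel q k.+1 (gen k.+1) l r -> l = r.
Proof.
exact: (hc_rel_morph (@cyc_pi_linear k) (@cyc_piM k) (cyc_pi1 k) (@cyc_pi_gen k) (@cyc_pi_rel k)).
Qed.

End Cyclotomic.

Lemma comm_inv (R : pzRingType) (x y y' : R) : y * y' = 1 -> y' * y = 1 ->
  x * y = y * x -> x * y' = y' * x.
Proof.
move=> yy' y'y c; rewrite -[x * y']mul1r -y'y -mulrA (mulrA y) -c.
by rewrite -mulrA yy' mulr1.
Qed.

Section Generated.
Variables (R : comUnitRingType) (A B : superAlgType R) (f : B -> A).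

(** Impredicative form of generation by the [g l], graded by parity. It also fits H_0 = R, where no
    letter is admissible. *)
Definition generated (L : Type) (ok odd : pred L) (g : L -> B) : Prop :=
  forall P : bool -> B -> Prop,
  (forall p, P p 0) ->
  (forall p a x y, P p x -> P p y -> P p (a *: x + y)) ->
  P false 1 ->
  (forall p r x y, P p x -> P r y -> P (p (+) r) (x * y)) ->
  (forall l, ok l -> P (odd l) (g l)) ->
  forall p x, homog p x -> P p x.

Variables (L : Type) (ok odd : pred L) (g : L -> B) (g' : L -> A).
Hypothesis gen : generated ok odd g.
Hypotheses (fL : linear f) (fM : {morph f : x y / x * y}) (f1 : f 1 = 1).
Hypothesis fg : forall l, ok l -> f (g l) = g' l.

Let fD x y : f (x + y) = f x + f y.
Proof. by rewrite -[x]scale1r fL !scale1r. Qed.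

Let f0 : f 0 = 0.
Proof. by apply: (addrI (f 0)); rewrite -fD !addr0. Qed.

Lemma generated_homog p x : (forall l, ok l -> homog (odd l) (g' l)) ->
  homog p x -> homog p (f x).
Proof.
move=> hg; apply: (gen (P := fun p x => homog p (f x))) => {p x}.
- by move=> p; rewrite f0; apply: homog0.
- by move=> p a x y hx hy; rewrite fL; apply: homogP.
- by rewrite f1; apply: homog1.
- by move=> p r x y hx hy; rewrite fM; apply: homogM.
- by move=> l hl; rewrite fg //; apply: hg.
Qed.

Lemma generated_supercomm D p x :
  (forall l, ok l -> g' l * D = (-1) ^+ odd l *: (D * g' l)) ->
  homog p x -> f x * D = (-1) ^+ p *: (D * f x).
Proof.
move=> hg; apply: (gen (P := fun p x => f x * D = (-1) ^+ p *: (D * f x))) => {p x}.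
- by move=> p; rewrite f0 mul0r mulr0 scaler0.
- move=> p a x y hx hy; rewrite fL mulrDl mulrDr scalerDr hy; congr (_ + _).
  by rewrite -super_scalerAl hx -super_scalerAr !scalerA mulrC.
- by rewrite f1 mul1r mulr1 scale1r.
- move=> p r x y hx hy; rewrite fM -mulrA hy -super_scalerAr mulrA.
  by rewrite hx -super_scalerAl scalerA mulrC -signr_addb !mulrA.
- by move=> l hl; rewrite fg // hg.
Qed.

Lemma generated_comm Y x : (forall l, ok l -> g' l * Y = Y * g' l) -> f x * Y = Y * f x.
Proof.
move=> hg; have [x0 [x1 [h0 h1 ->]]] := homog_split x.
suff E p y : homog p y -> f y * Y = Y * f y.
  by rewrite fD mulrDl mulrDr (E _ _ h0) (E _ _ h1).
apply: (gen (P := fun p y => f y * Y = Y * f y)) => {p y x x0 x1 h0 h1}.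
- by move=> p; rewrite f0 mul0r mulr0.
- move=> p a x y hx hy; rewrite fL mulrDl mulrDr hy; congr (_ + _).
  by rewrite -super_scalerAl hx super_scalerAr.
- by rewrite f1 mul1r mulr1.
- by move=> p r x y hx hy; rewrite fM -mulrA hy !mulrA hx.
- by move=> l hl; rewrite fg // hg.
Qed.

End Generated.

(** * Relations between neighbouring levels, from the presentation *)

Section Relations.
Variables (R : comUnitRingType) (q : R) (ct : cyc_type) (m : nat) (Q : 'I_m -> R).
Local Notation H := (cyc_alg q ct Q).
Local Notation gen := (cyc_gen q ct Q).
Local Notation iota k := (@cyc_map R q ct m Q k : {linear H k -> H k.+1}).

Lemma cyc_XX' k j : (0 < j <= k.+1)%N -> gen k.+1 (LX j) * gen k.+1 (LXinv j) = 1.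
Proof. by move=> hj; apply: cyc_rel (rel_XXinv q _ hj). Qed.

Lemma cyc_X'X k j : (0 < j <= k.+1)%N -> gen k.+1 (LXinv j) * gen k.+1 (LX j) = 1.
Proof. by move=> hj; apply: cyc_rel (rel_XinvX q _ hj). Qed.

Lemma cyc_commX k l : letter_ok k l ->
  gen k.+1 l * gen k.+1 (LX k.+1) = gen k.+1 (LX k.+1) * gen k.+1 l.
Proof.
have k1 : (0 < k.+1 <= k.+1)%N by rewrite leqnn.
have W j : (0 < j <= k)%N -> (0 < j <= k.+1)%N by case/andP=> -> /leqW.
have N j : (0 < j <= k)%N -> j != k.+1 by case/andP=> _ h; rewrite neq_ltn ltnS h.
have cX j : (0 < j <= k)%N ->
    gen k.+1 (LX j) * gen k.+1 (LX k.+1) = gen k.+1 (LX k.+1) * gen k.+1 (LX j).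
  by move=> /W hj; apply: cyc_rel (rel_XX q _ hj k1).
case: l => j /= hj.
- have hj' : (0 < j < k.+1)%N by case/andP: hj => -> /ltnW.
  apply: cyc_rel (rel_TXC q _ hj' k1 _ _).
    by case/andP: hj' => _ h; rewrite gtn_eqF.
  by case/andP: hj => _ h; rewrite eqSS gtn_eqF.
- exact: cX.
- by symmetry; apply: comm_inv (cyc_XX' (W _ hj)) (cyc_X'X (W _ hj)) _; rewrite cX.
- symmetry; apply: cyc_rel (rel_XCC q _ k1 (W _ hj) _).
  by rewrite eq_sym N.
Qed.

Lemma cyc_commC k l : letter_ok k l -> gen k.+1 l * gen k.+1 (LC k.+1)
  = (-1) ^+ letter_odd l *: (gen k.+1 (LC k.+1) * gen k.+1 l).
Proof.
have k1 : (0 < k.+1 <= k.+1)%N by rewrite leqnn.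
have W j : (0 < j <= k)%N -> (0 < j <= k.+1)%N by case/andP=> -> /leqW.
have N j : (0 < j <= k)%N -> j != k.+1 by case/andP=> _ h; rewrite neq_ltn ltnS h.
have cX j : (0 < j <= k)%N ->
    gen k.+1 (LX j) * gen k.+1 (LC k.+1) = gen k.+1 (LC k.+1) * gen k.+1 (LX j).
  by move=> hj; apply: cyc_rel (rel_XCC q _ (W _ hj) k1 (N _ hj)).
case: l => j hj; rewrite ?expr0 ?expr1 ?scale1r ?scaleN1r /= in hj *.
- have hj' : (0 < j < k.+1)%N by case/andP: hj => -> /ltnW.
  apply: cyc_rel (rel_TCC q _ hj' k1 _ _).
    by case/andP: hj' => _ h; rewrite gtn_eqF.
  by case/andP: hj => _ h; rewrite eqSS gtn_eqF.
- exact: cX.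
- by symmetry; apply: comm_inv (cyc_XX' (W _ hj)) (cyc_X'X (W _ hj)) _; rewrite cX.
- by apply: cyc_rel (rel_CCN q _ (W _ hj) k1 (N _ hj)).
Qed.

Lemma cyc_commT k l : letter_ok k l ->
  gen k.+2 l * gen k.+2 (LT k.+1) = gen k.+2 (LT k.+1) * gen k.+2 l.
Proof.
have k1 : (0 < k.+1 < k.+2)%N by rewrite ltnS leqnn.
have W j : (0 < j <= k)%N -> (0 < j <= k.+2)%N by case/andP=> -> h; apply/leqW/leqW.
have N j : (0 < j <= k)%N -> j != k.+1 by case/andP=> _ h; rewrite neq_ltn ltnS h.
have N' j : (0 < j <= k)%N -> j != k.+2 by case/andP=> _ h; rewrite neq_ltn ltnS (leqW h).
have cX j : (0 < j <= k)%N ->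
    gen k.+2 (LT k.+1) * gen k.+2 (LX j) = gen k.+2 (LX j) * gen k.+2 (LT k.+1).
  by move=> hj; apply: cyc_rel (rel_TXC q _ k1 (W _ hj) (N _ hj) (N' _ hj)).
case: l => j /= hj.
- have hj' : (0 < j < k.+2)%N by case/andP: hj => -> h; apply/leqW/leqW.
  by apply: cyc_rel (rel_TTC q _ hj' k1 _); case/andP: hj => _ h; rewrite ltnS h.
- by rewrite cX.
- by symmetry; apply: comm_inv (cyc_XX' (W _ hj)) (cyc_X'X (W _ hj)) _; rewrite cX.
- by symmetry; apply: cyc_rel (rel_TCC q _ k1 (W _ hj) (N _ hj) (N' _ hj)).
Qed.

Lemma cyc_generated k : generated (letter_ok k) letter_odd (gen k).
Proof. exact: cyc_ind. Qed.

Lemma cyc_map_homog k p x : homog p x -> homog p (iota k x).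
Proof.
exact: (generated_homog (@cyc_generated k) (@cyc_map_linear _ _ _ _ _ k)
  (@cyc_mapM _ _ _ _ _ k) (@cyc_map1 _ _ _ _ _ k) (@cyc_map_gen _ _ _ _ _ k)
  (fun l _ => @cyc_homog_gen _ _ _ _ _ k.+1 l)).
Qed.

Lemma cyc_map_commX k x :
  iota k x * gen k.+1 (LX k.+1) = gen k.+1 (LX k.+1) * iota k x.
Proof.
exact: (generated_comm (@cyc_generated k) (@cyc_map_linear _ _ _ _ _ k)
  (@cyc_mapM _ _ _ _ _ k) (@cyc_map1 _ _ _ _ _ k) (@cyc_map_gen _ _ _ _ _ k)
  x (@cyc_commX k)).
Qed.

Lemma cyc_map_commC k p x : homog p x -> iota k x * gen k.+1 (LC k.+1)
  = (-1) ^+ p *: (gen k.+1 (LC k.+1) * iota k x).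
Proof.
exact: (generated_supercomm (@cyc_generated k) (@cyc_map_linear _ _ _ _ _ k)
  (@cyc_mapM _ _ _ _ _ k) (@cyc_map1 _ _ _ _ _ k) (@cyc_map_gen _ _ _ _ _ k)
  (@cyc_commC k)).
Qed.

Lemma cyc_map2_linear k : linear (fun x => iota k.+1 (iota k x)).
Proof.
by move=> a x y; exact: (etrans (congr1 (iota k.+1) (cyc_map_linear a x y)) (cyc_map_linear a _ _)).
Qed.

Lemma cyc_map2M k : {morph (fun x => iota k.+1 (iota k x)) : x y / x * y}.
Proof. by move=> x y; exact: (etrans (congr1 (iota k.+1) (cyc_mapM x y)) (cyc_mapM _ _)). Qed.

Lemma cyc_map21 k : iota k.+1 (iota k 1) = 1.
Proof. exact: (etrans (congr1 (iota k.+1) (cyc_map1 q ct Q k)) (cyc_map1 q ct Q k.+1)). Qed.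

Lemma cyc_map2_gen k l : letter_ok k l -> iota k.+1 (iota k (gen k l)) = gen k.+2 l.
Proof.
move=> hl; exact: (etrans (congr1 (iota k.+1) (cyc_map_gen q ct Q hl))
  (cyc_map_gen q ct Q (letter_okS hl))).
Qed.

Lemma cyc_map_commT k x :
  iota k.+1 (iota k x) * gen k.+2 (LT k.+1) = gen k.+2 (LT k.+1) * iota k.+1 (iota k x).
Proof.
exact: (generated_comm (@cyc_generated k) (@cyc_map2_linear k)
  (@cyc_map2M k) (@cyc_map21 k) (@cyc_map2_gen k) x (@cyc_commT k)).
Qed.

Lemma cyc_extension k : extension (iota k) (gen k.+1 (LX k.+1)) (gen k.+1 (LXinv k.+1))
  (gen k.+1 (LC k.+1)).
Proof.
have k1 : (0 < k.+1 <= k.+1)%N by rewrite leqnn.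
split.
- exact: cyc_mapM.
- exact: cyc_map1.
- exact: cyc_map_homog.
- exact: cyc_XX'.
- exact: cyc_X'X.
- by rewrite -expr2; apply: cyc_rel (rel_CC q _ k1).
- exact: cyc_rel (rel_XC q _ k1).
- exact: (cyc_homog_gen q ct Q k.+1 (LX k.+1)).
- exact: (cyc_homog_gen q ct Q k.+1 (LC k.+1)).
- exact: cyc_map_commX.
- exact: cyc_map_commC.
Qed.

Lemma cyc_tower k : tower (iota k.+1) (iota k)
  (gen k.+2 (LX k.+2)) (gen k.+2 (LXinv k.+2)) (gen k.+2 (LC k.+2)) (gen k.+2 (LT k.+1))
  (gen k.+1 (LX k.+1)) (gen k.+1 (LXinv k.+1)) (gen k.+1 (LC k.+1))
  (0 < k)%N (gen k.+1 (LT k)) (hc_eps q).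
Proof.
have k1 : (0 < k.+1 < k.+2)%N by rewrite ltnS leqnn.
have iX : iota k.+1 (gen k.+1 (LX k.+1)) = gen k.+2 (LX k.+1).
  by apply: cyc_map_gen; rewrite /= leqnn.
have iC : iota k.+1 (gen k.+1 (LC k.+1)) = gen k.+2 (LC k.+1).
  by apply: cyc_map_gen; rewrite /= leqnn.
split.
- exact: cyc_extension.
- exact: cyc_extension.
- exact: (cyc_homog_gen q ct Q k.+2 (LT k.+1)).
- exact: (cyc_homog_gen q ct Q k.+1 (LT k)).
- by rewrite -expr2; apply: cyc_rel (rel_TT q _ k1).
- by rewrite iX iC [X in _ = X + _](cyc_rel (rel_TX q _ k1)) subrK.
- rewrite iX iC [LHS](cyc_rel (rel_TXS q _ k1)) mulrBl mul1r; congr (_ + _).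
- by rewrite iC; apply: cyc_rel (rel_TC q _ k1).
- by rewrite iC; apply: cyc_rel (rel_TCS q _ k1).
- exact: cyc_map_commT.
- move=> k0; have -> : iota k.+1 (gen k.+1 (LT k)) = gen k.+2 (LT k).
    by apply: cyc_map_gen; rewrite /= k0 ltnSn.
  by symmetry; apply: cyc_rel (rel_braid q _ k0 _).
Qed.

End Relations.

Lemma linear_bundle (R : comUnitRingType) (A B : superAlgType R) (f : A -> B) :
  linear f -> exists g : {linear A -> B}, (g : A -> B) = f.
Proof.
move=> fL; pose L := GRing.isLinear.Build R A B *:%R f fL.
pose g : {linear A -> B} := HB.pack f L.
by exists g.
Qed.

(** * The first level, where X_1 satisfies a monic polynomial *)

Section BaseLevel.
Variables (R : comUnitRingType) (A B : superAlgType R) (i : {linear B -> A}).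
Variables (Y Y' D T : A) (r : nat) (s : R) (c : nat -> R).
Hypothesis ext : extension i Y Y' D.
Hypothesis r_gt0 : (0 < r)%N.
Hypothesis ss : s * s = 1.
Hypothesis Y_rel : Y ^+ r = s *: (1 : A) - \sum_(1 <= j < r) c j *: Y ^+ j.
Notation span := (mspan i Y D false T r).

Let sZ := @mspanZ _ _ _ i Y D false T r.
Let sB := @mspanB _ _ _ i Y D false T r.
Let sr x h := @mspan_mulr _ _ _ i Y Y' D false T r ext x h.
Let sl x h := @mspan_mull _ _ _ i Y Y' D false T r ext x h.

Let s_YD j (a : bool) : (j < r)%N -> span (Y ^+ j * D ^+ a).
Proof.
move=> hj; have := @mspanX _ _ _ i Y D false T r j a 1 hj.
by rewrite (ext_1 ext) mulr1.
Qed.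

Let s_sum (I : eqType) (l : seq I) (F : I -> A) :
  (forall k, k \in l -> span (F k)) -> span (\sum_(k <- l) F k).
Proof.
by move=> h; rewrite big_seq; apply: (big_ind span) => //; [constructor|constructor].
Qed.

Let s_Yr (a : bool) : span (Y ^+ r * D ^+ a).
Proof.
rewrite Y_rel mulrBl -super_scalerAl mul1r mulr_suml; apply: sB.
  by apply: sZ; have := @s_YD 0 a r_gt0; rewrite mul1r.
apply: s_sum => j; rewrite mem_index_iota => /andP[_ hj].
by rewrite -super_scalerAl; apply/sZ/s_YD.
Qed.

Let s_mulY x : span x -> span (Y * x).
Proof.
elim=> {x} [|x y _ hx _ hy|//|j a h hj].
- by rewrite mulr0; constructor.
- by rewrite mulrDr; constructor.
- rewrite !mulrA -exprS; apply: sr; move: hj; rewrite leq_eqVlt.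
  by case/orP=> [/eqP -> //|]; apply: s_YD.
Qed.

Let s_Y'D (a : bool) : span (Y' * D ^+ a).
Proof.
(* [Y_rel] times [Y'], solved by means of [s * s = 1]: since the constant term is a unit, the
   inverse of [Y] is a polynomial of degree r - 1 in [Y]. *)
have -> : Y' = s *: (Y ^+ r.-1 + \sum_(1 <= j < r) c j *: Y ^+ j.-1).
  have E : Y' * Y ^+ r + Y' * (\sum_(1 <= j < r) c j *: Y ^+ j) = s *: Y'.
    by rewrite -mulrDr Y_rel subrK -super_scalerAr mulr1.
  have Y'Yj j : (0 < j)%N -> Y' * Y ^+ j = Y ^+ j.-1.
    by case: j => // j _; rewrite exprS mulrA (ext_Y'Y ext) mul1r.
  rewrite -[LHS]scale1r -ss -scalerA -E Y'Yj // mulr_sumr big_nat [in RHS]big_nat.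
  congr (_ *: (_ + _)); apply: eq_bigr => j /andP[j0 _].
  by rewrite -super_scalerAr Y'Yj.
rewrite -super_scalerAl mulrDl mulr_suml; apply/sZ/mspanD.
  by apply: s_YD; rewrite prednK.
apply: s_sum => j; rewrite mem_index_iota => /andP[j0 hj].
by rewrite -super_scalerAl; apply/sZ/s_YD; rewrite (leq_ltn_trans (leq_pred _) hj).
Qed.

Let s_mulY' x : span x -> span (Y' * x).
Proof.
elim=> {x} [|x y _ hx _ hy|//|[|j] a h hj].
- by rewrite mulr0; constructor.
- by rewrite mulrDr; constructor.
- by rewrite mul1r mulrA; apply/sr/s_Y'D.
- by rewrite !mulrA exprS mulrA (ext_Y'Y ext) mul1r; apply/sr/s_YD/ltnW.
Qed.

Let s_mulD x : span x -> span (D * x).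
Proof.
elim=> {x} [|x y _ hx _ hy|//|j a h hj].
- by rewrite mulr0; constructor.
- by rewrite mulrDr; constructor.
- rewrite !mulrA (ext_DYX ext); apply: sr; rewrite -mulrA.
  have hD : span (D * D ^+ a).
    case: a; first by have := s_YD false r_gt0; rewrite expr1 (ext_DD ext) !mulr1.
    by have := s_YD true r_gt0; rewrite mulr1 mul1r.
  by elim: j {hj} => [|j IH]; rewrite ?mul1r // exprS -mulrA; apply: s_mulY'.
Qed.

Lemma base_span_closed x : span x ->
  [/\ span (Y * x), span (Y' * x), span (D * x) & forall h, span (i h * x)].
Proof. by move=> hx; split; [exact: s_mulY|exact: s_mulY'|exact: s_mulD|move=> h; apply: sl]. Qed.

Variable e : {linear A -> B}.
Hypothesis proj : projection i Y D false T r e.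

Lemma base_Yr : e (Y ^+ r) = s *: (1 : B).
Proof.
have E j : (j < r)%N -> e (Y ^+ j) = (j == 0)%:R.
  by move=> hj; have := projYD ext proj false hj; rewrite mulr1 andbT.
have e1 : e 1 = 1 by have := E _ r_gt0; rewrite expr0.
rewrite Y_rel linearB linearZ linear_sum /= e1 big_nat big1 ?subr0 // => j /andP[j0 hj].
by rewrite linearZ /= E // eqn0Ngt j0 scaler0.
Qed.

(** From exponent r on, [Y_rel] rewrites [Y ^+ j * D] as a combination of lower powers of [Y] times
    [D]. *)
Lemma base_YD j : e (Y ^+ j * D) = 0.
Proof.
elim/ltn_ind: j => j IH; have [hj|hj] := ltnP j r.
  by have := projYD ext proj true hj; rewrite andbF.
rewrite -(subnK hj) exprD Y_rel mulrBr mulrBl linearB /= -super_scalerAr mulr1.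
rewrite -super_scalerAl linearZ /= IH ?ltn_subrL ?r_gt0 ?(leq_trans r_gt0) //.
rewrite scaler0 sub0r mulr_sumr mulr_suml linear_sum big_nat big1 ?oppr0 // => k /andP[_ kr].
rewrite -super_scalerAr -super_scalerAl linearZ /= -exprD IH ?scaler0 //.
by rewrite -[X in (_ < X)%N](subnK hj) ltn_add2l.
Qed.

End BaseLevel.

(** * The cyclotomic polynomial as a monic relation *)

Section Coefficients.
Variables (R : comUnitRingType) (A : superAlgType R) (X X' : A).
Hypotheses (XX' : X * X' = 1) (X'X : X' * X = 1).

Let ev N (c : nat -> R) : A := \sum_(j < N) c j *: X ^+ j.
Let shift (c : nat -> R) j := if j is k.+1 then c k else 0.

Let ev_shift N c : ev N.+1 (shift c) = ev N c * X.
Proof.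
rewrite /ev big_ord_recl scale0r add0r mulr_suml; apply: eq_bigr => j _.
by rewrite -super_scalerAl -exprSr.
Qed.

Let evD N c c' a : ev N (fun j => a * c j + c' j) = a *: ev N c + ev N c'.
Proof.
rewrite /ev scaler_sumr -big_split; apply: eq_bigr => j _.
by rewrite scalerDl scalerA.
Qed.

Let ev_recr N c : c N = 0 -> ev N.+1 c = ev N c.
Proof. by move=> h; rewrite /ev big_ord_recr /= h scale0r addr0. Qed.

(** [x] is a monic polynomial of degree [d] in [X] with constant term [a]. Coefficients are
    functions on all of [nat], so that [shift] expresses multiplication by [X] independently of the
    degree. *)
Let monic d a x := exists c : nat -> R,
  [/\ forall j, (d < j)%N -> c j = 0, c d = 1, c 0 = a & x = ev d.+1 c].

Let monic_quadratic d a b x : monic d a x ->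
  monic d.+2 a (x * (X * X - b *: X + 1)).
Proof.
case=> c [c0 cd ca ->].
exists (fun j => 1 * shift (shift c) j + ((- b) * shift c j + c j)); split.
- move=> [|[|j]] //=; rewrite !ltnS => hj.
  by rewrite (c0 _ hj) (c0 _ (leqW hj)) (c0 _ (leqW (leqW hj))) !mulr0 !addr0.
- by rewrite /shift /= cd (c0 _ (ltnSn d)) (c0 _ (leqW (ltnSn d))) mulr0 !addr0 mulr1.
- by rewrite /shift /= !mulr0 !add0r.
- rewrite !evD !ev_shift scale1r scaleNr (ev_recr (c0 _ (leqW (ltnSn d))))
    (ev_recr (c0 _ (ltnSn d))).
  by rewrite !mulrDr mulr1 mulrN -super_scalerAr mulrA addrA.
Qed.

Let monic_linear d a x : monic d a x -> monic d.+1 (- a) (x * X - x).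
Proof.
case=> c [c0 cd ca ->]; exists (fun j => (- 1) * c j + shift c j); split.
- by move=> [|j] //=; rewrite ltnS => hj; rewrite !c0 ?mulr0 ?addr0 // leqW.
- by rewrite /shift /= cd c0 // mulr0 add0r.
- by rewrite /shift /= ca addr0 mulN1r.
- by rewrite evD ev_shift scaleN1r (ev_recr (c0 _ (ltnSn d))) addrC.
Qed.

Let monic_prod m (a : 'I_m -> R) :
  monic m.*2 1 ((\prod_(j < m) (X + X' - a j *: (1 : A))) * X ^+ m).
Proof.
elim: m a => [|m IH] a.
  exists (fun j => (j == 0)%:R); split=> //; first by case.
  by rewrite big_ord0 mul1r /ev big_ord1 scale1r.
have := monic_quadratic (a ord_max) (IH (fun j => a (widen_ord (leqnSn m) j))).
rewrite big_ord_recr /= doubleS; congr (monic _ _ _).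
set P := \prod_(j < m) _; set u := X + X' - _.
have cu : GRing.comm u (X ^+ m).
  apply: commrX; rewrite /GRing.comm /u !(mulrDl, mulrDr, mulNr, mulrN).
  by rewrite XX' X'X -super_scalerAl -super_scalerAr mul1r mulr1.
rewrite exprSr -!mulrA; congr (P * _); rewrite !mulrA cu -!mulrA; congr (_ * _).
by rewrite /u mulrBl mulrDl X'X -super_scalerAl mul1r addrAC.
Qed.

Lemma cyclotomic_coef m (a : 'I_m -> R) (lin : bool) : (0 < lin + m.*2)%N ->
  (if lin then X - 1 else 1) * (\prod_(j < m) (X + X' - a j *: (1 : A))) = 0 ->
  exists c : nat -> R, X ^+ (lin + m.*2) =
    (if lin then 1 else - 1) *: (1 : A)
    - \sum_(1 <= j < lin + m.*2) c j *: X ^+ j.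
Proof.
move=> d0; set P := \prod_(j < m) _ => P0.
have [c [_ cd c0 cE]] : monic (lin + m.*2) (if lin then - 1 else 1) 0.
  have := monic_prod a; case: lin P0 {d0} => P0 /=; last first.
    by rewrite -/P -[P]mul1r P0 mul0r.
  move/monic_linear; congr (monic _ _ _); rewrite -/P.
  have cP : GRing.comm X P.
    apply: commr_prod => j _; rewrite /GRing.comm !(mulrDl, mulrDr, mulNr, mulrN).
    by rewrite XX' X'X -super_scalerAl -super_scalerAr mul1r mulr1.
  rewrite -mulrA -exprSr exprS mulrA -cP.
  by rewrite -[X in _ - X]mul1r -mulrA -mulrBl mulrA P0 mul0r.
exists c; move: cE; rewrite /ev big_ord_recr /= cd scale1r
  -(big_mkord xpredT (fun j => c j *: X ^+ j)).
rewrite big_ltn // c0 addrC addrA => /esym/(canRL (addrK _)).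
rewrite sub0r => /(canRL (addrK _)) ->.
by rewrite addrC; case: (lin); rewrite ?scaleN1r ?scale1r ?opprK.
Qed.

End Coefficients.

Lemma generated_span (R : comUnitRingType) (A : superAlgType R) (L : Type)
    (ok odd : pred L) (g : L -> A) (S : A -> Prop) :
  generated ok odd g ->
  S 0 -> (forall x y, S x -> S y -> S (x + y)) -> (forall a x, S x -> S (a *: x)) ->
  S 1 -> (forall l x, ok l -> S x -> S (g l * x)) -> forall x, S x.
Proof.
move=> gen S0 SD SZ S1 Sg x.
suff E p y : homog p y -> forall w, S w -> S (y * w).
  have [x0 [x1 [h0 h1 ->]]] := homog_split x.
  by rewrite -[x0 + x1]mulr1 mulrDl; apply: SD; [apply: E h0 _ _|apply: E h1 _ _].
apply: (gen (fun p y => forall w, S w -> S (y * w))) => {p y x}.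
- by move=> p w _; rewrite mul0r.
- move=> p a x y hx hy w hw; rewrite mulrDl -super_scalerAl.
  by apply: SD; [apply/SZ/hx|apply: hy].
- by move=> w hw; rewrite mul1r.
- by move=> p r x y hx hy w hw; rewrite -mulrA; apply/hx/hy.
- by move=> l hl w; apply: Sg.
Qed.

Lemma cyc_poly_morph (R : comUnitRingType) (q : R) ct m (Q : 'I_m -> R) n
    (B : superAlgType R) (f : hc_alg q n -> B) :
  linear f -> {morph f : x y / x * y} -> f 1 = 1 ->
  f (cyc_poly q ct Q n) =
  (if ct is cyc_s then f (hc_gen q n (LX 1)) - 1 else 1) *
  \prod_(i < m) (f (hc_gen q n (LX 1)) + f (hc_gen q n (LXinv 1)) - qfun q (Q i) *: (1 : B)).
Proof.
move=> fL fM f1; rewrite /cyc_poly.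
have fD x y : f (x + y) = f x + f y by rewrite -[x]scale1r fL !scale1r.
have f0 : f 0 = 0 by apply: (addrI (f 0)); rewrite -fD !addr0.
have fZ a x : f (a *: x) = a *: f x by rewrite -[_ *: _]addr0 fL f0 addr0.
have fN x : f (- x) = - f x by rewrite -scaleN1r fZ scaleN1r.
rewrite fM (big_morph f fM f1); congr (_ * _).
  by case: ct; rewrite ?fD ?fN f1.
by apply: eq_bigr => j _; rewrite !fD fN fZ f1.
Qed.

(** * Spanning by the Mackey sum at every level *)

Section Levels.
Variables (R : comUnitRingType) (q : R) (ct : cyc_type) (m : nat) (Q : 'I_m -> R).
Local Notation H := (cyc_alg q ct Q).
Local Notation gen := (cyc_gen q ct Q).
Local Notation iota k := (@cyc_map R q ct m Q k : {linear H k -> H k.+1}).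
Local Notation r := (cyc_deg ct m).

Definition cyc_super : bool := if ct is cyc_0 then true else false.
Definition cyc_sign : R := if cyc_super then - 1 else 1.

Lemma cyc_sign2 : cyc_sign * cyc_sign = 1.
Proof. by rewrite /cyc_sign; case: cyc_super; rewrite ?mulrNN mulr1. Qed.

Lemma cyc_poly0 k :
  (if ct is cyc_s then gen k.+1 (LX 1) - 1 else 1) *
  \prod_(i < m) (gen k.+1 (LX 1) + gen k.+1 (LXinv 1) - qfun q (Q i) *: (1 : H k.+1)) = 0.
Proof.
pose S := Homset (@cyc_set_homog R q ct m Q k.+1).
have <- := @cyc_poly_morph R q ct m Q k.+1 _ (squot_pi S) (@squot_pi_linear _ _ S)
  (@squot_piM _ _ S) erefl.
exact: squot_piS.
Qed.

Lemma cyc_X1_rel : (0 < r)%N -> exists c : nat -> R,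
  gen 1 (LX 1) ^+ r = cyc_sign *: (1 : H 1) - \sum_(1 <= j < r) c j *: gen 1 (LX 1) ^+ j.
Proof.
move=> r_gt0; have X1 : (0 < 1 <= 1)%N by [].
have := @cyclotomic_coef R (H 1) _ _ (cyc_XX' q ct Q X1) (cyc_X'X q ct Q X1) m
  (fun i => qfun q (Q i)) (~~ cyc_super).
have := @cyc_poly0 0; rewrite /cyc_sign /cyc_super; move: r_gt0; case: ct => r_gt0 /= E.
  by move=> h; have [c hc] := h r_gt0 E; exists c.
by move=> h; have [c hc] := h r_gt0 E; exists c.
Qed.

Hypothesis r_gt0 : (0 < r)%N.

(** A subspace containing 1 and stable under left multiplication by the generators is everything.
    Letters already admissible one level below act through the image of that level. *)
Lemma cyc_span k x : mspan (iota k) (gen k.+1 (LX k.+1)) (gen k.+1 (LC k.+1))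
  (0 < k)%N (gen k.+1 (LT k)) r x.
Proof.
elim: k x => [|k IH].
  have [c hc] := cyc_X1_rel r_gt0.
  have ext := cyc_extension q ct Q 0.
  have cl := base_span_closed ext r_gt0 cyc_sign2 hc.
  apply: (generated_span (@cyc_generated R q ct m Q 1)).
  - exact: mspan0.
  - exact: mspanD.
  - exact: mspanZ.
  - have := @mspan_i _ _ _ (iota 0) _ _ false (gen 1 (LT 0)) r r_gt0 1.
    by rewrite (ext_1 ext).
  - move=> l y hl hy; have [cX cX' cD _] := cl _ y hy.
    have E j : (0 < j <= 1)%N -> j = 1%N by case: j => [|[]].
    have N j : ~~ (0 < j < 1)%N by case: j => [|[]].
    case: l hl => j hj.
    + by exfalso; apply: negP (N j) hj.
    + by rewrite (E j hj); exact: cX.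
    + by rewrite (E j hj); exact: cX'.
    + by rewrite (E j hj); exact: cD.
have tow := cyc_tower q ct Q k; have ext := tow_ext tow.
have cl := tow_span_closed tow r_gt0 IH.
apply: (generated_span (@cyc_generated R q ct m Q k.+2)).
- exact: mspan0.
- exact: mspanD.
- exact: mspanZ.
- have := @mspan_i _ _ _ (iota k.+1) _ _ true (gen k.+2 (LT k.+1)) r r_gt0 1.
  by rewrite (ext_1 ext).
- move=> l y hl hy; have [cT cX cX' cD ci] := cl y hy.
  have [hl'|hl'] := boolP (letter_ok k.+1 l).
    by rewrite -(cyc_map_gen q ct Q hl'); exact: ci.
  have E j : (0 < j <= k.+2)%N -> ~~ (0 < j <= k.+1)%N -> j = k.+2.
    case/andP=> -> h1; rewrite /= -ltnNge => h2.
    by apply/eqP; rewrite eqn_leq h1 h2.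
  case: l hl hl' => j hj hj'.
  + have -> : j = k.+1.
      apply/eqP; rewrite eqn_leq -ltnS; case/andP: hj => j0 -> /=.
      by move: hj'; rewrite /= j0 /= -leqNgt.
    exact: cT.
  + by rewrite (E j hj hj'); exact: cX.
  + by rewrite (E j hj hj'); exact: cX'.
  + by rewrite (E j hj hj'); exact: cD.
Qed.

End Levels.

(** The invariant of the induction on the level: [frob_Yr] and [frob_YD] feed the next level,
    [frob_commY] and [frob_dual] feed the trace property. *)
Record frobenius_projection (R : comUnitRingType) (A B : superAlgType R) (i : {linear B -> A})
    (Y D : A) (hasT : bool) (T : A) (r : nat) (s : R) (e : {linear A -> B}) : Prop :=
  FrobeniusProjection {
  frob_span : forall x, mspan i Y D hasT T r x;
  frob_proj : projection i Y D hasT T r e;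
  frob_Yr : e (Y ^+ r) = s *: (1 : B);
  frob_YD : forall j, e (Y ^+ j * D) = 0;
  frob_commY : forall x, e (Y * x) = e (x * Y);
  frob_dual : forall p x, homog p x -> e (Y ^+ r * D * x * D) = (s * (-1) ^+ p) *: e x
}.

Lemma base_frobenius (R : comUnitRingType) (A B : superAlgType R) (i : {linear B -> A})
    (Y Y' D T : A) (r : nat) (s : R) (c : nat -> R) (e : {linear A -> B}) :
  extension i Y Y' D -> homog false T -> (0 < r)%N ->
  Y ^+ r = s *: (1 : A) - \sum_(1 <= j < r) c j *: Y ^+ j ->
  (forall x, mspan i Y D false T r x) ->
  projection i Y D false T r e -> frobenius_projection i Y D false T r s e.
Proof.
move=> ext hT r0 rel span proj.
have eYD := base_YD ext r0 rel proj; have eYr := base_Yr ext r0 rel proj.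
split=> //.
- exact: (proj_commY ext proj span (eYD r) (eYD r.+1)).
- exact: (proj_duality ext hT proj span r0 eYr (eYD r) (eYD r.+1)).
Qed.

Lemma tower_frobenius (R : comUnitRingType) (A B B0 : superAlgType R)
    (i : {linear B -> A}) (i0 : {linear B0 -> B})
    (Y Y' D T : A) (X X' C : B) (hasT0 : bool) (T0 : B) (eps : R) (r : nat) (s : R)
    (e : {linear A -> B}) (e0 : {linear B -> B0}) :
  tower i i0 Y Y' D T X X' C hasT0 T0 eps -> (0 < r)%N ->
  (forall x, mspan i Y D true T r x) ->
  frobenius_projection i0 X C hasT0 T0 r s e0 ->
  projection i Y D true T r e -> frobenius_projection i Y D true T r s e.
Proof.
move=> tow r0 spanA [spanB proj0 e0Xr e0XC _ _] proj; split=> //.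
- exact: (proj_Yr tow r0 spanA spanB proj proj0 e0Xr).
- exact: (tower_YD tow r0 spanA spanB proj proj0 e0Xr e0XC).
- by move=> x; have := tower_commYX tow r0 spanA spanB proj proj0 e0Xr e0XC 1 x.
- exact: (tower_duality tow r0 spanA spanB proj proj0 e0Xr e0XC).
Qed.

Section TraceFrobenius.
Variables (R : comUnitRingType) (A B : superAlgType R) (i : {linear B -> A}).
Variables (Y Y' D : A) (hasT : bool) (T : A) (r : nat) (s : R) (e : {linear A -> B}).
Variables (ks : seq nat) (super : bool) (tB : {linear B -> R^o}).
Let z := \sum_(k <- ks) Y ^+ k.
Notation commutes := (tr_commutes Y e ks super tB).

(** The rule for [Y] applied to [Y' * x * Y']. *)
Lemma tr_commutes_inv : extension i Y Y' D -> commutes false Y -> commutes false Y'.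
Proof.
move=> ext cY p x hx.
have sg1 p' : ssign R super p' false = 1 by rewrite /ssign andbF; case: super.
have hY' : homog false Y' := homog_inv (ext_homogY ext) (ext_YY' ext) (ext_Y'Y ext).
have hw : homog p (Y' * x * Y').
  by have := homogM (homogM hY' hx) hY'; rewrite addbF.
have E1 : Y' * x * Y' * Y = Y' * x by rewrite -mulrA (ext_Y'Y ext) mulr1.
have E2 : Y * (Y' * x * Y') = x * Y' by rewrite !mulrA (ext_YY' ext) mul1r.
by have := cY _ _ hw; rewrite E1 E2 !sg1 !mul1r => ->.
Qed.

Lemma tr_commutes_trace (L : Type) (ok odd : pred L) (g : L -> A) :
  generated ok odd g -> (forall l, homog (odd l) (g l)) ->
  (forall l, ok l -> commutes (odd l) (g l)) ->
  trace_form super (fun x => tB (e (x * z))).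
Proof.
move=> gen hg cg p q x y hx hy.
suff [] : homog q y /\ commutes q y by move=> _; apply.
apply: (gen (fun q y => homog q y /\ commutes q y)) hy => {p q x y hx}.
- by move=> q; split=> [|p x hx]; [exact: homog0|rewrite mulr0 !mul0r !linear0 mulr0].
- move=> q a x y [hx cx] [hy cy]; split; first exact: homogP.
  move=> p w hw; rewrite mulrDr mulrDl !mulrDl !linearD /= -super_scalerAr -!super_scalerAl.
  rewrite !linearZ /= (cx _ _ hw) (cy _ _ hw) mulrDr; congr (_ + _).
  by rewrite -![_ *: _]/(_ * _) mulrCA.
- split; first exact: homog1.
  by move=> p x hx; rewrite mulr1 mul1r /ssign andbF; case: super; rewrite mul1r.
- move=> p q x y [hx cx] [hy cy]; split; first exact: homogM.
  exact: tr_commutesM.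
- by move=> l hl; split; [exact: hg|exact: cg].
Qed.

Hypotheses (ext : extension i Y Y' D) (hT : homog false T).
Hypothesis frob : frobenius_projection i Y D hasT T r s e.
Hypothesis ks_le : forall k, k \in ks -> (k <= r)%N.
Hypothesis ks_sym : \sum_(k <- ks) Y ^+ (r - k) = \sum_(k <- ks) Y ^+ k.
Hypothesis s_def : s = if super then - 1 else 1.
Hypothesis tB_even : forall x, homog true x -> tB x = 0.
Hypothesis tB_trace : trace_form super tB.

Let eMl := projMl ext (frob_proj frob) (frob_span frob).
Let eMr := projMr ext (frob_proj frob) (frob_span frob).
Let e_homog := proj_homog ext hT (frob_proj frob) (frob_span frob).

Lemma frob_even x : homog true x -> tB (e (x * z)) = 0.
Proof. exact: (tr_even ext e_homog ks tB_even). Qed.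

Lemma frob_commutes_i q h : homog q h -> commutes q (i h).
Proof. exact: (tr_commutes_i ext eMl eMr e_homog ks tB_trace). Qed.

Lemma frob_commutes_Y : commutes false Y.
Proof. exact: (tr_commutes_Y (frob_commY frob) ks super tB). Qed.

Lemma frob_commutes_D : commutes true D.
Proof.
exact: (tr_commutes_D ext e_homog (frob_commY frob) (frob_dual frob) ks_le ks_sym s_def tB_even).
Qed.

End TraceFrobenius.

(** * The trace property by induction on the level *)

Section Standard.
Variables (R : comUnitRingType) (q : R) (ct : cyc_type) (m : nat) (Q : 'I_m -> R).
Local Notation H := (cyc_alg q ct Q).
Local Notation gen := (cyc_gen q ct Q).
Local Notation iota k := (@cyc_map R q ct m Q k : {linear H k -> H k.+1}).
Local Notation r := (cyc_deg ct m).
Local Notation super := (cyc_super ct).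
Local Notation s := (cyc_sign R ct).
Local Notation frob k := (frobenius_projection (iota k) (gen k.+1 (LX k.+1)) (gen k.+1 (LC k.+1))
  (0 < k)%N (gen k.+1 (LT k)) r s).
Hypothesis r_gt0 : (0 < r)%N.
Variables (n : nat) (e : forall k, H k.+1 -> H k).
Hypothesis he : forall k, (k < n)%N -> mackey_projection (@e k).

(* The exponents occurring in X^m and in X^m (1 + X). *)
Definition twist_exps : seq nat := if super then [:: m] else [:: m; m.+1].
Local Notation z k := (\sum_(j <- twist_exps) gen k.+1 (LX k.+1) ^+ j).

Lemma twist_exps_le j : j \in twist_exps -> (j <= r)%N.
Proof.
rewrite /twist_exps /cyc_super; case: (ct) => /=; rewrite !inE -addnn.
  by move/eqP->; apply: leq_addr.
by case/orP=> /eqP ->; rewrite ?ltnS ?leqW // leq_addr.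
Qed.

Lemma twist_exps_sym (A : pzRingType) (X : A) :
  \sum_(j <- twist_exps) X ^+ (r - j) = \sum_(j <- twist_exps) X ^+ j.
Proof.
rewrite /twist_exps /cyc_super; case: (ct) => /=; rewrite -addnn ?big_cons !big_nil !addr0.
  by rewrite addnK.
by rewrite -addSn addnK addSnnS addnK addrC.
Qed.

Lemma level_frobenius k : (k < n)%N ->
  exists2 eL : {linear H k.+1 -> H k}, (eL : H k.+1 -> H k) = @e k & frob k eL.
Proof.
have span j := @cyc_span R q ct m Q r_gt0 j.
have homT j := @cyc_homog_gen R q ct m Q j.+1 (LT j).
elim: k => [|k IH] kn.
  have [eLin _ eX] := he kn; have [eL EL] := linear_bundle eLin.
  exists eL; first exact: EL.
  have proj : projection (iota 0) (gen 1 (LX 1)) (gen 1 (LC 1)) false (gen 1 (LT 0)) r eL.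
    by split; [move=> x y h; exfalso; move: h|rewrite EL; exact: eX].
  have [c hc] := cyc_X1_rel q Q r_gt0.
  exact: (base_frobenius (cyc_extension q ct Q 0) (homT 0) r_gt0 hc (span 0) proj).
have [eLin eT eX] := he kn; have [eL EL] := linear_bundle eLin.
exists eL; first exact: EL.
have [e0 _ g0] := IH (ltnW kn).
have proj : projection (iota k.+1) (gen k.+2 (LX k.+2)) (gen k.+2 (LC k.+2)) true
    (gen k.+2 (LT k.+1)) r eL.
  split; first by move=> x y _; rewrite EL; exact: (eT isT).
  by rewrite EL; exact: eX.
exact: (tower_frobenius (cyc_tower q ct Q k) r_gt0 (span k.+1) g0 proj).
Qed.

(** The twist enters level by level, so that each step of the induction meets only the factor in its
    own X_k; [twisted_formE] collects the factors into a single one. *)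
Fixpoint twisted_form k : H k -> R :=
  if k is j.+1 return H k -> R then fun x => twisted_form (e (x * z j)) else id.

Lemma compose_linear k : (k <= n)%N ->
  exists tL : {linear H k -> R^o}, (tL : H k -> R) = @compose_projections R q ct m Q e k.
Proof.
elim: k => [|k IH] kn; first by apply: (@linear_bundle R R^o R^o id) => a x y.
have [tL EL] := IH (ltnW kn); have [eLin _ _] := he kn.
have [|fL EfL] := @linear_bundle R (H k.+1) R^o (fun x => tL (e x)).
  by move=> a x y; rewrite eLin linearP.
by exists fL; rewrite EfL EL.
Qed.

Lemma level_commutes_T k (eL : {linear H k.+2 -> H k.+1})
    (tB : {linear H k.+1 -> R^o}) (t0 : {linear H k -> R^o}) : (k < n)%N ->
  frob k.+1 eL -> (tB : H k.+1 -> R) = @twisted_form k.+1 -> (t0 : H k -> R) = @twisted_form k ->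
  (forall x, homog true x -> tB x = 0) -> trace_form super tB ->
  tr_commutes (gen k.+2 (LX k.+2)) eL twist_exps super tB false (gen k.+2 (LT k.+1)).
Proof.
move=> kn [spanA proj _ _ _ _] EB E0 tB_even tB_trace p x hx.
have [e0 EL0 [spanB proj0 e0Xr e0XC _ _]] := level_frobenius kn.
have sym := twist_exps_sym (gen k.+2 (LX k.+2)).
have tB_def y : tB y = t0 (e0 (y * z k)) by rewrite EB E0 EL0.
have sg : ssign R super p false = 1 by rewrite /ssign andbF; case: super.
rewrite sg mul1r.
exact: (tower_traceT (cyc_tower q ct Q k) r_gt0 spanA spanB proj proj0 e0Xr e0XC
  twist_exps_le sym erefl tB_even tB_trace tB_def x).
Qed.

(** The induction is strong because of the generator T_k of H_{k+1}: [tower_traceT] needs the form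
    on H_{k-1} besides the one on H_k. *)
Lemma twisted_trace k : (k <= n)%N ->
  exists2 tL : {linear H k -> R^o}, (tL : H k -> R) = @twisted_form k &
    (forall x, homog true x -> tL x = 0) /\ trace_form super tL.
Proof.
have homT j := @cyc_homog_gen R q ct m Q j.+1 (LT j).
elim/ltn_ind: k => -[|k] IH kn.
  have [|tL EL] := @linear_bundle R R^o R^o id; first by move=> a x y.
  exists tL => //; split; rewrite EL; first by move=> x hx; exact: hx isT.
  move=> p p' x y hx hy; rewrite mulrC /ssign; case: super; last by rewrite mul1r.
  case: p hx => [hx|_]; last by rewrite mul1r.
  by rewrite (hx isT) mulr0 mulr0.
have [tB EB [tB_even tB_trace]] := IH k (ltnSn k) (ltnW kn).
have [eL EL g] := level_frobenius kn.
have ext := cyc_extension q ct Q k.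
have [|tA EA] := @linear_bundle R (H k.+1) R^o (fun x => tB (eL (x * z k))).
  by move=> a x y; rewrite mulrDl -super_scalerAl !linearP.
exists tA; first by rewrite EA EB EL.
have sym := twist_exps_sym (gen k.+1 (LX k.+1)).
rewrite EA; split.
  by move=> x hx; exact: (frob_even twist_exps ext (homT k) g tB_even hx).
have cY := frob_commutes_Y twist_exps super tB g.
have cD := frob_commutes_D ext (homT k) g twist_exps_le sym erefl tB_even.
have cY' := tr_commutes_inv ext cY.
have ci := frob_commutes_i twist_exps ext (homT k) g tB_trace.
apply: (tr_commutes_trace (@cyc_generated R q ct m Q k.+1) 
  (@cyc_homog_gen R q ct m Q k.+1)) => l hl.
have [hl'|hl'] := boolP (letter_ok k l).
  rewrite -(cyc_map_gen q ct Q hl'); apply: ci; exact: cyc_homog_gen.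
have E j : (0 < j <= k.+1)%N -> ~~ (0 < j <= k)%N -> j = k.+1.
  case/andP=> -> h1; rewrite /= -ltnNge => h2.
  by apply/eqP; rewrite eqn_leq h1 h2.
case: l hl hl' => j hj hj'.
- have jk : j = k.
    apply/eqP; rewrite eqn_leq -ltnS; case/andP: hj => j0 -> /=.
    by move: hj'; rewrite /= j0 /= -leqNgt.
  rewrite jk in hj *; clear j E jk hj'.
  have k0 : (0 < k)%N by case/andP: hj.
  (* T_k is an admissible letter only for [k] > 0, so there is a level below H_k to which the
     induction hypothesis applies. *)
  case: k k0 kn IH tB EB tB_even tB_trace eL EL g {ext tA EA sym cY cD cY' ci homT hj}
    => // k _ kn IH tB EB tB_even tB_trace eL EL g.
  have [t0 E0 _] := IH k (leqnSn _) (ltnW (ltnW kn)).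
  exact: (level_commutes_T (ltnW kn) g EB E0 tB_even tB_trace).
- by rewrite (E j hj hj'); exact: cY.
- by rewrite (E j hj hj'); exact: cY'.
- by rewrite (E j hj hj'); exact: cD.
Qed.

End Standard.

(** * The twist as a product, and bases at every level *)

Section TwistStep.
Variables (R : comUnitRingType) (A B : superAlgType R) (i : {linear B -> A}) (Y Y' D : A).
Hypothesis ext : extension i Y Y' D.

Lemma ext_X a j : i (a ^+ j) = i a ^+ j.
Proof. by elim: j => [|j IH]; rewrite ?(ext_1 ext) // !exprS (ext_M ext) IH. Qed.

Lemma twist_step_super a j : i (a ^+ j) * Y ^+ j = (i a * Y) ^+ j.
Proof. by rewrite exprMn_comm ?ext_X //; apply: ext_commY ext _. Qed.

Lemma twist_step_sym a b j :
  i (a ^+ j * b) * (Y ^+ j + Y ^+ j.+1) = (i a * Y) ^+ j * (i b * (1 + Y)).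
Proof.
rewrite -twist_step_super (ext_M ext) -!mulrA; congr (_ * _).
have -> : Y ^+ j + Y ^+ j.+1 = Y ^+ j * (1 + Y) by rewrite mulrDr mulr1 -exprSr.
by rewrite !mulrA (ext_commYX ext).
Qed.

Lemma twist_step_inv a a' : a * a' = 1 -> a' * a = 1 ->
  (i a * Y) * (Y' * i a') = 1 /\ (Y' * i a') * (i a * Y) = 1.
Proof.
move=> aa' a'a; split.
  by rewrite -mulrA (mulrA Y) (ext_YY' ext) mul1r -(ext_M ext) aa' (ext_1 ext).
by rewrite -mulrA (mulrA (i a')) -(ext_M ext) a'a (ext_1 ext) mul1r (ext_Y'Y ext).
Qed.

Lemma prod_step (F : nat -> B) (G : nat -> A) k :
  (forall j, (0 < j <= k)%N -> i (F j) = G j) ->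
  \prod_(1 <= j < k.+2) G j = i (\prod_(1 <= j < k.+1) F j) * G k.+1.
Proof.
move=> FG; rewrite big_nat_recr //=; congr (_ * _).
rewrite (big_morph i (ext_M ext) (ext_1 ext)).
rewrite big_nat_cond [RHS]big_nat_cond; apply: eq_bigr => j; rewrite andbT => hj.
by rewrite FG.
Qed.

Variable e : {linear A -> B}.
Hypothesis eMr : forall h x, e (x * i h) = e x * h.

Lemma proj_twist x b w : i b * w = w * i b -> e (x * (i b * w)) = e (x * w) * b.
Proof. by move=> ->; rewrite mulrA eMr. Qed.

End TwistStep.

Section Standard.
Variables (R : comUnitRingType) (q : R) (ct : cyc_type) (m : nat) (Q : 'I_m -> R).
Local Notation H := (cyc_alg q ct Q).
Local Notation gen := (cyc_gen q ct Q).
Local Notation iota k := (@cyc_map R q ct m Q k : {linear H k -> H k.+1}).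
Local Notation r := (cyc_deg ct m).
Local Notation super := (cyc_super ct).
Local Notation s := (cyc_sign R ct).
Local Notation z k := (\sum_(j <- twist_exps ct m) gen k.+1 (LX k.+1) ^+ j).

Fixpoint twist k : H k := if k is j.+1 return H k then iota j (twist j) * z j else 1.

Definition prodX k := \prod_(1 <= j < k.+1) gen k (LX j).
Definition prodX1 k := \prod_(1 <= j < k.+1) (1 + gen k (LX j)).

Lemma prodXS k : prodX k.+1 = iota k (prodX k) * gen k.+1 (LX k.+1).
Proof.
apply: (prod_step (cyc_extension q ct Q k) (F := fun j => gen k (LX j))
  (G := fun j => gen k.+1 (LX j))) => j hj.
exact: (@cyc_map_gen R q ct m Q k (LX j) hj).
Qed.

Lemma prodX1S k : prodX1 k.+1 = iota k (prodX1 k) * (1 + gen k.+1 (LX k.+1)).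
Proof.
apply: (prod_step (cyc_extension q ct Q k) (F := fun j => 1 + gen k (LX j))
  (G := fun j => 1 + gen k.+1 (LX j))) => j hj.
have E := @cyc_map_gen R q ct m Q k (LX j) hj.
have E1 := @cyc_map1 R q ct m Q k.
exact: (etrans (linearD (iota k) 1 (gen k (LX j))) (congr2 +%R E1 E)).
Qed.

Lemma prodX_inv k : exists u, prodX k * u = 1 /\ u * prodX k = 1.
Proof.
elim: k => [|k [u [h1 h2]]].
  by exists 1; rewrite /prodX big_geq // mulr1.
have [E1 E2] := twist_step_inv (cyc_extension q ct Q k) h1 h2.
by exists (gen k.+1 (LXinv k.+1) * iota k u); rewrite prodXS; split; [exact: E1|exact: E2].
Qed.

Lemma twistE k : twist k = prodX k ^+ m * (if super then 1 else prodX1 k).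
Proof.
elim: k => [|k IH].
  by rewrite /prodX /prodX1 !big_geq // expr1n; case: super; rewrite mulr1.
have ext := cyc_extension q ct Q k.
rewrite [LHS]/= IH prodXS prodX1S /twist_exps; case: super.
  rewrite big_seq1 !mulr1; exact: (twist_step_super ext).
rewrite big_cons big_seq1; exact: (twist_step_sym ext).
Qed.

Lemma twist_homog k : homog false (twist k).
Proof.
elim: k => [|k IH]; first exact: homog1.
exact: (homogM (cyc_map_homog IH) (trz_homog (cyc_extension q ct Q k) _)).
Qed.

Hypothesis r_gt0 : (0 < r)%N.
Variables (n : nat) (e : forall k, H k.+1 -> H k).
Hypothesis he : forall k, (k < n)%N -> mackey_projection (@e k).

Lemma cyc_sign_unit : s \is a GRing.unit.
Proof. by apply/unitrP; exists s; rewrite cyc_sign2. Qed.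

Lemma level_frame k : (k < n)%N -> exists M : seq (H k.+1 * H k.+1),
  triangular (@e k) M /\ forall x, rspan (iota k) M x.
Proof.
elim: k => [|k IH] kn; have [eL <- g] := level_frobenius r_gt0 he kn.
  have ext := cyc_extension q ct Q 0.
  exists (frame (gen 1 (LX 1)) (gen 1 (LC 1)) r r); split; last first.
    by move=> x; exact: (frame_rspan (frob_span g x)).
  apply: (frame_triangular ext r_gt0 cyc_sign_unit _ (frob_Yr g) (frob_YD g) (leqnn r)).
  move=> j hj; have := projYD ext (frob_proj g) false hj.
  by rewrite mulr1 andbT.
have [e0 E0 g0] := level_frobenius r_gt0 he (ltnW kn).
have [M [triM spanM]] := IH (ltnW kn); rewrite -E0 in triM.
have tow := cyc_tower q ct Q k.
exists (tower_frame (iota k.+1) (gen k.+2 (LX k.+2)) (gen k.+2 (LC k.+2)) (gen k.+2 (LT k.+1)) r M).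
split; last exact: (tower_frame_rspan tow (frob_span g) spanM).
exact: (tower_frame_triangular tow r_gt0 (frob_span g) (frob_span g0) (frob_proj g) (frob_proj g0)
  cyc_sign_unit (frob_Yr g0) (frob_YD g0) triM).
Qed.

(** Starts from the pair (1, 1) over R and composes with one frame per level;
    [triangular_nondegenerate] later extracts freeness from it. *)
Lemma level_basis k : (k <= n)%N -> exists N : seq (H k * H k),
  triangular (B := R^o) (@compose_projections R q ct m Q e k) N /\ forall x, lspan N x.
Proof.
elim: k => [|k IH] kn.
  exists [:: (1, 1)]; split; last first.
    move=> x; have E : x *: (1 : H 0) = x := mulr1 (x : R).
    rewrite -E; exact: (@lspanZ R (H 0) [:: (1, 1)] (1, 1) x (mem_head _ _)).
  split=> //.
    move=> p; rewrite inE => /eqP -> /=.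
    by exists 1; rewrite ?unitr1 // mulr1 scale1r.
  by move=> p; rewrite inE => /eqP -> /=; exists false; exact: homog1.
have [tL EL] := compose_linear he (ltnW kn).
have [N [triN spanN]] := IH (ltnW kn); rewrite -EL in triN.
have [M [triM spanM]] := level_frame kn.
have [eL Ee g] := level_frobenius r_gt0 he kn; rewrite -Ee in triM.
have ext := cyc_extension q ct Q k.
have eMl := projMl ext (frob_proj g) (frob_span g).
have eMr := projMr ext (frob_proj g) (frob_span g).
exists [seq pair_mul (iota k) p c | p <- M, c <- N]; split.
  have := triangular_comp (@cyc_map_homog R q ct m Q k) eMl eMr triM triN.
  by rewrite EL Ee.
exact: (lspan_comp spanM spanN).
Qed.

Lemma twisted_formE k x : (k <= n)%N ->
  twisted_form e x = compose_projections e (x * twist k).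
Proof.
elim: k x => [|k IH] x kn; first by rewrite /= mulr1.
have [eL Ee g] := level_frobenius r_gt0 he kn.
have ext := cyc_extension q ct Q k.
have eMr := projMr ext (frob_proj g) (frob_span g).
have c : iota k (twist k) * z k = z k * iota k (twist k).
  by symmetry; exact: (trz_comm ext).
have E := proj_twist eMr x c; rewrite Ee in E.
exact: (etrans (IH _ (ltnW kn)) (congr1 (@compose_projections R q ct m Q e k) (esym E))).
Qed.

End Standard.

(** Covers r = 0, where f = 1 and the quotient is zero: the empty family is a basis with Gram
    determinant 1. *)
Lemma trivial_form (R : comUnitRingType) (A : superAlgType R) (super : bool) (t : A -> R) :
  (1 : A) = 0 -> t 0 = 0 ->
  [/\ scalar t, even_form t, Defs.nondegenerate t & trace_form super t].
Proof.
move=> A0 t0; have x0 (x : A) : x = 0 by rewrite -[x]mulr1 A0 mulr0.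
split.
- by move=> a x y; rewrite [X in t X = _]x0 (x0 x) (x0 y) t0 mulr0 addr0.
- by move=> x _; rewrite (x0 x).
- exists 0%N, (fun=> 0); split=> //; last by rewrite det_mx00 unitr1.
  + move=> x; exists [ffun=> 0]; split; first by rewrite big_ord0 (x0 x).
    by move=> c _; apply/ffunP => -[j hj]; exfalso; move: hj; rewrite ltn0.
  + by move=> [j hj]; exfalso; move: hj; rewrite ltn0.
- by move=> p q x y _ _; rewrite (x0 (x * y)) (x0 (y * x)) t0 mulr0.
Qed.

Lemma trace_form_sym (R : comUnitRingType) (A : superAlgType R) (t : A -> R) :
  scalar t -> trace_form false t -> forall x y, t (x * y) = t (y * x).
Proof.
move=> tL tT x y; have tD u v : t (u + v) = t u + t v.
  by have := tL 1 u v; rewrite scale1r mul1r.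
have h p r u v : homog p u -> homog r v -> t (u * v) = t (v * u).
  by move=> hu hv; rewrite (tT _ _ _ _ hu hv) mul1r.
have [x0 [x1 [hx0 hx1 ->]]] := homog_split x.
have [y0 [y1 [hy0 hy1 ->]]] := homog_split y.
rewrite !(mulrDl, mulrDr) !tD (h _ _ _ _ hx0 hy0) (h _ _ _ _ hx0 hy1).
by rewrite (h _ _ _ _ hx1 hy0) (h _ _ _ _ hx1 hy1) addrACA.
Qed.

(** * The properties of the twisted form, for both cases at once *)

Section Main.
Variables (R : comUnitRingType) (q : R) (ct : cyc_type) (m : nat) (Q : 'I_m -> R).
Local Notation H := (cyc_alg q ct Q).
Local Notation tw := (@twist R q ct m Q).

Lemma cyc_alg_trivial n : (0 < n)%N -> cyc_deg ct m = 0%N -> (1 : H n) = 0.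
Proof.
case: n => [|k] n0 r0; first by exfalso; move: n0.
have := @cyc_poly0 R q ct m Q k.
move: r0; rewrite /cyc_deg; case: (ct) => // /eqP; rewrite double_eq0 => /eqP m0.
rewrite mul1r big1; first by [].
by move=> [j hj]; exfalso; move: hj; rewrite m0.
Qed.

Lemma twisted_form_spec n (tau : H n -> R) (u : H n) :
  standard_Frobenius_form tau -> (0 < n)%N -> tw n * u = 1 -> u * tw n = 1 ->
  [/\ scalar (fun h : H n => tau (h * tw n)), even_form (fun h : H n => tau (h * tw n)),
      Defs.nondegenerate (fun h : H n => tau (h * tw n))
    & trace_form (cyc_super ct) (fun h : H n => tau (h * tw n))].
Proof.
case=> e [he /boolp.funext ->] n0 tu ut.
have [cL EL] := compose_linear he (leqnn n).
(* r = 0 occurs only in case 0 with [m] = 0. *)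
have [r0|r_gt0] := posnP (cyc_deg ct m).
  rewrite -EL; apply: trivial_form (cyc_alg_trivial n0 r0) _.
  by rewrite mul0r linear0.
have [N [triN spanN]] := level_basis r_gt0 he (leqnn n).
have [tL Et [tE tT]] := twisted_trace r_gt0 he (leqnn n).
have E : (fun h : H n => compose_projections e (h * tw n)) = tL.
  by rewrite Et; apply: boolp.funext => h; rewrite (twisted_formE r_gt0 he).
split.
- by rewrite E => a x y; exact: linearP.
- by rewrite E; exact: tE.
- rewrite -EL in triN *.
  exact: (triangular_nondegenerate tu ut (twist_homog q ct Q n) triN spanN).
- by rewrite E; exact: tT.
Qed.

End Main.

Theorem theorem1p2 (R : idomainType) (hR : 2%N \notin [pchar R])
    (q : R) (q_unit : q \is a GRing.unit) (q_neq1 : q != 1) (q_neqN1 : q != -1)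
    (qq_unit : q + q^-1 \is a GRing.unit)
    (n : nat) (n_gt0 : (0 < n)%N) (m : nat)
    (Q : 'I_m -> R) (Q_unit : forall i, Q i \is a GRing.unit) :
  (forall tau : cyc_alg q cyc_0 Q n -> R,
     standard_Frobenius_form tau ->
     supersymmetrizing_form (fun h : cyc_alg q cyc_0 Q n =>
       tau (h * (\prod_(1 <= i < n.+1) cyc_gen q cyc_0 Q n (LX i)) ^+ m)))
  /\
  (forall tau : cyc_alg q cyc_s Q n -> R,
     standard_Frobenius_form tau ->
     (exists y : cyc_alg q cyc_s Q n,
        y * \prod_(1 <= i < n.+1) (1 + cyc_gen q cyc_s Q n (LX i)) = 1 /\
        (\prod_(1 <= i < n.+1) (1 + cyc_gen q cyc_s Q n (LX i))) * y = 1) ->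
     symmetrizing_form (fun h : cyc_alg q cyc_s Q n =>
       tau (h * ((\prod_(1 <= i < n.+1) cyc_gen q cyc_s Q n (LX i)) ^+ m *
                 \prod_(1 <= i < n.+1) (1 + cyc_gen q cyc_s Q n (LX i)))))).
Proof.
have X_pow_inv (A : pzRingType) (x u : A) : x * u = 1 -> u * x = 1 ->
    x ^+ m * u ^+ m = 1 /\ u ^+ m * x ^+ m = 1.
  move=> xu ux; have c : GRing.comm x u by rewrite /GRing.comm xu ux.
  by rewrite -(exprMn_comm _ c) -(exprMn_comm _ (commr_sym c)) xu ux expr1n.
split=> tau htau.
  have [u [xu ux]] := prodX_inv q cyc_0 Q n.
  have [h1 h2] := X_pow_inv _ _ _ xu ux.
  have E : twist q cyc_0 Q n = prodX q cyc_0 Q n ^+ m.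
    by have := twistE q cyc_0 Q n; rewrite /= mulr1.
  rewrite -E in h1 h2.
  have [sc ev nd tr] := twisted_form_spec htau n_gt0 h1 h2.
  rewrite E in sc ev nd tr.
  by split; [exact: sc|exact: ev|exact: nd|exact: tr].
case=> y [yP Py].
have [u [xu ux]] := prodX_inv q cyc_s Q n.
have [h1 h2] := X_pow_inv _ _ _ xu ux.
have E : twist q cyc_s Q n = prodX q cyc_s Q n ^+ m * prodX1 q cyc_s Q n.
  exact: (twistE q cyc_s Q n).
(* The assumed inverse [y] of the product of the 1 + X_i enters here: with it the twist is a unit,
   and nondegeneracy passes from [tau] to the twisted form. *)
have k1 : twist q cyc_s Q n * (y * u ^+ m) = 1.
  by rewrite E -mulrA (mulrA (prodX1 _ _ _ _)) Py mul1r h1.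
have k2 : (y * u ^+ m) * twist q cyc_s Q n = 1.
  by rewrite E -mulrA (mulrA (u ^+ m)) h2 mul1r yP.
have [sc ev nd tr] := twisted_form_spec htau n_gt0 k1 k2.
rewrite E in sc ev nd tr.
by split; [exact: sc|exact: ev|exact: nd|exact: (trace_form_sym sc tr)].
Qed.
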